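(* Let $n\ge 3$, $p,q>1$, let $B\subset\mathbb{R}^n$ be an open ball centered at the origin, and let $a,b\in\mathbb{R}$ satisfy $$ a,b>-n,\qquad \frac{a+n}{p}+\frac{b+n}{q}>n-2. $$ Then there exist $\lambda_1,\lambda_2>0$ such that the problem $$ \begin{cases} -\Delta u=\lambda_1|x|^a v^{p-1} & \text{in } B\\ -\Delta v=\lambda_2|x|^b u^{q-1} & \text{in } B\\ u,v>0 & \text{in } B\\ u=v=0 & \text{on } \partial B \end{cases} $$ has at least one radial solution $u,v$ satisfying $$ u,v\in W^{2,1}(B)\cap W^{1,1}_0(B),\qquad \int_B|x|^b|u|^q\,dx<\infty,\qquad \int_B|x|^a|v|^p\,dx<\infty . $$
   Context: $W^{2,1}(B)$ and $W^{1,1}_0(B)$ are the usual Sobolev spaces. The equations are understood in the weak sense (equivalently, almost everywhere in $B$, since $u,v\in W^{2,1}(B)$), and the boundary condition is understood as $u,v\in W^{1,1}_0(B)$. ''Radial'' means that $u$ and $v$ depend only on $|x|$. *)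

(* Defs.v *)
From HB Require Import structures.
From mathcomp Require Import all_boot all_order all_algebra.
From mathcomp Require Import all_classical all_reals all_analysis.

Set Implicit Arguments.
Unset Strict Implicit.
Unset Printing Implicit Defensive.
Import Order.TTheory GRing.Theory Num.Theory.
Import numFieldNormedType.Exports.
Local Open Scope classical_set_scope.
Local Open Scope ring_scope.

(* The sigma-algebra on R^n generated by the coordinates, i.e. the Borel
   sigma-algebra of R^n. *)
Definition rowvec_display : measure_display -> measure_display.
Proof. exact. Qed.

Section measurable_rowvec.
Context {R : realType} {n : nat}.

Definition rowvec_coord (i : 'I_n) (x : 'rV[R]_n) : measurableTypeR R :=
  x ord0 i.

Let rowvec_set0 : g_sigma_preimage rowvec_coord set0.
Proof. exact: sigma_algebra0. Qed.

Let rowvec_setC A :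
  g_sigma_preimage rowvec_coord A -> g_sigma_preimage rowvec_coord (~` A).
Proof. exact: sigma_algebraC. Qed.

Let rowvec_bigcup (F : (set 'rV[R]_n)^nat) :
  (forall i, g_sigma_preimage rowvec_coord (F i)) ->
  g_sigma_preimage rowvec_coord (\bigcup_i (F i)).
Proof. exact: sigma_algebra_bigcup. Qed.

HB.instance Definition _ := @isMeasurable.Build (rowvec_display R.-ocitv.-measurable.-sigma)
  'rV[R]_n (g_sigma_preimage rowvec_coord) rowvec_set0 rowvec_setC rowvec_bigcup.

End measurable_rowvec.

Lemma measurable_rowvec_coord (R : realType) n (i : 'I_n) :
  measurable_fun [set: 'rV[R]_n] (@rowvec_coord R n i).
Proof.
move=> _ Y mY; rewrite setTI; apply: sub_sigma_algebra => /=.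
rewrite -bigcup_seq/=; exists i => /=; first by rewrite mem_index_enum.
by exists Y => //; rewrite setTI.
Qed.

Lemma measurable_fun_rowvecP (R : realType) d (T : measurableType d) n
    (f : T -> 'rV[R]_n) :
  (forall i, measurable_fun [set: T] (rowvec_coord i \o f)) ->
  measurable_fun [set: T] f.
Proof.
move=> mf.
suff H : g_sigma_preimage (fun i => @rowvec_coord R n i \o f) `<=` measurable.
  by move=> _ A mA; apply: H; rewrite g_sigma_preimage_comp; exists A.
apply: smallest_sub; first exact: sigma_algebra_measurable.
case: n f mf => [|n] f mf; first by rewrite big_ord0.
rewrite -bigcup_mkord_ord; apply: bigcup_sub => i Ii.
by move=> A [B mB <-]; exact: mf.
Qed.

Section lebesgue_rowvec.
Context {R : realType}.

Definition rowvec_cons n (xy : measurableTypeR R * 'rV[R]_n) : 'rV[R]_n.+1 :=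
  row_mx (xy.1 : R)%:M xy.2.

Definition rowvec_uncons n (z : 'rV[R]_n.+1) : measurableTypeR R * 'rV[R]_n :=
  (rowvec_coord ord0 z, \row_j rowvec_coord (lift ord0 j) z).

Lemma rowvec_cons0 n xy : @rowvec_cons n xy ord0 ord0 = xy.1.
Proof.
rewrite /rowvec_cons mxE; case: splitP => [j _|//].
by rewrite mxE !ord1 eqxx mulr1n.
Qed.

Lemma rowvec_consS n xy j : @rowvec_cons n xy ord0 (lift ord0 j) = xy.2 ord0 j.
Proof.
rewrite /rowvec_cons mxE; case: splitP => [[k /= k1] jk|k /= [jk]].
  by move: k1; rewrite -jk.
by congr (xy.2 _ _); exact/val_inj.
Qed.

Lemma rowvec_consK n : cancel (@rowvec_cons n) (@rowvec_uncons n).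
Proof.
move=> [x y]; rewrite /rowvec_uncons /rowvec_coord rowvec_cons0; congr pair.
by apply/rowP => j; rewrite mxE rowvec_consS.
Qed.

Lemma measurable_rowvec_cons n : measurable_fun setT (@rowvec_cons n).
Proof.
apply: measurable_fun_rowvecP => i; rewrite /rowvec_coord /comp.
case: (unliftP ord0 i) => [j|] ->.
  rewrite (_ : (fun _ => _) = @rowvec_coord R n j \o snd).
    by apply: measurableT_comp => //; exact: measurable_rowvec_coord.
  by apply/funext => xy /=; rewrite rowvec_consS.
rewrite (_ : (fun _ => _) = fst)//.
by apply/funext => xy /=; rewrite rowvec_cons0.
Qed.

Lemma measurable_rowvec_uncons n : measurable_fun setT (@rowvec_uncons n).
Proof.
apply/measurable_fun_pair; first exact: measurable_rowvec_coord.
apply: measurable_fun_rowvecP => j.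
rewrite (_ : _ \o _ = @rowvec_coord R n.+1 (lift ord0 j)).
  exact: measurable_rowvec_coord.
by apply/funext => z /=; rewrite /rowvec_coord mxE.
Qed.

Section step.
Variables (n : nat) (m : {sigma_finite_measure set 'rV[R]_n -> \bar R}).

Definition lebesgue_step : set 'rV[R]_n.+1 -> \bar R :=
  pushforward (lebesgue_measure \x m)%E (@rowvec_cons n).

HB.instance Definition _ := Measure.copy lebesgue_step
  (measure_function_pushforward__canonical__measure_function_Measure
     (lebesgue_measure \x m)%E (@measurable_rowvec_cons n)).

Lemma lebesgue_step_sigma_finite : sigma_finite setT lebesgue_step.
Proof.
have /sigma_finiteP[F [TF ndF Foo]] := sigma_finiteT (@lebesgue_measure R).
have /sigma_finiteP[G [TG ndG Goo]] := sigma_finiteT m.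
exists (fun k => @rowvec_uncons n @^-1` (F k `*` G k)).
  rewrite -preimage_bigcup (_ : \bigcup_i _ = setT) ?preimage_setT//.
  apply/seteqP; split=> // -[x y] _.
  have [i _ Fx] : (\bigcup_i F i) x by rewrite -TF.
  have [j _ Gy] : (\bigcup_j G j) y by rewrite -TG.
  exists (maxn i j) => //; split.
  - by move: x Fx; exact/subsetPset/ndF/leq_maxl.
  - by move: y Gy; exact/subsetPset/ndG/leq_maxr.
move=> k; have [mF Fk] := Foo k; have [mG Gk] := Goo k; split.
  rewrite -[X in measurable X]setTI; apply: measurable_rowvec_uncons => //.
  exact: measurableX.
rewrite /lebesgue_step /pushforward -comp_preimage.
rewrite (_ : _ \o _ = id); last by apply/funext => x; exact: rowvec_consK.
rewrite preimage_id product_measure1E//.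
by rewrite lte_mul_pinfty// ge0_fin_numE.
Qed.

HB.instance Definition _ := Measure_isSigmaFinite.Build _ _ _ lebesgue_step
  lebesgue_step_sigma_finite.

End step.

(* n-dimensional Lebesgue measure, as the n-fold product of the
   one-dimensional one. *)
Fixpoint lebesgue_rV n : {sigma_finite_measure set 'rV[R]_n -> \bar R} :=
  if n is n'.+1 then lebesgue_step (lebesgue_rV n') else dirac (0 : 'rV[R]_0).

End lebesgue_rowvec.

Lemma lebesgue_rV_box (R : realType) n (A : 'I_n -> set (measurableTypeR R)) :
  (forall i, measurable (A i)) ->
  lebesgue_rV n [set x | forall i, A i (rowvec_coord i x)] =
  (\prod_(i < n) lebesgue_measure (A i))%E.
Proof.
elim: n A => [|n ih] A mA.
  by rewrite big_ord0 /= diracE mem_set// => -[].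
rewrite big_ord_recl -ih//=.
rewrite /lebesgue_step /pushforward.
rewrite (_ : _ @^-1` _ = A ord0 `*`
    [set y : 'rV[R]_n | forall i, A (lift ord0 i) (rowvec_coord i y)]).
  rewrite product_measure1E//.
  rewrite (_ : [set _ | _] = \bigcap_(i in [set: 'I_n])
      (rowvec_coord i @^-1` A (lift ord0 i))); last first.
    by apply/seteqP; split => y /= h i *; exact: h.
  apply: fin_bigcap_measurable => // i _.
  by rewrite -[X in measurable X]setTI; exact: measurable_rowvec_coord.
apply/seteqP; split => -[x y] /=.
  move=> h; split; first by have := h ord0; rewrite /rowvec_coord rowvec_cons0.
  by move=> i; have := h (lift ord0 i); rewrite /rowvec_coord rowvec_consS.
move=> [h0 h] i; rewrite /rowvec_coord.
case: (unliftP ord0 i) => [j|] ->; last by rewrite rowvec_cons0.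
by rewrite rowvec_consS; exact: h.
Qed.

(* The norm of 'rV[R]_n provided by the library is the sup norm. *)
Definition enorm (R : realType) n (x : 'rV[R]_n) : R :=
  Num.sqrt (\sum_i x ord0 i ^+ 2).

Definition eball (R : realType) n (r : R) : set 'rV[R]_n :=
  [set x | enorm x < r].

Section sobolev.
Context {R : realType} {n : nat}.
Implicit Types (U : set 'rV[R]_n) (f g u phi : 'rV[R]_n -> R).

Definition partial (i : 'I_n) f : 'rV[R]_n -> R :=
  'D_(delta_mx ord0 i : 'rV[R]_n) f.

(* Multi-indices are sequences of directions. *)
Definition partials (s : seq 'I_n) f : 'rV[R]_n -> R := foldr partial f s.

Definition smooth f := forall s : seq 'I_n,
  continuous (partials s f) /\
  forall (i : 'I_n) x, derivable (partials s f) x (delta_mx ord0 i).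

Definition test_function U phi :=
  [/\ smooth phi, compact (closure [set x | phi x != 0]) &
      closure [set x | phi x != 0] `<=` U].

Definition L1 U f := (lebesgue_rV n).-integrable U (EFin \o f).

Definition L1loc U f := forall K, compact K -> K `<=` U -> L1 K f.

Definition weak_partials U (s : seq 'I_n) u g :=
  [/\ L1loc U u, L1loc U g & forall phi, test_function U phi ->
    \int[lebesgue_rV n]_(x in U) (u x * partials s phi x) =
    (-1) ^+ size s * \int[lebesgue_rV n]_(x in U) (g x * phi x)].

(* W^{k,1}(U) *)
Definition W1 (k : nat) U u := L1 U u /\
  forall s : seq 'I_n, (size s <= k)%N ->
    exists2 g, L1 U g & weak_partials U s u g.

(* W^{1,1}_0(U), the closure of the test functions in W^{1,1}(U) *)
Definition W11_0 U u := L1 U u /\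
  exists Du : 'I_n -> 'rV[R]_n -> R,
    (forall i, L1 U (Du i) /\ weak_partials U [:: i] u (Du i)) /\
    forall e : R, 0 < e -> exists2 phi, test_function U phi &
      (\int[lebesgue_rV n]_(x in U) `|u x - phi x|%:E +
       \sum_(i < n) \int[lebesgue_rV n]_(x in U) `|Du i x - partial i phi x|%:E
       < e%:E)%E.

(* u is a weak solution of - Laplacian u = f in U. *)
Definition weak_poisson U u f := L1loc U f /\
  exists Du : 'I_n -> 'rV[R]_n -> R,
    (forall i, weak_partials U [:: i] u (Du i)) /\
    forall phi, test_function U phi ->
      \int[lebesgue_rV n]_(x in U) (\sum_(i < n) Du i x * partial i phi x) =
      \int[lebesgue_rV n]_(x in U) (f x * phi x).

Definition radial_on U u := exists w : R -> R, forall x, U x -> u x = w (enorm x).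

End sobolev.

(* Main.v *)
(* For functions of t = |x|^2 the system reads, with nu = n/2, c = nu + a/2 and
   d = nu + b/2, U = K (t^(c-1) V^(p-1)) and V = l K (t^(d-1) U^(q-1)), where K is
   the Green operator of U |-> - (t^nu U')'. We maximize the integral of
   t^(d-1) (K (t^(c-1) V^(p-1)))^q over V >= 0 with the integral of t^(c-1) V^p at
   most 1. The hypothesis on a, b gives exponents al < d/q and be < c/p with
   nu - 1 <= c/p + al and nu - 1 <= d/q + be; then K (t^(c-1) V^(p-1)) is
   O(t^(-al)) uniformly in V, so the supremum is finite, and, the images being
   equicontinuous, those of a maximizing sequence converge pointwise to some U.
   With W = K (t^(d-1) U^(q-1)), symmetry of K and two applications of Young's
   inequality, whose equality cases must occur, show that U and a multiple of W
   solve the radial system.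

   The resulting functions of x are C^2 off the origin, with derivatives of order
   at most 2 dominated by integrable powers of |x|; as n >= 2, integrating by parts
   on the lines missing the origin shows that these are the weak derivatives.
   Smoothing t^nu U' and cutting it off near 0 and near the sphere gives test
   functions converging to u in W^{1,1}. *)
Require Import Defs.
From mathcomp Require Import all_boot all_order all_algebra.
From mathcomp Require Import all_classical all_reals all_analysis.
From mathcomp Require Import measurable_realfun ring lra.
Import Order.TTheory GRing.Theory Num.Theory.
Import numFieldNormedType.Exports.
Local Open Scope classical_set_scope.
Local Open Scope ring_scope.
Set Implicit Arguments.
Unset Strict Implicit.
Unset Printing Implicit Defensive.

(** * Young inequality, triangular Tonelli and power integrals *)

(** All data are nonnegative, so Tonelli and domination by powers of t replace Sobolev embeddings
    and weak compactness. The maximizing V_k are never shown to converge: only their potentials do,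
    and a maximizer is rebuilt from the limit U as a multiple of W. Young's inequality stands in for
    Holder's because its strict form at a point identifies the equality case at once. The variable t
    = |x|^2 is preferred to |x| because it is polynomial in x: a function smooth in t near [0, +oo[
    is smooth at the origin as well, which the test functions need. The Laplacian of U(|x|^2) is 4
    t^(1 - nu) (t^nu U')', whence the factor 4 in both constants lambda. The norm constraint on V
    leaves one free scalar l = 1/S, where S is the weighted L^p norm of W; this is why the two
    lambdas come out as 4 and 4 l. The obstacle throughout is the origin, where u, v and the
    right-hand sides may blow up. Each of them is therefore controlled by a single power of t, and
    the exponents al and be are chosen so that all these powers are integrable. *)

Section young.
Variable R : realType.
Implicit Types p q x y : R.

(** Young's inequality for the pair (y, 1), multiplied by q. *)
Lemma powR_bernoulli q y : 1 < q -> 0 <= y -> 1 + q * (y - 1) <= y `^ q.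
Proof.
move=> q1 y0; have q0 : 0 < q by lra.
have qV : 0 < 1 - q^-1 by rewrite subr_gt0 invf_lt1.
have := @conjugate_powR R y 1 q (1 - q^-1)^-1 y0 ler01 q0.
rewrite invr_gt0 invrK => /(_ qV); rewrite addrC subrK => /(_ erefl).
rewrite powR1 mulr1 mul1r => H.
have : q * y <= q * (y `^ q / q + (1 - q^-1)) by rewrite ler_pM2l.
rewrite mulrDr mulrCA mulfV ?gt_eqF// mulr1 mulrBr mulfV ?gt_eqF//; lra.
Qed.

(** Strictness comes from squaring the weak inequality at z = sqrt y: (1 + q (z - 1))^2 exceeds 1 +
    q (z^2 - 1) by q (q - 1) (z - 1)^2. *)
Lemma powR_bernoulli_lt q y : 1 < q -> 0 <= y -> y != 1 ->
  1 + q * (y - 1) < y `^ q.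
Proof.
move=> q1 y0 y1.
have [z [z0 z1 ->]] : exists z, [/\ 0 <= z, z != 1 & y = z * z].
  exists (Num.sqrt y); rewrite sqrtr_ge0 -expr2 sqr_sqrtr//; split => //.
  by apply: contra y1 => /eqP h; rewrite -(sqr_sqrtr y0) h expr1n.
rewrite powRM//.
have B := powR_bernoulli q1 z0.
have zq := powR_ge0 z q.
have d : 0 < (z - 1) ^+ 2 by rewrite exprn_even_gt0//= subr_eq0.
have q0 : 0 < q * (q - 1) by rewrite mulr_gt0//; lra.
have d' : 0 < q * (q - 1) * (z - 1) ^+ 2 by rewrite mulr_gt0.
have [h|h] := leP 0 (1 + q * (z - 1)).
  have : (1 + q * (z - 1)) * (1 + q * (z - 1)) <= z `^ q * z `^ q by apply: ler_pM.
  by apply: lt_le_trans; nra.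
(* Here the tangent is negative at z, so z < 1 and it is negative at z^2 too. *)
have : z * z <= z by nra.
by move=> zz; apply: (@lt_le_trans _ _ 0); nra.
Qed.

Lemma young_powR_lt q x y : 1 < q -> 0 <= x -> 0 <= y -> x != y ->
  x `^ (q - 1) * y < (1 - q^-1) * x `^ q + q^-1 * y `^ q.
Proof.
move=> q1 x0 y0 xy.
have qV : 0 < q^-1 by rewrite invr_gt0; lra.
have qq : q * q^-1 = 1 by rewrite mulfV//; lra.
move: x0; rewrite le_eqVlt => /predU1P[x0|x0].
  rewrite -x0 !powR0 ?subr_eq0; [|lra..].
  by rewrite mul0r mulr0 add0r mulr_gt0// powR_gt0// lt0r y0 andbT eq_sym x0.
pose z := y / x.
have z0 : 0 <= z by rewrite divr_ge0// ltW.
have yE : y = z * x by rewrite /z mulfVK ?gt_eqF.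
have z1 : z != 1.
  by apply: contra xy => /eqP h; rewrite yE h mul1r.
have := powR_bernoulli_lt q1 z0 z1.
have <- : x * x `^ (q - 1) = x `^ q by rewrite mulr_powRB1//; lra.
rewrite yE powRM ?(ltW x0)//.
have <- : x * x `^ (q - 1) = x `^ q by rewrite mulr_powRB1 ?ltW//; lra.
have X0 : 0 < x * x `^ (q - 1) * q^-1 by rewrite !mulr_gt0 ?powR_gt0.
rewrite -(ltr_pM2l X0).
move: (x `^ (q - 1)) (z `^ q) => X Z H.
have E1 : q^-1 * q * (x * X) = x * X by rewrite mulVf ?mul1r//; lra.
have E2 : q^-1 * q * (x * X * z) = x * X * z by rewrite mulVf ?mul1r//; lra.
lra.
Qed.

Lemma young_powR q x y : 1 < q -> 0 <= x -> 0 <= y ->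
  x `^ (q - 1) * y <= (1 - q^-1) * x `^ q + q^-1 * y `^ q.
Proof.
move=> q1 x0 y0; have [->|xy] := eqVneq x y; last exact/ltW/young_powR_lt.
rewrite mulrC mulr_powRB1//; last by lra.
by rewrite -mulrDl subrK mul1r.
Qed.

End young.

Section triangular.
Context {R : realType}.
Notation mu := (@lebesgue_measure R).
Implicit Types (g k : R -> \bar R) (rho : R).

Let E (rho : R) : set (measurableTypeR R * measurableTypeR R) :=
  [set z | [&& 0 < z.1, z.1 < z.2 & z.2 < rho]].

Let mE rho : measurable (E rho).
Proof.
rewrite (_ : E rho = (fst @^-1` `]0, +oo[) `&` (((fun z => z.2 - z.1) @^-1` `]0, +oo[)
   `&` (snd @^-1` `]-oo, rho[))); last first.
  apply/seteqP; split => z; rewrite /E /= !in_itv/= ?andbT subr_gt0.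
    by move=> /and3P[].
  by move=> [-> [-> ->]].
apply: measurableI; first by rewrite -[X in measurable X]setTI; exact: measurable_fst.
apply: measurableI; last by rewrite -[X in measurable X]setTI; exact: measurable_snd.
rewrite -[X in measurable X]setTI.
have : measurable_fun setT (fun z : measurableTypeR R * measurableTypeR R => z.2 - z.1 : measurableTypeR R).
  by apply: measurable_funB; [exact: measurable_snd|exact: measurable_fst].
by apply.
Qed.

Let h rho g k (z : measurableTypeR R * measurableTypeR R) := (g z.1 * k z.2 * (\1_(E rho) z)%:E)%E.

Let mh rho g k : measurable_fun setT g -> measurable_fun setT k ->
  measurable_fun setT (h rho g k).
Proof.
move=> mg mk; apply: emeasurable_funM.
  apply: emeasurable_funM.
    exact: measurableT_comp mg measurable_fst.
  exact: measurableT_comp mk measurable_snd.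
apply/measurable_EFinP; exact: measurable_indic.
Qed.

Let h0 rho g k : (forall t, 0 <= g t)%E -> (forall t, 0 <= k t)%E ->
  forall z, (0 <= h rho g k z)%E.
Proof. by move=> g0 k0 z; rewrite !mule_ge0// lee_fin indicE. Qed.

Let hF rho g k : (forall t, 0 <= g t)%E -> (forall t, 0 <= k t)%E ->
  measurable_fun setT k ->
  forall t, fubini_F mu (h rho g k) t =
   ((fun t => g t * \int[mu]_(s in `]t, rho[) k s)%E \_ `]0, rho[) t.
Proof.
move=> g0 k0 mk t; rewrite /fubini_F patchE.
case: ifPn => [|tD].
  rewrite inE/= in_itv/= => /andP[t0 tr].
  rewrite -ge0_integralZl//; last by exact: measurable_funTS.
  rewrite [RHS]integral_mkcond; apply: eq_integral => s _.
  rewrite /h /= patchE indicE.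
  have -> : ((t, s) \in E rho) = (s \in `]t, rho[%classic).
    by apply/idP/idP; rewrite !inE /E /= in_itv/= t0.
  by case: ifP => _; rewrite ?mule1 ?mule0.
rewrite integral0_eq// => s _; rewrite /h indicE /=.
rewrite (_ : (t, s) \in E rho = false) ?mule0//.
apply/negP; rewrite inE /E /= => /and3P[t0 ts sr].
by move: tD; rewrite notin_setE/= in_itv/= t0 (lt_trans ts sr).
Qed.

Let hG rho g k : (forall t, 0 <= g t)%E -> (forall t, 0 <= k t)%E ->
  measurable_fun setT g ->
  forall s, fubini_G mu (h rho g k) s =
   ((fun s => k s * \int[mu]_(t in `]0%R, s[) g t)%E \_ `]0, rho[) s.
Proof.
move=> g0 k0 mg s; rewrite /fubini_G patchE.
case: ifPn => [|sD].
  rewrite inE/= in_itv/= => /andP[s0 sr].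
  rewrite -ge0_integralZl//; last by exact: measurable_funTS.
  rewrite [RHS]integral_mkcond; apply: eq_integral => t _.
  rewrite /h /= patchE indicE.
  have -> : ((t, s) \in E rho) = (t \in `]0, s[%classic).
    by apply/idP/idP; rewrite !inE /E /= in_itv/= sr andbT.
  by case: ifP => _; rewrite ?mule1 ?mule0// muleC.
rewrite integral0_eq// => t _; rewrite /h indicE /=.
rewrite (_ : (t, s) \in E rho = false) ?mule0//.
apply/negP; rewrite inE /E /= => /and3P[t0 ts sr].
by move: sD; rewrite notin_setE/= in_itv/= sr (lt_trans t0 ts).
Qed.

(** Both sides integrate g(t) k(s) over the triangle 0 < t < s < rho. The symmetry of the Green
    operator comes from here. *)
Lemma triangular_tonelli rho g k :
  (forall t, 0 <= g t)%E -> (forall t, 0 <= k t)%E ->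
  measurable_fun setT g -> measurable_fun setT k ->
  (\int[mu]_(t in `]0%R, rho[) (g t * \int[mu]_(s in `]t, rho[) k s) =
   \int[mu]_(s in `]0%R, rho[) (k s * \int[mu]_(t in `]0%R, s[) g t))%E.
Proof.
move=> g0 k0 mg mk.
rewrite integral_mkcond [RHS]integral_mkcond.
transitivity (\int[mu]_t fubini_F mu (h rho g k) t)%E.
  by apply: eq_integral => t _; rewrite hF.
transitivity (\int[mu]_s fubini_G mu (h rho g k) s)%E.
  apply: fubini_tonelli; first exact: mh.
  exact: h0.
by apply: eq_integral => t _; rewrite hG.
Qed.

(** This integral is a Tonelli section of the triangle with the other factor equal to 1. *)
Lemma measurable_tail_integral rho k : (forall t, 0 <= k t)%E ->
  measurable_fun setT k ->
  measurable_fun `]0, rho[ (fun t : R => \int[mu]_(s in `]t, rho[) k s)%E.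
Proof.
move=> k0 mk; apply/(measurable_restrictT _ _) => //.
rewrite (_ : _ \_ _ = fubini_F mu (h rho (cst 1%E) k)).
  apply: measurable_fun_fubini_tonelli_F; first exact: mh.
  exact: h0.
by apply/funext => t; rewrite hF// !patchE; case: ifP => //; rewrite mul1e.
Qed.

Lemma measurable_head_integral rho g : (forall t, 0 <= g t)%E ->
  measurable_fun setT g ->
  measurable_fun `]0, rho[ (fun s : R => \int[mu]_(t in `]0%R, s[) g t)%E.
Proof.
move=> g0 mg; apply/(measurable_restrictT _ _) => //.
rewrite (_ : _ \_ _ = fubini_G mu (h rho g (cst 1%E))).
  apply: measurable_fun_fubini_tonelli_G; first exact: mh.
  exact: h0.
by apply/funext => t; rewrite hG// !patchE; case: ifP => //; rewrite mul1e.
Qed.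

End triangular.

Section power_integrals.
Context {R : realType}.
Notation mu := (@lebesgue_measure R).

Lemma FTC2_is_derive (F f : R -> R) (a b : R) : a < b ->
  (forall x, a <= x <= b -> is_derive x 1 F (f x)) ->
  (forall x, a <= x <= b -> {for x, continuous f}) ->
  (\int[mu]_(x in `[a, b]) (f x)%:E = (F b - F a)%:E)%E.
Proof.
move=> ab dF cf.
have cF x : a <= x <= b -> {for x, continuous F}.
  move=> xab; apply: differentiable_continuous; apply/derivable1_diffP.
  by case: (dF _ xab).
rewrite (@continuous_FTC2 _ f F)//.
- by apply: continuous_in_subspaceT => x; rewrite inE/= in_itv/= => /cf.
- split.
  + move=> x; rewrite in_itv/= => /andP[ax xb]; case: (dF x) => //.
    by rewrite !ltW.
  + by apply: cvg_at_right_filter; apply: cF; rewrite lexx ltW.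
  + by apply: cvg_at_left_filter; apply: cF; rewrite lexx ltW.
- move=> x; rewrite in_itv/= => /andP[ax xb]; rewrite derive1E.
  by apply: derive_val; apply: dF; rewrite !ltW.
Qed.

Lemma continuous_powR (c x : R) : 0 < x -> {for x, continuous (fun s => s `^ c)}.
Proof.
move=> x0; apply: differentiable_continuous; apply/derivable1_diffP.
by apply: derivable_powR; rewrite in_itv/= x0.
Qed.

Lemma measurable_powR_EFin (c : R) (D : set R) : measurable_fun D (fun s => (s `^ c)%:E).
Proof.
apply/measurable_EFinP; apply: measurable_funTS; exact: measurable_powR.
Qed.

Lemma FTC2_powR (c a b : R) : c != 0 -> 0 < a -> a < b ->
  (\int[mu]_(s in `[a, b]) (s `^ (c - 1))%:E = (c^-1 * b `^ c - c^-1 * a `^ c)%:E)%E.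
Proof.
move=> c0 a0 ab; apply: (@FTC2_is_derive (fun s => c^-1 * s `^ c) (fun s => s `^ (c - 1))) => //.
  move=> x /andP[ax _]; have x0 := lt_le_trans a0 ax.
  have H := is_derive1_powR c x0.
  by apply: is_derive_eq; rewrite /= scalerA mulVf// scale1r.
move=> x /andP[ax _]; apply: continuous_powR; exact: lt_le_trans ax.
Qed.

Lemma integral_powR_head (c tau : R) : 0 < c -> 0 < tau ->
  (\int[mu]_(s in `]0%R, tau[) (s `^ (c - 1))%:E <= (c^-1 * tau `^ c)%:E)%E.
Proof.
move=> c0 t0.
(* The integrand may be singular at 0, so ]0, tau[ is covered by intervals away from 0. The shift
   [i.+2] keeps the first of them nondegenerate, as [FTC2_powR] requires. *)
pose F (i : nat) : set R := `[tau / i.+2%:R, tau]%classic.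
have Fpos i x : F i x -> 0 < x.
  by rewrite /F/= in_itv/= => /andP[+ _]; apply: lt_le_trans; rewrite divr_gt0.
have ndF : nondecreasing_seq F.
  apply/nondecreasing_seqP => i; rewrite subsetEset /F; apply: subset_itvr.
  by rewrite bnd_simp ler_pM2l// lef_pV2 ?posrE// ler_nat.
have UF : `]0, tau[ `<=` \bigcup_i F i.
  move=> x /=; rewrite in_itv/= => /andP[x0 xt].
  exists (Num.truncn (tau / x)) => //; rewrite /F /= in_itv/= (ltW xt) andbT.
  rewrite ler_pdivrMr// mulrC -ler_pdivrMr//; apply/ltW.
  apply: (@lt_trans _ _ (Num.truncn (tau / x)).+1%:R); last by rewrite ltr_nat.
  by apply: truncnS_gt.
have mU : measurable (\bigcup_i F i).
  by apply: bigcup_measurable => i _; exact: measurable_itv.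
apply: (@le_trans _ _ (\int[mu]_(s in \bigcup_i F i) (s `^ (c - 1))%:E)%E).
  apply: ge0_subset_integral => //; first exact: measurable_powR_EFin.
  by move=> x _; rewrite lee_fin powR_ge0.
have cF : (\int[mu]_(s in F i) (s `^ (c - 1))%:E)%E @[i --> \oo] -->
    (\int[mu]_(s in \bigcup_i F i) (s `^ (c - 1))%:E)%E.
  apply: ge0_nondecreasing_set_cvg_integral => //.
  - by move=> i; exact: measurable_itv.
  - by move=> i; exact: measurable_powR_EFin.
  - by move=> i x _; rewrite lee_fin powR_ge0.
rewrite -(cvg_lim _ cF)//; apply: lime_le; first by apply/cvg_ex; eexists; exact: cF.
apply: nearW => i; rewrite FTC2_powR ?gt_eqF//.
- by rewrite lee_fin gerBl mulr_ge0 ?invr_ge0 ?powR_ge0 ?ltW.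
- by rewrite divr_gt0.
- by rewrite ltr_pdivrMr// ltr_pMr// ltr1n.
Qed.

Lemma integral_powR_tail (c t rho : R) : 0 < c -> 0 < t ->
  (\int[mu]_(s in `]t, rho[) (s `^ (- c - 1))%:E <= (c^-1 * t `^ (- c))%:E)%E.
Proof.
move=> c0 t0; have [tr|tr] := ltP t rho; last first.
  rewrite set_itv_ge ?bnd_simp -?leNgt// integral_set0 lee_fin.
  by rewrite mulr_ge0 ?invr_ge0 ?powR_ge0 ?ltW.
apply: (@le_trans _ _ (\int[mu]_(s in `[t, rho]) (s `^ (- c - 1))%:E)%E).
  apply: ge0_subset_integral => //; first exact: measurable_powR_EFin.
    by move=> x _; rewrite lee_fin powR_ge0.
  exact: subset_itv_oo_cc.
rewrite FTC2_powR//; last by rewrite oppr_eq0 gt_eqF.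
rewrite lee_fin invrN mulNr mulNr opprK addrC gerBl.
by rewrite mulr_ge0 ?invr_ge0 ?powR_ge0 ?ltW.
Qed.

End power_integrals.

(** * Extraction of pointwise limits *)

Section extraction.
Variable R : realType.
Implicit Types (u : nat -> R -> R) (M U : R -> R) (s t e d : R).

(** U is a cluster point of the sequence in the product of the segments [- M t, M t], compact by
    Tychonoff. Neighbourhoods in the product topology see finitely many points, whence the list
    [ts]. *)
Lemma pointwise_cluster u M : (forall k t, `|u k t| <= M t) ->
  exists U, forall (ts : seq R) (e : R) (m : nat), 0 < e ->
    exists2 k, (m <= k)%N & forall t, t \in ts -> `|u k t - U t| < e.
Proof.
move=> uM.
pose T := prod_topology (fun _ : R => (R : topologicalType)).
pose K := [set f : T | forall t, `[- M t, M t]%classic (f t)].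
have cK : compact K by apply: (@tychonoff R (fun=> (R : topologicalType)) (fun t => `[- M t, M t]%classic)) => t; exact: segment_compact.
have [|U [KU clU]] := cK ((u : nat -> T) @ \oo) _.
  by exists 0%N => // k _ t; rewrite /= in_itv/= -ler_norml.
exists U => ts e m e0.
have nbA : nbhs (U : T) [set k : T | forall t, t \in ts -> `|k t - U t| < e].
  elim: ts => [|t ts ih]; first by apply: filterE.
  have nt : nbhs (U : T) [set f : T | `|f t - U t| < e].
    have nbt : nbhs (U t) [set y : R | `|y - U t| < e].
      by apply/nbhs_ballP; exists e => // y; rewrite /ball/= distrC.
    exact: (@proj_continuous R (fun=> (R : topologicalType)) t U _ nbt).
  near=> f; move=> t' /[!inE] /predU1P[->|t's].
    by near: f.
  have : [set k : T | forall t, t \in ts -> `|k t - U t| < e] f by near: f.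
  exact.
have nbB : ((u : nat -> T) @ \oo) (u @` [set k | (m <= k)%N]).
  exists m => // k /= mk; by exists k.
have [_ [[k mk <-] h]] := clU _ _ nbB nbA.
by exists k.
Unshelve. all: by end_near. Qed.

(** A pointwise Arzela-Ascoli argument: [phi m] is chosen to be close to U at the first m rationals,
    and equicontinuity carries the closeness to every point of D. *)
Lemma equicontinuous_extraction u M (D : set R) :
  (forall k t, D t -> `|u k t| <= M t) ->
  (forall t e, D t -> 0 < e -> exists2 d : R, 0 < d &
    forall s, `|s - t| < d -> D s /\ forall k, `|u k s - u k t| < e) ->
  exists U (phi : nat -> nat), (forall m, (m <= phi m)%N) /\
    forall t, D t -> u (phi m) t @[m --> \oo] --> U t.
Proof.
move=> uM ueq.
pose v k := u k \_ D.
have vM k t : `|v k t| <= (fun t => `|M t|) t.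
  rewrite /v patchE; case: ifPn; rewrite ?normr0// inE => Dt.
  by rewrite (le_trans (uM _ _ Dt))// ler_norm.
have vE k t : D t -> v k t = u k t by move=> Dt; rewrite /v patchE mem_set.
have [U clU] := pointwise_cluster vM.
(* An enumeration of the rationals; codes that decode to nothing are sent to 0. *)
pose q (i : nat) : R := odflt 0 (omap ratr (unpickle i : option rat)).
have /choice[phi hphi] : forall m : nat, exists k, (m <= k)%N /\
    forall i, (i < m)%N -> `|v k (q i) - U (q i)| < m.+1%:R^-1.
  move=> m; have [|k mk h] := clU [seq q i | i <- iota 0 m] (m.+1%:R^-1) m.
    by rewrite invr_gt0.
  exists k; split => // i im; apply: h; apply: map_f.
  by rewrite mem_iota.
exists U, phi; split; first by move=> m; case: (hphi m).
move=> t Dt; apply/cvgrPdist_lt => e e0.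
have e5 : 0 < e / 5 by rewrite divr_gt0.
have [d d0 hd] := ueq t _ Dt e5.
have [r] : exists r : rat, ratr r \in `](t - d), (t + d)[.
  by apply: rat_in_itvoo; lra.
rewrite in_itv/= -ltr_distl => rt.
have [Dr ur] := hd _ rt.
(* U inherits the modulus of continuity: some term of the sequence is close to U at both points. *)
have Uqt : `|U (ratr r) - U t| < e / 5 + e / 5 + e / 5.
  have [k _ h] := clU [:: ratr r; t] _ 0%N e5.
  have := h (ratr r); have := h t; rewrite !inE !eqxx/= orbT => /(_ isT) h1 /(_ isT) h2.
  have := ur k; rewrite -!vE// => h3.
  rewrite (_ : U _ - U t = (v k t - U t) - (v k (ratr r) - U (ratr r)) + (v k (ratr r) - v k t)); last by ring.
  rewrite (le_lt_trans (ler_normD _ _))// ltrD// (le_lt_trans (ler_normB _ _))// ltrD//.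
near=> m.
have [_ /(_ (pickle r))] := hphi m.
have -> : q (pickle r) = ratr r by rewrite /q pickleK.
have pm : (pickle r < m)%N by near: m; exists (pickle r).+1.
move=> /(_ pm) h1.
have h2 : m.+1%:R^-1 < e / 5 :> R.
  by near: m; exact: near_infty_natSinv_lt (PosNum e5).
have := ur (phi m); rewrite -vE// => h3.
rewrite (_ : U t - u (phi m) t = - (U (ratr r) - U t) - (v (phi m) (ratr r) - U (ratr r)) + (v (phi m) (ratr r) - u (phi m) t)); last by ring.
rewrite vE// in h1 h3 *.
apply: (le_lt_trans (ler_normD _ _)).
(* Three fifths for U between t and the rational, one for [phi m] at the rational, one for
   equicontinuity. *)
have -> : e = (e / 5 + e / 5 + e / 5 + e / 5) + e / 5 by lra.
rewrite ltrD// (le_lt_trans (ler_normB _ _))// normrN ltrD//.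
exact: lt_trans h1 h2.
Unshelve. all: by end_near. Qed.

End extraction.

(** * The radial Green operator *)

Section triangular_in.
Context {R : realType}.
Notation mu := (@lebesgue_measure R).
Implicit Types (g k : R -> \bar R) (rho t s : R).

Lemma triangular_tonelli_in rho g k :
  (forall t, 0 < t < rho -> (0 <= g t)%E) -> (forall t, 0 < t < rho -> (0 <= k t)%E) ->
  measurable_fun `]0, rho[ g -> measurable_fun `]0, rho[ k ->
  (\int[mu]_(t in `]0%R, rho[) (g t * \int[mu]_(s in `]t, rho[) k s) =
   \int[mu]_(s in `]0%R, rho[) (k s * \int[mu]_(t in `]0%R, s[) g t))%E.
Proof.
move=> g0 k0 mg mk.
have := @triangular_tonelli R rho (g \_ `]0, rho[) (k \_ `]0, rho[).
rewrite -!(measurable_restrictT _)// => /(_ _ _ mg mk) H.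
pose gD := g \_ `]0, rho[; pose kD := k \_ `]0, rho[.
transitivity (\int[mu]_(t in `]0%R, rho[) (gD t *
     \int[mu]_(s in `]t, rho[) kD s))%E.
  apply: eq_integral => t tD; rewrite /gD patchE tD; congr (_ * _)%E.
  apply: eq_integral => s; rewrite !inE/= !in_itv/= => /andP[ts sr].
  rewrite /kD patchE mem_set//= in_itv/= sr andbT; apply: lt_trans ts.
  by move: tD; rewrite inE/= in_itv/= => /andP[].
rewrite H; last 2 first.
- by move=> t; apply: erestrict_ge0 => s /=; rewrite in_itv; exact: g0.
- by move=> t; apply: erestrict_ge0 => s /=; rewrite in_itv; exact: k0.
apply: eq_integral => t tD; rewrite patchE tD; congr (_ * _)%E.
apply: eq_integral => s; rewrite !inE/= !in_itv/= => /andP[s0 st].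
rewrite patchE mem_set//= in_itv/= s0; apply: lt_trans st _.
by move: tD; rewrite inE/= in_itv/= => /andP[].
Qed.

Lemma measurable_tail_integral_in rho k :
  (forall t, 0 < t < rho -> (0 <= k t)%E) ->
  measurable_fun `]0, rho[ k ->
  measurable_fun `]0, rho[ (fun t : R => \int[mu]_(s in `]t, rho[) k s)%E.
Proof.
move=> k0 mk.
have := @measurable_tail_integral R rho (k \_ `]0, rho[).
rewrite -!(measurable_restrictT _)// => /(_ _ mk) H.
apply: eq_measurable_fun (H _) => [t tD|t].
  apply: eq_integral => s; rewrite !inE/= !in_itv/= => /andP[ts sr].
  rewrite patchE mem_set//= in_itv/= sr andbT; apply: lt_trans ts.
  by move: tD; rewrite inE/= in_itv/= => /andP[].
by apply: erestrict_ge0 => s /=; rewrite in_itv; exact: k0.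
Qed.

Lemma measurable_head_integral_in rho g :
  (forall t, 0 < t < rho -> (0 <= g t)%E) ->
  measurable_fun `]0, rho[ g ->
  measurable_fun `]0, rho[ (fun s : R => \int[mu]_(t in `]0%R, s[) g t)%E.
Proof.
move=> g0 mg.
have := @measurable_head_integral R rho (g \_ `]0, rho[).
rewrite -!(measurable_restrictT _)// => /(_ _ mg) H.
apply: eq_measurable_fun (H _) => [t tD|t].
  apply: eq_integral => s; rewrite !inE/= !in_itv/= => /andP[s0 st].
  rewrite patchE mem_set//= in_itv/= s0; apply: lt_trans st _.
  by move: tD; rewrite inE/= in_itv/= => /andP[].
by apply: erestrict_ge0 => s /=; rewrite in_itv; exact: g0.
Qed.

End triangular_in.

Section green.
Context {R : realType}.
Notation mu := (@lebesgue_measure R).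
Variables (nu rho : R).
Implicit Types (f g : R -> R) (s t C X al : R).

Definition head f t : \bar R := (\int[mu]_(s in `]0%R, t[) (f s)%:E)%E.

(* On functions of [t = |x|^2] in R^n, with [nu = n / 2], the Laplacian is
   [4 t^(1 - nu) (t^nu U')'], so [green f] solves [- (t^nu U')' = f], [U rho = 0];
   [greene] is its extended-real version. *)
Definition greene f t : \bar R :=
  (\int[mu]_(s in `]t, rho[) ((s `^ (- nu))%:E * head f s))%E.

Definition green f t : R := fine (greene f t).

Local Notation D := (`]0%R, rho[%classic : set R).

Lemma head_ge0 f t : (forall s, 0 < s < rho -> 0 <= f s) -> t <= rho ->
  (0 <= head f t)%E.
Proof.
move=> f0 tr; apply: integral_ge0 => s /=; rewrite in_itv/= lee_fin => /andP[s0 st].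
by apply: f0; rewrite s0 (lt_le_trans st).
Qed.

Lemma measurable_head f : (forall s, 0 < s < rho -> 0 <= f s) ->
  measurable_fun D f -> measurable_fun D (head f).
Proof.
move=> f0 mf; apply: measurable_head_integral_in; last exact/measurable_EFinP.
by move=> t /f0; rewrite lee_fin.
Qed.

Lemma measurable_green_integrand f : (forall s, 0 < s < rho -> 0 <= f s) ->
  measurable_fun D f -> measurable_fun D (fun s => (s `^ (- nu))%:E * head f s)%E.
Proof.
move=> f0 mf; apply: emeasurable_funM; first exact: measurable_powR_EFin.
exact: measurable_head.
Qed.

Lemma green_integrand_ge0 f t : (forall s, 0 < s < rho -> 0 <= f s) ->
  t <= rho -> (0 <= (t `^ (- nu))%:E * head f t)%E.
Proof. by move=> f0 tr; rewrite mule_ge0 ?lee_fin ?powR_ge0 ?head_ge0. Qed.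

Lemma greene_ge0 f t : (forall s, 0 < s < rho -> 0 <= f s) -> (0 <= greene f t)%E.
Proof.
move=> f0; apply: integral_ge0 => s /=; rewrite in_itv/= => /andP[ts sr].
by rewrite green_integrand_ge0 ?(ltW sr).
Qed.

Lemma green_ge0 f t : (forall s, 0 < s < rho -> 0 <= f s) -> 0 <= green f t.
Proof. by move=> f0; rewrite /green fine_ge0// greene_ge0. Qed.

Lemma measurable_greene f : (forall s, 0 < s < rho -> 0 <= f s) ->
  measurable_fun D f -> measurable_fun D (greene f).
Proof.
move=> f0 mf; apply: measurable_tail_integral_in.
  by move=> t /andP[_ tr]; rewrite green_integrand_ge0 ?ltW.
exact: measurable_green_integrand.
Qed.

Lemma measurable_green f : (forall s, 0 < s < rho -> 0 <= f s) ->
  measurable_fun D f -> measurable_fun D (green f).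
Proof.
move=> f0 mf; apply: measurableT_comp; first exact: fine_measurable.
exact: measurable_greene.
Qed.

(** The right-hand side is the Dirichlet form, the integral of t^nu (Kf)' (Kg)', because (Kf)' = -
    t^(- nu) [head f]; it is visibly symmetric. *)
Lemma greene_pairing f g : (forall s, 0 < s < rho -> 0 <= f s) ->
  (forall s, 0 < s < rho -> 0 <= g s) ->
  measurable_fun D f -> measurable_fun D g ->
  (\int[mu]_(t in `]0%R, rho[) ((g t)%:E * greene f t) =
   \int[mu]_(t in `]0%R, rho[) ((t `^ (- nu))%:E * head f t * head g t))%E.
Proof.
move=> f0 g0 mf mg; apply: triangular_tonelli_in.
- by move=> t /g0; rewrite lee_fin.
- by move=> t /andP[_ tr]; rewrite green_integrand_ge0 ?ltW.
- exact/measurable_EFinP.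
- exact: measurable_green_integrand.
Qed.

Lemma greene_sym f g : (forall s, 0 < s < rho -> 0 <= f s) ->
  (forall s, 0 < s < rho -> 0 <= g s) ->
  measurable_fun D f -> measurable_fun D g ->
  (\int[mu]_(t in `]0%R, rho[) ((g t)%:E * greene f t) =
   \int[mu]_(t in `]0%R, rho[) ((f t)%:E * greene g t))%E.
Proof.
move=> f0 g0 mf mg; rewrite !greene_pairing//.
by apply: eq_integral => t _; rewrite muleAC.
Qed.

(** The growth condition on the mass near 0 from which decay, equicontinuity and regularity of
    [green f] are deduced. *)
Definition head_bound f C X :=
  forall s, 0 < s < rho -> (head f s <= (C * s `^ X)%:E)%E.

(** The integrand is at most C s^(X - nu) = C s^(X + al - (nu - 1)) s^(- al - 1). The first exponent
    is nonnegative, so that power is at most its value at rho, and the second power integrates to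
    t^(- al) / al. *)
Lemma greene_le f C X al t : (forall s, 0 < s < rho -> 0 <= f s) ->
  measurable_fun D f -> head_bound f C X -> 0 <= C -> 0 < al -> nu - 1 <= X + al ->
  0 < t -> (greene f t <= (C * rho `^ (X + al - (nu - 1)) * al^-1 * t `^ (- al))%:E)%E.
Proof.
move=> f0 mf fC C0 al0 Xal t0.
pose c := C * rho `^ (X + al - (nu - 1)).
have c0 : 0 <= c by rewrite mulr_ge0 ?powR_ge0.
apply: (@le_trans _ _ (\int[mu]_(s in `]t, rho[) (c%:E * (s `^ (- al - 1))%:E))%E).
  apply: ge0_le_integral => //.
  - move=> s /=; rewrite in_itv/= => /andP[ts sr].
    by rewrite green_integrand_ge0 ?(ltW sr).
  - apply: measurable_funS (measurable_green_integrand f0 mf) => //.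
    by move=> s /=; rewrite !in_itv/= => /andP[ts ->]; rewrite (lt_trans t0).
  - by apply: emeasurable_funM => //; exact: measurable_powR_EFin.
  - move=> s /=; rewrite in_itv/= => /andP[ts sr].
    have s0 := lt_trans t0 ts.
    apply: (@le_trans _ _ ((s `^ (- nu))%:E * (C * s `^ X)%:E)%E).
      by rewrite lee_pmul2l ?lte_fin ?powR_gt0// fC// s0.
    rewrite -!EFinM lee_fin /c.
    have -> : s `^ (- nu) * (C * s `^ X) = C * s `^ (X + al - (nu - 1)) * s `^ (- al - 1).
      rewrite mulrCA -mulrA -!powRD; last 2 first.
        by rewrite (gt_eqF s0) implybT.
        by rewrite (gt_eqF s0) implybT.
      by congr (_ * _ `^ _); ring.
    rewrite ler_wpM2r ?powR_ge0// ler_wpM2l// ge0_ler_powR// ?nnegrE; lra.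
rewrite ge0_integralZl//; last 2 first.
- exact: measurable_powR_EFin.
- by move=> s _; rewrite lee_fin powR_ge0.
rewrite -/c -(mulrA c) (EFinM c); apply: (@lee_wpmul2l _ c%:E); first by rewrite lee_fin.
exact: integral_powR_tail.
Qed.

Lemma greene_split f t t' : (forall s, 0 < s < rho -> 0 <= f s) ->
  measurable_fun D f -> 0 < t -> t <= t' -> t' < rho ->
  greene f t = (\int[mu]_(s in `]t, t']) ((s `^ (- nu))%:E * head f s) + greene f t')%E.
Proof.
move=> f0 mf t0 tt tr; rewrite /greene -ge0_integral_setU//.
- congr (integral _ _ _); apply/seteqP; split => s /=; rewrite !in_itv/=.
    by move=> /andP[-> sr]; case: (leP s t') => ?; [left|right].
  by move=> [/andP[-> /le_lt_trans->//]|/andP[/(le_lt_trans tt)-> ->]].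
- apply: measurable_funS (measurable_green_integrand f0 mf) => //.
  move=> s /=; rewrite !in_itv/= => -[/andP[ts st]|/andP[ts ->]].
    by rewrite (lt_trans t0)// (le_lt_trans st).
  by rewrite (lt_trans t0)// (le_lt_trans tt).
- move=> s /=; rewrite !in_itv/= => -[/andP[ts st]|/andP[ts sr]];
    rewrite green_integrand_ge0//; last exact: ltW.
  by rewrite (le_trans st) ?ltW.
- apply/disj_setPS => s /=; rewrite !in_itv/= => -[/andP[_ st] /andP[ts _]].
  by move: (lt_le_trans ts st); rewrite ltxx.
Qed.

(** The modulus depends on f only through C and X, which is what makes the whole maximizing sequence
    equicontinuous. *)
Lemma green_equicontinuous C X t (e : R) : 0 <= C -> 0 <= X -> 0 <= nu ->
  0 < t < rho -> 0 < e ->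
  exists2 d : R, 0 < d & forall s, `|s - t| < d -> 0 < s < rho /\
    forall f, (forall s, 0 < s < rho -> 0 <= f s) ->
      measurable_fun D f -> head_bound f C X ->
      (forall s, 0 < s < rho -> greene f s \is a fin_num) ->
      `|green f s - green f t| < e.
Proof.
move=> C0 X0 nu0 /andP[t0 tr] e0.
pose t2 := t / 2; have t20 : 0 < t2 by rewrite divr_gt0.
(* A Lipschitz constant on ]t/2, rho[, where s^(- nu) [head f s] is at most (t/2)^(- nu) C rho^X;
   the 1 makes it positive. The minimum defining [d] keeps s in that interval. *)
pose L := t2 `^ (- nu) * (C * rho `^ X) + 1.
have L0 : 0 < L by rewrite ltr_wpDl// !mulr_ge0 ?powR_ge0.
pose d := Order.min (e / L) (Order.min t2 (rho - t)).
have d0 : 0 < d by rewrite !lt_min divr_gt0// t20 subr_gt0 tr.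
exists d => // s std.
have st2 : t2 < s.
  move: std; rewrite !lt_min => /and3P[_ + _].
  by rewrite ltr_distl /t2 => /andP[h _]; lra.
have sr : s < rho.
  move: std; rewrite !lt_min => /and3P[_ _ +].
  by rewrite ltr_distl => /andP[_ h]; lra.
have s0 := lt_trans t20 st2.
split; first by rewrite s0.
move=> f f0 mf fC ffin.
have key x y : t2 < x -> x <= y -> y < rho -> 0 <= green f x - green f y <= L * (y - x).
  move=> x2 xy yr; have x0 := lt_trans t20 x2; have y0 := lt_le_trans x0 xy.
  have xr := le_lt_trans xy yr.
  have := greene_split f0 mf x0 xy yr.
  set I := (\int[mu]_(s in _) _)%E => E1.
  have I0 : (0 <= I)%E.
    apply: integral_ge0 => z /=; rewrite in_itv/= => /andP[_ zy].
    by rewrite green_integrand_ge0// (le_trans zy) ?ltW.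
  have IL : (I <= (L * (y - x))%:E)%E.
    apply: (@le_trans _ _ (\int[mu]_(s in `]x, y]) L%:E)%E).
      apply: ge0_le_integral => //.
      - move=> z /=; rewrite in_itv/= => /andP[_ zy].
        by rewrite green_integrand_ge0// (le_trans zy) ?ltW.
      - apply: measurable_funS (measurable_green_integrand f0 mf) => //.
        move=> z /=; rewrite !in_itv/= => /andP[xz zy].
        by rewrite (lt_trans x0)// (le_lt_trans zy).
      - move=> z /=; rewrite in_itv/= => /andP[xz zy].
        have z0 := lt_trans x0 xz; have zr := le_lt_trans zy yr.
        apply: (@le_trans _ _ ((z `^ (- nu))%:E * (C * z `^ X)%:E)%E).
          by rewrite lee_pmul2l ?lte_fin ?powR_gt0// fC// z0.
        rewrite -EFinM lee_fin /L -[leLHS]addr0 lerD// ler_pM ?mulr_ge0 ?powR_ge0//.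
          rewrite !powRN lef_pV2 ?posrE ?powR_gt0// ge0_ler_powR ?nnegrE//; try exact: ltW.
          by apply/ltW/(lt_trans x2).
        by rewrite ler_wpM2l// ge0_ler_powR ?nnegrE// ?(ltW z0) ?(ltW zr) ?(ltW (lt_trans z0 zr)).
    rewrite integral_cst//= lebesgue_measure_itv/= lte_fin.
    have [xy'|yx] := ltP x y; first by rewrite -EFinB -EFinM.
    by rewrite mule0 lee_fin mulr_ge0 ?subr_ge0// ltW.
  have Ifin : I \is a fin_num by rewrite ge0_fin_numE// (le_lt_trans IL)// ltry.
  rewrite /green E1 fineD//; last by rewrite ffin// y0.
  rewrite addrK fine_ge0//= -lee_fin fineK//.
have dL : L * `|s - t| < e.
  by move: std; rewrite !lt_min => /andP[+ _]; rewrite ltr_pdivlMr// mulrC.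
have tt2 : t2 < t by rewrite /t2; lra.
have [st|/ltW ts] := leP s t.
  have /andP[k1 k2] := key s t st2 st tr.
  rewrite ger0_norm//; apply: le_lt_trans k2 _.
  by move: dL; rewrite ler0_norm ?subr_le0// opprB.
have /andP[k1 k2] := key t s tt2 ts sr.
rewrite distrC ger0_norm//; apply: le_lt_trans k2 _.
by move: dL; rewrite ger0_norm ?subr_ge0.
Qed.

End green.

(** * Integrals over ]0, rho[ with power weights *)

Section weighted_integrals.
Context {R : realType}.
Notation mu := (@lebesgue_measure R).
Implicit Types (f g : R -> R) (x y c C : R).

Lemma integral_itv_gt0 (f : R -> \bar R) x y : x < y -> measurable_fun `]x, y[ f ->
  (forall s, x < s < y -> (0 < f s)%E) -> (0 < \int[mu]_(s in `]x, y[) f s)%E.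
Proof.
move=> xy mf f0.
have f0' s : `]x, y[%classic s -> (0 <= f s)%E.
  by rewrite /= in_itv/= => /f0/ltW.
rewrite lt_def integral_ge0// andbT; apply/negP => /eqP I0.
have /(ae_eq_integral_abs mu (measurable_itv _) mf) : (\int[mu]_(s in `]x, y[) `|f s| = 0)%E.
  by rewrite -[RHS]I0; apply: eq_integral => s; rewrite inE => /f0' /gee0_abs.
move=> [N [mN N0 sN]].
have : (mu `]x, y[ <= mu N)%E.
  apply: le_measure; rewrite ?inE//.
  move=> s xsy; apply: sN => /= /(_ xsy) fs0.
  by move: xsy; rewrite /= in_itv/= => /f0; rewrite fs0 ltxx.
by rewrite -[mu in X in (X <= _)%E]/mu N0 lebesgue_measure_itv/= lte_fin xy leNgt -EFinB lte_fin subr_gt0 xy.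
Qed.

Variables (rho : R).
Local Notation D := (`]0%R, rho[%classic : set R).
Definition ge0D f := forall s, 0 < s < rho -> 0 <= f s.
Definition intD f : \bar R := (\int[mu]_(s in `]0%R, rho[) (f s)%:E)%E.

Lemma intD_ge0 f : ge0D f -> (0 <= intD f)%E.
Proof. by move=> f0; apply: integral_ge0 => s /=; rewrite in_itv lee_fin; exact: f0. Qed.

Lemma eq_intD f g : (forall s, 0 < s < rho -> f s = g s) -> intD f = intD g.
Proof. by move=> fg; apply: eq_integral => s; rewrite inE/= in_itv/= => /fg ->. Qed.

Lemma le_intD f g : ge0D f -> measurable_fun D f -> measurable_fun D g ->
  (forall s, 0 < s < rho -> f s <= g s) -> (intD f <= intD g)%E.
Proof.
move=> f0 mf mg fg; apply: ge0_le_integral => //; try exact/measurable_EFinP.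
Qed.

Lemma intDZ c f : 0 <= c -> ge0D f -> measurable_fun D f ->
  intD (fun s => c * f s) = (c%:E * intD f)%E.
Proof.
move=> c0 f0 mf; rewrite /intD; under eq_integral do rewrite EFinM.
by rewrite ge0_integralZl//; exact/measurable_EFinP.
Qed.

Lemma intDD f g : ge0D f -> ge0D g -> measurable_fun D f -> measurable_fun D g ->
  intD (fun s => f s + g s) = (intD f + intD g)%E.
Proof.
move=> f0 g0 mf mg; rewrite /intD; under eq_integral do rewrite EFinD.
by rewrite ge0_integralD//; exact/measurable_EFinP.
Qed.

Lemma measurable_powR_comp f c : measurable_fun D f -> measurable_fun D (fun s => f s `^ c).
Proof. by move=> mf; exact: (measurableT_comp (measurable_powR c) mf). Qed.

Lemma measurable_powR_mul f c : measurable_fun D f ->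
  measurable_fun D (fun s => s `^ c * f s).
Proof.
move=> mf; apply: measurable_funM => //.
apply: measurable_funTS; exact: measurable_powR.
Qed.

Lemma intD_powR_le c C : 0 < rho -> 0 < c -> 0 <= C ->
  (intD (fun s => C * s `^ (c - 1))%R <= (C * (c^-1 * rho `^ c))%:E)%E.
Proof.
move=> r0 c0 C0; rewrite intDZ//; last 2 first.
- by move=> s _; rewrite powR_ge0.
- apply: measurable_funTS; exact: measurable_powR.
rewrite (EFinM C); apply: (@lee_wpmul2l _ C%:E) => //.
exact: integral_powR_head.
Qed.

Lemma intD_cvg (f_ : nat -> R -> R) f C c : 0 < rho -> 0 < c ->
  (forall n, measurable_fun D (f_ n)) ->
  (forall s, 0 < s < rho -> f_ ^~ s @ \oo --> f s) ->
  (forall n s, 0 < s < rho -> `|f_ n s| <= C * s `^ (c - 1)) ->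
  measurable_fun D f /\ (intD (f_ n) @[n --> \oo] --> intD f).
Proof.
move=> r0 c0 mf cf fC.
have mf' : measurable_fun D f.
  exact: (@measurable_fun_cvg _ _ _ _ f_).
split => //.
have [] := @dominated_convergence _ _ _ mu D (measurable_itv _)
  (fun n s => (f_ n s)%:E) (fun s => (f s)%:E) (fun s => (`|C| * s `^ (c - 1))%:E).
- by move=> n; apply/measurable_EFinP; exact: mf.
- exact/measurable_EFinP.
- apply: aeW => s /=; rewrite in_itv/= => sD.
  by apply: cvg_EFin; [exact: nearW|exact: (cf _ sD)].
- apply/integrableP; split.
    apply/measurable_EFinP; apply: measurable_funM => //.
    by apply: measurable_funTS; exact: measurable_powR.
  apply: (@le_lt_trans _ _ (`|C| * (c^-1 * rho `^ c))%:E); last exact: ltry.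
  apply: le_trans (intD_powR_le r0 c0 (normr_ge0 C)); rewrite le_eqVlt; apply/orP; left.
  apply/eqP; apply: eq_integral => s _.
  by rewrite gee0_abs// lee_fin mulr_ge0 ?powR_ge0.
- apply: aeW => s n /=; rewrite in_itv/= => sD; rewrite lee_fin.
  by rewrite (le_trans (fC _ _ sD))// ler_wpM2r ?powR_ge0// ler_norm.
- by [].
Qed.

End weighted_integrals.

Section head_young.
Context {R : realType}.
Variables (rho : R).
Local Notation D := (`]0%R, rho[%classic : set R).

(** A form of Holder's inequality on ]0, t[. Young is applied to V and the constant e = t^(- c/p),
    chosen so that the integral of s^(c - 1) e^p over ]0, t[ is at most 1/c, independently of t;
    multiplying back by 1/e gives the factor t^(c/p). *)
Lemma head_bound_young (c p L : R) (V : R -> R) : 0 < c -> 1 < p ->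
  ge0D rho V -> measurable_fun D V ->
  (intD rho (fun s => s `^ (c - 1) * V s `^ p)%R <= L%:E)%E ->
  head_bound rho (fun s => s `^ (c - 1) * V s `^ (p - 1))%R
    ((1 - p^-1) * L + p^-1 * c^-1) (c / p).
Proof.
move=> c0 p1 V0 mV VL t /andP[t0 tr].
have p0 : 0 < p by lra.
have pV : 0 < p^-1 by rewrite invr_gt0.
have pV1 : 0 <= 1 - p^-1 by rewrite subr_ge0 invf_le1// ltW.
pose e := t `^ (- (c / p)).
have e0 : 0 < e by rewrite powR_gt0.
have sub s : `]0, t[%classic s -> D s.
  by rewrite /= !in_itv/= => /andP[-> st]; rewrite (lt_trans st).
have sub' s : 0 < s < t -> 0 < s < rho by move=> /andP[-> st]; rewrite (lt_trans st).
have mV' : measurable_fun (`]0, t[ : set R) V by exact: measurable_funS mV.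
pose k s := t `^ (c / p) * ((1 - p^-1) * (s `^ (c - 1) * V s `^ p) + p^-1 * e `^ p * s `^ (c - 1)).
apply: (@le_trans _ _ (intD t k)).
  apply: le_intD.
  - by move=> s /sub' /V0 Vs; rewrite mulr_ge0 ?powR_ge0.
  - by apply: measurable_powR_mul; exact: measurable_powR_comp.
  - apply: measurable_funM => //; apply: measurable_funD; apply: measurable_funM => //.
      by apply: measurable_powR_mul; exact: measurable_powR_comp.
    by apply: measurable_funTS; exact: measurable_powR.
  - move=> s st; have Vs := V0 _ (sub' _ st).
    rewrite /k [leLHS](_ : _ = t `^ (c / p) * (s `^ (c - 1) * (V s `^ (p - 1) * e))); last first.
      rewrite /e powRN; set z := t `^ (c / p).
      have z0 : z != 0 by rewrite gt_eqF// powR_gt0.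
      by field.
    rewrite ler_wpM2l ?powR_ge0//.
    have := young_powR p1 Vs (ltW e0).
    have := powR_ge0 s (c - 1).
    move=> /ler_wpM2l/[apply] /le_trans; apply.
    by rewrite le_eqVlt; apply/orP; left; apply/eqP; ring.
have [m1 m2] : measurable_fun (`]0, t[ : set R) (fun s => s `^ (c - 1) * V s `^ p) /\
   measurable_fun (`]0, t[ : set R) (fun s : R => s `^ (c - 1)).
  split; first by apply: measurable_powR_mul; exact: measurable_powR_comp.
  by apply: measurable_funTS; exact: measurable_powR.
rewrite intDZ ?powR_ge0//; last 2 first.
- move=> s st; rewrite addr_ge0// !mulr_ge0 ?powR_ge0//; exact: ltW.
- by apply: measurable_funD; apply: measurable_funM.
rewrite [X in (X <= _)%E]muleC [X in (_ <= X)%E]EFinM; apply: (@lee_wpmul2r _ (t `^ (c / p))%:E).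
  by rewrite lee_fin powR_ge0.
rewrite intDD; last 4 first.
- by move=> s _; rewrite !mulr_ge0 ?powR_ge0.
- by move=> s _; rewrite !mulr_ge0 ?powR_ge0 ?ltW.
- by apply: measurable_funM.
- by apply: measurable_funM.
rewrite EFinD leeD//.
  rewrite intDZ//; last by move=> s _; rewrite mulr_ge0 ?powR_ge0.
  rewrite (EFinM (1 - _)); apply: (@lee_wpmul2l _ (1 - p^-1)%:E); first by rewrite lee_fin.
  apply: le_trans VL; apply: ge0_subset_integral => //.
    apply/measurable_EFinP; apply: measurable_powR_mul; exact: measurable_powR_comp.
  by move=> s _; rewrite lee_fin mulr_ge0 ?powR_ge0.
apply: (le_trans (intD_powR_le t0 c0 _)); first by rewrite mulr_ge0 ?powR_ge0 ?ltW.
rewrite lee_fin /e -powRrM mulNr divfK ?gt_eqF// powRN.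
rewrite -!mulrA ler_wpM2l ?(ltW pV)// mulrCA mulVf ?mulr1//.
by rewrite gt_eqF ?powR_gt0.
Qed.

End head_young.

(** * Existence for the radial system *)

Section source.
Context {R : realType}.
Variables (nu rho : R).
Hypotheses (rho0 : 0 < rho).
Local Notation D := (`]0%R, rho[%classic : set R).
Implicit Types (V : R -> R) (c p L al C s t : R).

(** With c = nu + a/2: in - 4 t^(1 - nu) (t^nu U')' = lambda t^(a/2) V^(p - 1), moving t^(1 - nu) to
    the right leaves t^(c - 1). *)
Definition src c p V s : R := s `^ (c - 1) * V s `^ (p - 1).

Lemma src_ge0 c p V s : 0 <= src c p V s.
Proof. by rewrite mulr_ge0 ?powR_ge0. Qed.

Lemma measurable_src c p V : measurable_fun D V -> measurable_fun D (src c p V).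
Proof. by move=> mV; apply: measurable_powR_mul; exact: measurable_powR_comp. Qed.

Lemma green_src_bound c p L al : 0 < c -> 1 < p -> 0 <= L -> 0 < al ->
  nu - 1 <= c / p + al ->
  exists2 C, 0 <= C & forall V, ge0D rho V -> measurable_fun D V ->
    (intD rho (fun s => s `^ (c - 1) * V s `^ p)%R <= L%:E)%E ->
    [/\ head_bound rho (src c p V) C (c / p),
        forall t, 0 < t -> greene nu rho (src c p V) t \is a fin_num &
        forall t, 0 < t -> 0 <= green nu rho (src c p V) t <= C * t `^ (- al)].
Proof.
move=> c0 p1 L0 al0 cal.
have p0 : 0 < p by lra.
pose C1 := (1 - p^-1) * L + p^-1 * c^-1.
have C10 : 0 <= C1.
  rewrite addr_ge0 ?mulr_ge0 ?invr_ge0 ?subr_ge0 ?invf_le1//; exact: ltW.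
pose C2 := C1 * rho `^ (c / p + al - (nu - 1)) * al^-1.
have C20 : 0 <= C2 by rewrite !mulr_ge0 ?powR_ge0 ?invr_ge0// ltW.
(* The sum serves both as the mass constant and as the constant of the pointwise bound. *)
exists (C1 + C2); first exact: addr_ge0.
move=> V V0 mV VL.
have hb : head_bound rho (src c p V) C1 (c / p) by exact: head_bound_young.
have le t : 0 < t -> (greene nu rho (src c p V) t <= (C2 * t `^ (- al))%:E)%E.
  move=> t0; apply: greene_le => //; last exact: measurable_src.
  by move=> s _; exact: src_ge0.
have ge t : (0 <= greene nu rho (src c p V) t)%E.
  by apply: greene_ge0 => s _; exact: src_ge0.
have fin t : 0 < t -> greene nu rho (src c p V) t \is a fin_num.
  by move=> t0; rewrite ge0_fin_numE// (le_lt_trans (le _ t0)) ?ltry.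
split => //.
- move=> s sD; apply: (le_trans (hb _ sD)).
  by rewrite lee_fin ler_wpM2r ?powR_ge0// lerDl.
- move=> t t0; rewrite green_ge0/=; last by move=> s _; exact: src_ge0.
  rewrite -lee_fin fineK ?fin// (le_trans (le _ t0))// lee_fin.
  by rewrite ler_wpM2r ?powR_ge0// lerDr.
Qed.

(** Turns a bound by s^(- al) into a majorant of the weighted p-th power that is integrable at 0
    exactly when al p < c. *)
Lemma weight_powR_le c p al C s x : 0 <= p -> 0 < s -> 0 <= C -> 0 <= x <= C * s `^ (- al) ->
  s `^ (c - 1) * x `^ p <= C `^ p * s `^ (c - al * p - 1).
Proof.
move=> p0 s0 C0 /andP[x0 xC].
apply: (@le_trans _ _ (s `^ (c - 1) * (C * s `^ (- al)) `^ p)).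
  rewrite ler_wpM2l ?powR_ge0// ge0_ler_powR// ?nnegrE//.
  by rewrite mulr_ge0 ?powR_ge0.
rewrite powRM ?powR_ge0// mulrCA -powRrM -powRD ?(gt_eqF s0) ?implybT//.
by rewrite le_eqVlt; apply/orP; left; apply/eqP; congr (_ * _ `^ _); ring.
Qed.

End source.

(** * The maximization problem; [a] and [b] stand here for the exponents c and d of the overview *)

Section existence.
Context {R : realType}.
Notation mu := (@lebesgue_measure R).
Variables (nu rho a b p q al be : R).
Implicit Types (f g V U : R -> R) (s t : R).
Hypotheses (rho0 : 0 < rho) (nu0 : 0 <= nu) (a0 : 0 < a) (b0 : 0 < b).
Hypotheses (p1 : 1 < p) (q1 : 1 < q).
Hypotheses (al0 : 0 < al) (alb : al * q < b) (ala : nu - 1 <= a / p + al).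
Hypotheses (be0 : 0 < be) (bea : be * p < a) (beb : nu - 1 <= b / q + be).
Local Notation D := (`]0%R, rho[%classic : set R).

Let p0 : 0 < p. Proof. exact: lt_trans ltr01 _. Qed.
Let q0 : 0 < q. Proof. exact: lt_trans ltr01 _. Qed.
Let bq : 0 < b - al * q. Proof. by rewrite subr_gt0. Qed.
Let ap : 0 < a - be * p. Proof. by rewrite subr_gt0. Qed.

Local Notation K := (green nu rho).
Local Notation Ke := (greene nu rho).

Let adm V := [/\ ge0D rho V, measurable_fun D V &
  (intD rho (fun s => s `^ (a - 1) * V s `^ p)%R <= 1%:E)%E].

Let Phi V := intD rho (fun s => s `^ (b - 1) * K (src a p V) s `^ q).

Let KA_bound : exists2 C, 0 <= C & forall V, adm V ->
    [/\ head_bound rho (src a p V) C (a / p),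
        forall t, 0 < t -> Ke (src a p V) t \is a fin_num &
        forall t, 0 < t -> 0 <= K (src a p V) t <= C * t `^ (- al)].
Proof.
have [C C0 h] := @green_src_bound R nu rho a p 1 al a0 p1 ler01 al0 ala.
by exists C => // V [V0 mV V1]; exact: h.
Qed.

Let mKA V : adm V -> measurable_fun D (K (src a p V)).
Proof.
move=> [V0 mV _]; apply: measurable_green; last exact: measurable_src.
by move=> s _; exact: src_ge0.
Qed.

Let Phi_fin : exists M : R, forall V, adm V -> (Phi V <= M%:E)%E.
Proof.
have [C C0 h] := KA_bound.
exists (C `^ q * ((b - al * q)^-1 * rho `^ (b - al * q))) => V aV.
apply: le_trans (intD_powR_le rho0 bq (powR_ge0 _ _)).
apply: le_intD.
- by move=> s _; rewrite mulr_ge0 ?powR_ge0.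
- by apply: measurable_powR_mul; apply: measurable_powR_comp; exact: mKA.
- by apply: measurable_funM => //; apply: measurable_funTS; exact: measurable_powR.
- move=> s /andP[s0 _]; apply: weight_powR_le => //; first exact: ltW.
  by have [_ _] := h _ aV; apply.
Qed.

Let L := ereal_sup [set Phi V | V in adm].

Let adm_gt0 : exists2 V, adm V & forall s, 0 < s < rho -> 0 < V s.
Proof.
(* Normalized so that c^p times the bound rho^a / a for the integral of the weight equals 1. *)
pose c := (a^-1 * rho `^ a)^-1 `^ (p^-1).
have c0' : 0 < (a^-1 * rho `^ a)^-1 by rewrite invr_gt0 mulr_gt0 ?invr_gt0 ?powR_gt0.
have c0 : 0 < c by rewrite powR_gt0.
exists (cst c); last by move=> s _; exact: c0.
split => //; first by move=> s _; exact: ltW.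
have := @intD_powR_le R rho a (c `^ p) rho0 a0 (powR_ge0 _ _).
rewrite {2}/c -powRrM mulVf ?gt_eqF// powRr1; last exact: ltW.
rewrite mulVf; last by rewrite gt_eqF// -invr_gt0.
by under eq_intD do rewrite mulrC.
Qed.

Let head_gt0 f t : 0 < t -> measurable_fun (`]0, t[ : set R) f ->
  (forall s, 0 < s < t -> 0 < f s) -> (0 < head f t)%E.
Proof.
move=> t0 mf f0; apply: integral_itv_gt0 => //.
exact/measurable_EFinP.
Qed.

(** [head f] is nondecreasing, so positive mass at one point makes the integrand of [greene]
    positive beyond max(t, t0). *)
Lemma greene_gt0 f t0 : (forall s, 0 < s < rho -> 0 <= f s) ->
  measurable_fun D f -> 0 < t0 < rho -> (0 < head f t0)%E ->
  forall t, 0 < t < rho -> (0 < Ke f t)%E.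
Proof.
move=> f0 mf /andP[t00 t0r] ht0 t /andP[t0' tr].
pose m := Order.max t t0.
have mr : m < rho by rewrite gt_max tr t0r.
have m0 : 0 < m by rewrite lt_max t0'.
apply: (@lt_le_trans _ _ (\int[mu]_(s in `]m, rho[) ((s `^ (- nu))%:E * head f s))%E).
  apply: integral_itv_gt0 => //.
    apply: measurable_funS (measurable_green_integrand nu f0 mf) => //.
    by move=> s /=; rewrite !in_itv/= => /andP[ts ->]; rewrite (lt_trans m0).
  move=> s /andP[ms sr]; have s0 := lt_trans m0 ms.
  rewrite mule_gt0// ?lte_fin ?powR_gt0//; apply: (lt_le_trans ht0).
  have t0s : t0 < s by apply: le_lt_trans ms; rewrite le_max lexx orbT.
  apply: ge0_subset_integral => //.
  - apply/measurable_EFinP; apply: measurable_funS mf => //.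
    by move=> z /=; rewrite !in_itv/= => /andP[-> zs]; rewrite (lt_trans zs).
  - move=> z /=; rewrite in_itv/= => /andP[z0 zs]; rewrite lee_fin f0// z0.
    exact: lt_trans sr.
  - by apply: subset_itvl; rewrite bnd_simp ltW.
apply: ge0_subset_integral => //.
- apply: measurable_funS (measurable_green_integrand nu f0 mf) => //.
  by move=> s /=; rewrite !in_itv/= => /andP[ts ->]; rewrite (lt_trans t0').
- move=> s /=; rewrite in_itv/= => /andP[_ sr].
  by apply: (@green_integrand_ge0 _ nu rho) => //; exact: ltW.
- by apply: subset_itvr; rewrite bnd_simp le_max lexx.
Qed.

Let L_gt0 : (0 < L)%E.
Proof.
have [V aV V0] := adm_gt0.
apply: (@lt_le_trans _ _ (Phi V)); last by apply: ereal_sup_ubound; exists V.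
have [C C0 /(_ _ aV)[_ fin _]] := KA_bound.
have mV : measurable_fun D V by case: aV.
apply: integral_itv_gt0 => //.
  apply/measurable_EFinP; apply: measurable_powR_mul; apply: measurable_powR_comp.
  exact: mKA.
move=> s /andP[s0 sr]; rewrite lte_fin mulr_gt0 ?powR_gt0//.
rewrite -lte_fin fineK ?fin//.
have r20 : 0 < rho / 2 by rewrite divr_gt0.
have r2r : rho / 2 < rho by rewrite ltr_pdivrMr// ltr_pMr// ltr1n.
apply: (@greene_gt0 _ (rho / 2)); rewrite ?r20 ?s0//.
- by move=> z _; exact: src_ge0.
- exact: measurable_src.
- apply: head_gt0 => //.
    apply: measurable_funS (measurable_src a p mV) => //.
    by apply: subset_itvl; rewrite bnd_simp ltW.
  move=> z /andP[z0 zr]; rewrite mulr_gt0 ?powR_gt0// V0// z0.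
  exact: lt_trans r2r.
Qed.

Let L_fin : L \is a fin_num.
Proof.
have [M hM] := Phi_fin.
rewrite fin_numE; apply/andP; split; first by rewrite gt_eqF// (lt_trans _ L_gt0).
rewrite lt_eqF//; apply: (@le_lt_trans _ _ M%:E); last exact: ltry.
by apply: ge_ereal_sup => _ [V aV <-]; exact: hM.
Qed.

Let maximizing : exists V_ : nat -> R -> R, (forall k, adm (V_ k)) /\
  (forall k, (L - (k.+1%:R^-1)%:E <= Phi (V_ k))%E).
Proof.
have /choice[V_ hV] : forall k : nat, exists V, adm V /\ (L - (k.+1%:R^-1)%:E <= Phi V)%E.
  move=> k; have k0 : 0 < k.+1%:R^-1 :> R by rewrite invr_gt0.
  have [_ [V aV <-] h] := ub_ereal_sup_adherent k0 L_fin.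
  by exists V; split => //; exact: ltW.
by exists V_; split => k; case: (hV k).
Qed.

(** The limit is taken in the potentials K (src V_k), which are locally equicontinuous and bounded
    by C t^(- al); no limit of the V_k is formed. *)
Let limit : exists (C : R) (V_ : nat -> R -> R) (U : R -> R),
  [/\ 0 <= C, forall k, adm (V_ k),
      forall k t, 0 < t < rho -> 0 <= K (src a p (V_ k)) t <= C * t `^ (- al),
      forall t, 0 < t < rho -> K (src a p (V_ k)) t @[k --> \oo] --> U t &
      Phi (V_ k) @[k --> \oo] --> L].
Proof.
have [C C0 hC] := KA_bound.
have [V_ [aV hV]] := maximizing.
have [||U [phi [phim cU]]] := @equicontinuous_extraction R (fun k => K (src a p (V_ k)))
    (fun t => C * t `^ (- al)) D.
- move=> k t; rewrite /= in_itv/= => /andP[t0 _].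
  have [_ _ /(_ _ t0)/andP[h1 h2]] := hC _ (aV k).
  by rewrite ger0_norm.
- move=> t e; rewrite /= in_itv/= => tD e0.
  have [|d d0 hd] := @green_equicontinuous R nu rho C (a / p) t e C0 _ nu0 tD e0.
    by rewrite divr_ge0 ?ltW.
  exists d => // s /hd [sD h]; split; first by rewrite in_itv.
  move=> k; have [V0 mV _] := aV k; have [hb fin _] := hC _ (aV k).
  apply: h => //.
  + by move=> z _; exact: src_ge0.
  + exact: measurable_src.
  + by move=> z /andP[z0 _]; exact: fin.
exists C, (fun k => V_ (phi k)), U; split.
- exact: C0.
- by move=> k; exact: aV.
- by move=> k t /andP[t0 _]; have [_ _] := hC _ (aV (phi k)); apply.
- by move=> t tD; apply: (cU t); rewrite /= in_itv.
- have cl : (L - (k.+1%:R^-1)%:E)%E @[k --> \oo] --> L.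
    rewrite -[X in _ --> X]sube0; apply: cvgeB.
    + by rewrite fin_num_adde_defl.
    + exact: cvg_cst.
    + apply: cvg_EFin; first exact: nearW.
      exact: cvg_harmonic.
  apply: squeeze_cvge cl (cvg_cst L); apply: nearW => k; apply/andP; split.
    (* Since k <= phi k, the defect 1/(phi k + 1) is at most 1/(k + 1). *)
    apply: le_trans (hV (phi k)); apply: leeB => //.
    by rewrite lee_fin lef_pV2 ?posrE// ler_nat ltnS phim.
  by apply: ereal_sup_ubound; exists (V_ (phi k)).
Qed.

(** Continuity of the power covers l > 0; for l = 0 the sequence is squeezed, since u^c <= u once u
    <= 1. *)
Let cvg_powR_ge0 (u : nat -> R) (l c : R) : 1 < c -> (forall k, 0 <= u k) ->
  u @ \oo --> l -> (u k) `^ c @[k --> \oo] --> l `^ c.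
Proof.
move=> c1 u0 ul.
have l0 : 0 <= l by apply: (cvgr_to_ge ul); exact: nearW.
move: l0; rewrite le_eqVlt => /predU1P[l0|l0]; last first.
  by apply: (@cvg_comp _ _ _ u (fun y => y `^ c)) ul _; exact: continuous_powR.
rewrite -l0 powR0; last by rewrite gt_eqF// (lt_trans ltr01).
rewrite -l0 in ul.
apply: (squeeze_cvgr _ (cvg_cst 0) ul); near=> k.
rewrite powR_ge0/=.
have u1 : u k <= 1.
  by apply/ltW; near: k; apply: (cvgr_lt 0) => //; exact: ltr01.
have := u0 k; rewrite le_eqVlt => /predU1P[<-|uk].
  by rewrite powR0// gt_eqF// (lt_trans ltr01).
by apply: ge1r_powR; [rewrite uk u1|exact: ltW].
Unshelve. all: by end_near. Qed.

(** One equation of the system, with what its regularity requires: X is the exponent of the mass and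
    e that of the blow-up at 0. The other equation is the same predicate with U and V exchanged, so
    everything about it is proved once. *)
Definition radial_half c r l (X e C : R) V U :=
  [/\ head_bound rho (src c r V) C X,
      forall t, 0 < t -> Ke (src c r V) t \is a fin_num,
      forall t, 0 < t < rho -> 0 < U t <= C * t `^ (- e),
      forall t, U t = l * K (src c r V) t &
      measurable_fun D U].

(** Write <f, h> for the integral of f h over ]0, rho[, g = src U, W = K g, and S for the weighted
    norm of W. Then L = lim <g, K src V_k> = lim <src V_k, W> <= S. For V = W/S and X = K src V, S =
    <src V, W> = <g, X> <= L. So both inequalities are equalities and X = U almost everywhere; the
    solution is (X, V) with l = 1/S. *)
Lemma radial_pair_exists : exists (l C1 C2 : R) U V,
  [/\ 0 < l, 0 <= C1, 0 <= C2, radial_half a p 1 (a / p) al C1 V U &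
     radial_half b q l (b / q) be C2 U V].
Proof.
have [C [V_ [U [C0 aV Ub cU cPhi]]]] := limit.
pose L' := fine L.
have LE : L = L'%:E by rewrite /L' fineK.
have L'0 : 0 < L' by rewrite -lte_fin -LE.
have Ubd t : 0 < t < rho -> 0 <= U t <= C * t `^ (- al).
  move=> tD; apply/andP; split.
    by apply: (cvgr_to_ge (cU _ tD)); apply: nearW => k; have /andP[] := Ub k _ tD.
  by apply: (cvgr_to_le (cU _ tD)); apply: nearW => k; have /andP[] := Ub k _ tD.
have U0 : ge0D rho U by move=> t /Ubd/andP[].
have mU : measurable_fun D U.
  apply: (@measurable_fun_cvg _ _ _ _ (fun k => K (src a p (V_ k)))) => //.
  by move=> k; exact: mKA.
have C'0 : 0 <= C `^ q by exact: powR_ge0.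
have UL : intD rho (fun s => s `^ (b - 1) * U s `^ q) = L'%:E.
  have [|||_ h] := @intD_cvg R rho (fun k s => s `^ (b - 1) * K (src a p (V_ k)) s `^ q)
    (fun s => s `^ (b - 1) * U s `^ q) (C `^ q) (b - al * q) rho0 bq.
  - by move=> k; apply: measurable_powR_mul; apply: measurable_powR_comp; exact: mKA.
  - move=> s sD; apply: cvgMl_tmp.
    apply: cvg_powR_ge0 => //; last exact: cU.
    by move=> k; have /andP[] := Ub k _ sD.
  - move=> k s sD; rewrite ger0_norm ?mulr_ge0 ?powR_ge0//.
    have /andP[s0 _] := sD.
    by apply: weight_powR_le => //; [exact: ltW|exact: Ub].
  by rewrite -LE -(cvg_lim _ cPhi)// -(cvg_lim _ h).
have [C2 C20 /(_ U U0 mU)] := @green_src_bound R nu rho b q L' be b0 q1 (ltW L'0) be0 beb.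
rewrite UL => /(_ (lexx _))[hbW finW Wbd].
have [g gE] : exists g, g = src b q U by exists (src b q U).
have [W WE] : exists W, W = K g by exists (K g).
rewrite -!gE in hbW finW Wbd; rewrite -WE in Wbd.
have g0 : ge0D rho g by move=> s _; rewrite gE; exact: src_ge0.
have mg : measurable_fun D g by rewrite gE; exact: measurable_src.
have W0 : ge0D rho W by move=> s /andP[s0 _]; have /andP[] := Wbd _ s0.
have mW : measurable_fun D W by rewrite WE; exact: measurable_green.
have pairing V : adm V -> intD rho (fun s => src a p V s * W s) =
    intD rho (fun s => g s * K (src a p V) s).
  move=> aV'; have [V0 mV _] := aV'; have [CA CA0 /(_ _ aV')[_ finV _]] := KA_bound.
  transitivity (\int[mu]_(t in `]0%R, rho[) ((src a p V t)%:E * Ke g t))%E.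
    apply: eq_integral => s; rewrite inE/= in_itv/= => /andP[s0 _].
    by rewrite EFinM WE /green fineK// finW.
  rewrite greene_sym//; last first.
    exact: measurable_src.
    by move=> s _; exact: src_ge0.
  apply: eq_integral => s; rewrite inE/= in_itv/= => /andP[s0 _].
  by rewrite (EFinM (g s)) /green fineK// finV.
have Jlim : intD rho (fun s => g s * K (src a p (V_ k)) s) @[k --> \oo] --> L.
  have [|||_ h] := @intD_cvg R rho (fun k s => g s * K (src a p (V_ k)) s)
    (fun s => g s * U s) (C `^ q) (b - al * q) rho0 bq.
  - by move=> k; apply: measurable_funM; [exact: mg|exact: mKA].
  - by move=> s sD; apply: cvgMl_tmp; exact: cU.
  - move=> k s sD; have /andP[k0 k1] := Ub k _ sD.
    have /andP[u0 u1] := Ubd _ sD; have /andP[s0 _] := sD.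
    rewrite ger0_norm ?mulr_ge0 ?(g0 _ sD)//.
    (* U and K (src V_k) have the common bound C s^(- al), so the product U^(q - 1) K (src V_k) is
       at most its q-th power. *)
    have M0 : 0 <= C * s `^ (- al) by rewrite mulr_ge0 ?powR_ge0.
    apply: (@le_trans _ _ (s `^ (b - 1) * (C * s `^ (- al)) `^ q)).
      rewrite gE /src -mulrA ler_wpM2l ?powR_ge0//.
      rewrite -(mulr_powRB1 M0 q0) mulrC ler_pM ?powR_ge0//.
      by rewrite ge0_ler_powR// ?nnegrE// subr_ge0 ltW.
    by apply: weight_powR_le => //; [exact: ltW|rewrite M0 lexx].
  have E : intD rho (fun s => g s * U s) = L.
    rewrite LE -UL; apply: eq_intD => s sD.
    rewrite gE /src -mulrA (mulrC (U s `^ _)) mulr_powRB1//; exact: U0.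
  by rewrite E in h.
(* This is where be p < a is used: W lies in the weighted L^p space, hence can be normalized into an
   admissible function. *)
have Pfin : intD rho (fun s => s `^ (a - 1) * W s `^ p) \is a fin_num.
  rewrite ge0_fin_numE; last by apply: intD_ge0 => s _; rewrite mulr_ge0 ?powR_ge0.
  apply: (@le_lt_trans _ _ (C2 `^ p * ((a - be * p)^-1 * rho `^ (a - be * p)))%:E); last exact: ltry.
  apply: le_trans (intD_powR_le rho0 ap (powR_ge0 _ _)); apply: le_intD.
  - by move=> s _; rewrite mulr_ge0 ?powR_ge0.
  - by apply: measurable_powR_mul; exact: measurable_powR_comp.
  - by apply: measurable_funM => //; apply: measurable_funTS; exact: measurable_powR.
  - by move=> s /andP[s0 _]; apply: weight_powR_le => //; [exact: ltW|exact: Wbd].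
pose P := fine (intD rho (fun s => s `^ (a - 1) * W s `^ p)).
have PE : intD rho (fun s => s `^ (a - 1) * W s `^ p) = P%:E by rewrite fineK.
have P0 : 0 <= P.
  by rewrite -lee_fin -PE; apply: intD_ge0 => s _; rewrite mulr_ge0 ?powR_ge0.
have pV : 0 <= p^-1 by rewrite invr_ge0 ltW.
have pV1 : 0 <= 1 - p^-1 by rewrite subr_ge0 invf_le1// ltW.
have qV : 0 <= q^-1 by rewrite invr_ge0 ltW.
have qV1 : 0 <= 1 - q^-1 by rewrite subr_ge0 invf_le1// ltW.
(* By Young, no pairing of [W] with an admissible [V] exceeds the norm of [W]. *)
have LS S : 0 < S -> P <= S `^ p -> L' <= S.
  move=> S0 PS; rewrite -lee_fin -LE; apply: (cvge_to_le Jlim); apply: nearW => k.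
  rewrite -pairing//; have [V0 mV VL] := aV k; move: (V_ k) V0 mV VL => V V0 mV VL.
  (* Young for the pair (V, W/S), multiplied by S; the weighted integral of (W/S)^p is P / S^p <=
     1. *)
  apply: (@le_trans _ _ (intD rho (fun s => S * ((1 - p^-1) * (s `^ (a - 1) * V s `^ p) +
      p^-1 * (S `^ p)^-1 * (s `^ (a - 1) * W s `^ p))))).
    apply: le_intD.
    - by move=> s sD; rewrite mulr_ge0 ?src_ge0 ?W0.
    - by apply: measurable_funM => //; exact: measurable_src.
    - by apply: measurable_funM => //; apply: measurable_funD; apply: measurable_funM => //;
        apply: measurable_powR_mul; exact: measurable_powR_comp.
    - move=> s sD; have WS0 : 0 <= S^-1 * W s by rewrite mulr_ge0 ?invr_ge0 ?(ltW S0)// W0.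
      have := young_powR p1 (V0 _ sD) WS0.
      move=> /(ler_wpM2l (powR_ge0 s (a - 1)))/(ler_wpM2l (ltW S0)).
      rewrite (powRM _ _ (W0 _ sD)) ?invr_ge0 ?(ltW S0)// -[S^-1]powR_inv1 ?(ltW S0)//.
      rewrite -powRrM mulN1r !powRN powRr1 ?(ltW S0)//.
      rewrite [X in X <= _ -> _](_ : _ = src a p V s * W s).
        move=> /le_trans; apply; rewrite le_eqVlt; apply/orP; left; apply/eqP; ring.
      rewrite /src; field.
      by rewrite gt_eqF.
  have mVp : measurable_fun D (fun s => s `^ (a - 1) * V s `^ p).
    by apply: measurable_powR_mul; exact: measurable_powR_comp.
  have mWp : measurable_fun D (fun s => s `^ (a - 1) * W s `^ p).
    by apply: measurable_powR_mul; exact: measurable_powR_comp.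
  have SV0 : 0 <= p^-1 * (S `^ p)^-1 by rewrite mulr_ge0// invr_ge0 powR_ge0.
  rewrite intDZ ?(ltW S0)//; last 2 first.
  - by move=> s _; rewrite addr_ge0// mulr_ge0// mulr_ge0 ?powR_ge0.
  - by apply: measurable_funD; apply: measurable_funM.
  rewrite intDD; last 4 first.
  - by move=> s _; rewrite mulr_ge0// mulr_ge0 ?powR_ge0.
  - by move=> s _; rewrite mulr_ge0// mulr_ge0 ?powR_ge0.
  - by apply: measurable_funM.
  - by apply: measurable_funM.
  rewrite intDZ//; last by move=> s _; rewrite mulr_ge0 ?powR_ge0.
  rewrite intDZ//; last by move=> s _; rewrite mulr_ge0 ?powR_ge0.
  rewrite PE -EFinM.
  apply: (@le_trans _ _ (S%:E * ((1 - p^-1)%:E * 1%:E + (p^-1 * (S `^ p)^-1 * P)%:E))%E).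
    by apply: lee_wpmul2l; rewrite ?lee_fin ?(ltW S0)//; apply: leeD => //; apply: lee_wpmul2l.
  rewrite mule1 -EFinD -EFinM lee_fin -[leRHS]mulr1 ler_wpM2l ?(ltW S0)//.
  rewrite -lerBrDl opprB addrCA subrr addr0 -mulrA ler_piMr//.
  by rewrite mulrC ler_pdivrMr ?powR_gt0// mul1r.
pose S := P `^ p^-1.
have SP : S `^ p = P by rewrite /S -powRrM mulVf ?gt_eqF// powRr1.
have S0 : 0 < S.
  (* If P were 0, [LS] would hold for every positive number, in particular for L'/2. *)
  rewrite /S powR_gt0// lt_def P0 andbT; apply/eqP => P00.
  have := LS (L' / 2); rewrite divr_gt0// P00 powR_ge0 => /(_ isT isT).
  by lra.
have L'S : L' <= S by apply: LS => //; rewrite SP.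
have [V VE] : exists V, forall s, V s = S^-1 * W s by exists (fun s => S^-1 * W s).
have [X XE] : exists X, X = K (src a p V) by exists (K (src a p V)).
have V0 : ge0D rho V by move=> s sD; rewrite VE mulr_ge0 ?invr_ge0 ?(ltW S0)// W0.
have mV : measurable_fun D V by rewrite (funext VE); exact: measurable_funM.
have V1 : intD rho (fun s => s `^ (a - 1) * V s `^ p) = 1%:E.
  transitivity (intD rho (fun s => P^-1 * (s `^ (a - 1) * W s `^ p))).
    apply: eq_intD => s sD; rewrite VE (powRM _ _ (W0 _ sD)) ?invr_ge0 ?(ltW S0)//.
    rewrite -[S^-1]powR_inv1 ?(ltW S0)// -powRrM mulN1r powRN SP; ring.
  rewrite intDZ ?invr_ge0//; last 2 first.
  - by move=> s _; rewrite mulr_ge0 ?powR_ge0.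
  - by apply: measurable_powR_mul; exact: measurable_powR_comp.
  rewrite PE -EFinM mulVf// gt_eqF// -SP powR_gt0//.
have admV : adm V by split => //; rewrite V1.
have [CA CA0 /(_ _ admV)[hbX finX Xbd]] := KA_bound.
rewrite -XE in Xbd.
have mX : measurable_fun D X by rewrite XE; exact: mKA.
have X0 : ge0D rho X by move=> s /andP[s0 _]; have /andP[] := Xbd _ s0.
have gX : intD rho (fun s => g s * X s) = S%:E.
  rewrite XE -pairing//; transitivity (intD rho (fun s => S * (s `^ (a - 1) * V s `^ p))).
    apply: eq_intD => s sD; rewrite /src -(mulr_powRB1 (V0 _ sD) p0) {2}VE.
    by field; rewrite gt_eqF.
  rewrite intDZ ?(ltW S0)//; last 2 first.
  - by move=> s _; rewrite mulr_ge0 ?powR_ge0.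
  - by apply: measurable_powR_mul; exact: measurable_powR_comp.
  by rewrite V1 -EFinM mulr1.
(* [V] is admissible, so its functional value is at most [L]; a second use of
   Young then gives [S <= L], and the equality forces [X = U] a.e. *)
pose E2 s := (1 - q^-1) * (s `^ (b - 1) * U s `^ q) + q^-1 * (s `^ (b - 1) * X s `^ q).
have mUq : measurable_fun D (fun s => s `^ (b - 1) * U s `^ q).
  by apply: measurable_powR_mul; exact: measurable_powR_comp.
have mXq : measurable_fun D (fun s => s `^ (b - 1) * X s `^ q).
  by apply: measurable_powR_mul; exact: measurable_powR_comp.
have mE2 : measurable_fun D E2 by apply: measurable_funD; exact: measurable_funM.
have mgX : measurable_fun D (fun s => g s * X s) by exact: measurable_funM.
have E2L : (intD rho E2 <= L'%:E)%E.
  rewrite intDD; last 4 first.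
  - by move=> s _; rewrite mulr_ge0// mulr_ge0 ?powR_ge0.
  - by move=> s _; rewrite mulr_ge0// mulr_ge0 ?powR_ge0.
  - by apply: measurable_funM.
  - by apply: measurable_funM.
  rewrite intDZ//; last by move=> s _; rewrite mulr_ge0 ?powR_ge0.
  rewrite intDZ//; last by move=> s _; rewrite mulr_ge0 ?powR_ge0.
  apply: (@le_trans _ _ ((1 - q^-1)%:E * L'%:E + q^-1%:E * L'%:E)%E).
    apply: leeD; first by rewrite UL.
    apply: lee_wpmul2l; first by rewrite lee_fin.
    by rewrite -LE XE; apply: ereal_sup_ubound; exists V.
  by rewrite -!EFinM -EFinD -mulrDl subrK mul1r.
pose d s := E2 s - g s * X s.
have gE2 s : 0 < s < rho -> g s * X s <= E2 s.
  move=> sD; have := young_powR q1 (U0 _ sD) (X0 _ sD).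
  move=> /(ler_wpM2l (powR_ge0 s (b - 1))); rewrite gE /src -mulrA => /le_trans; apply.
  by rewrite le_eqVlt; apply/orP; left; apply/eqP; rewrite /E2; ring.
have d0 : ge0D rho d by move=> s sD; rewrite subr_ge0 gE2.
have md : measurable_fun D d by exact: measurable_funB.
have gX0 : ge0D rho (fun s => g s * X s) by move=> s sD; rewrite mulr_ge0 ?g0 ?X0.
have E2d : intD rho E2 = (S%:E + intD rho d)%E.
  rewrite -gX -intDD//; apply: eq_intD => s sD; rewrite /d; ring.
(* S + int d = int E2 <= L' <= S leaves no room for d. *)
have Id : intD rho d = 0%E.
  apply/eqP; rewrite eq_le intD_ge0// andbT -(leeD2lE (x := S%:E))// adde0 -E2d.
  by apply: (le_trans E2L); rewrite lee_fin.
have aeU : ae_eq mu D (EFin \o U) (EFin \o X).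
  have /(ae_eq_integral_abs mu (measurable_itv _)) :
      (\int[mu]_(s in `]0%R, rho[) `|(d s)%:E| = 0)%E.
    rewrite -[RHS]Id; apply: eq_integral => s; rewrite inE/= in_itv/= => sD.
    by rewrite ger0_norm// d0.
  move=> /(_ _)[|N [mN N0 sN]]; first exact/measurable_EFinP.
  exists N; split => // s /= h; apply: sN => /= dE; apply: h => sD.
  congr EFin; apply/eqP; apply/negPn/negP => UX.
  move: (sD); rewrite /= in_itv/= => sD'.
  have := young_powR_lt q1 (U0 _ sD') (X0 _ sD') UX.
  have /andP[s0 _] := sD'.
  rewrite -(ltr_pM2l (powR_gt0 (b - 1) s0)).
  have [+] := dE sD; rewrite /d /E2 gE /src; lra.
(* From here X replaces U: being a potential, it satisfies its equation at every point, and the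
   almost everywhere equality X = U only has to pass under the integral defining [head]. *)
have headE t : t <= rho -> head g t = head (src b q X) t.
  move=> tr; apply: ge0_ae_eq_integral => //.
  - apply/measurable_EFinP; apply: measurable_funS mg => //.
    by apply: subset_itvl; rewrite bnd_simp.
  - apply/measurable_EFinP; apply: measurable_funS (measurable_src b q mX) => //.
    by apply: subset_itvl; rewrite bnd_simp.
  - by move=> s _; rewrite lee_fin gE src_ge0.
  - by move=> s _; rewrite lee_fin src_ge0.
  - case: aeU => N [mN N0 sN]; exists N; split => // s /= h; apply: sN => /= UX; apply: h.
    rewrite in_itv/= => /andP[s0 st]; rewrite gE /src.
    have [E] : (U s)%:E = (X s)%:E.
      by apply: UX; rewrite in_itv/= s0 (lt_le_trans st).
    by rewrite E.
have greeneE t : Ke g t = Ke (src b q X) t.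
  apply: eq_integral => s; rewrite inE/= in_itv/= => /andP[_ sr].
  by rewrite headE// ltW.
(* <g, X> = S > 0 is the integral of t^(- nu) [head g] [head (src a p V)], so both masses are
   positive at a common point; this gives the positivity of both components. *)
have pair_gt0 : exists2 t0, 0 < t0 < rho & (0 < head g t0)%E /\ (0 < head (src a p V) t0)%E.
  apply: contrapT => H.
  have : intD rho (fun s => g s * X s) = 0%E.
    transitivity (\int[mu]_(t in `]0%R, rho[) ((g t)%:E * Ke (src a p V) t))%E.
      apply: eq_integral => s; rewrite inE/= in_itv/= => /andP[s0 _].
      by rewrite (EFinM (g s)) XE /green fineK// finX.
    rewrite greene_pairing//; last first.
    - exact: measurable_src.
    - by move=> s _; exact: src_ge0.
    apply: integral0_eq => s /=; rewrite in_itv/= => sD.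
    have /andP[s0 sr] := sD.
    have h1 : (0 <= head g s)%E by apply: (@head_ge0 _ rho) => //; exact: ltW.
    have h2 : (0 <= head (src a p V) s)%E.
      by apply: integral_ge0 => z _; rewrite lee_fin src_ge0.
    move: h1; rewrite le_eqVlt => /predU1P[<-|h1]; first by rewrite mule0.
    move: h2; rewrite le_eqVlt => /predU1P[<-|h2]; first by rewrite mule0 mul0e.
    by exfalso; apply: H; exists s.
  by rewrite gX => -[] /eqP; rewrite gt_eqF.
have [t0 t0D [hg0 hV0]] := pair_gt0.
have S0V : 0 <= S^-1 by rewrite invr_ge0 ltW.
(* In the last constant, C2 serves the mass bound and C2 / S the pointwise bound on V = W/S. *)
exists S^-1, CA, (S^-1 * C2 + C2), X, V; split.
- by rewrite invr_gt0.
- exact: CA0.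
- by rewrite addr_ge0// mulr_ge0.
- split.
  + exact: hbX.
  + exact: finX.
  + move=> t tD; have /andP[t00 _] := tD; have /andP[_ ->] := Xbd _ t00; rewrite andbT.
    rewrite XE -lte_fin fineK ?finX//; apply: (@greene_gt0 _ t0).
    * by move=> s _; exact: src_ge0.
    * exact: measurable_src.
    * exact: t0D.
    * exact: hV0.
    * exact: tD.
  + by move=> t; rewrite mul1r XE.
  + exact: mX.
- split.
  + move=> s sD; have /andP[s0 sr] := sD; rewrite -headE ?(ltW sr)//.
    apply: (le_trans (hbW _ sD)); rewrite lee_fin ler_wpM2r ?powR_ge0// lerDr.
    exact: mulr_ge0.
  + by move=> t t0'; rewrite -greeneE finW.
  + move=> t tD; have /andP[t00 _] := tD; have /andP[_ W1] := Wbd _ t00.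
    apply/andP; split.
      rewrite VE mulr_gt0 ?invr_gt0// WE -lte_fin fineK ?finW//.
      exact: (@greene_gt0 _ t0).
    apply: (@le_trans _ _ (S^-1 * (C2 * t `^ (- be)))).
      by rewrite VE ler_wpM2l.
    by rewrite mulrA ler_wpM2r ?powR_ge0// lerDl.
  + by move=> t; rewrite VE WE /green greeneE.
  + exact: mV.
Qed.

End existence.

(** * Regularity of the Green operator *)

Section regularity.
Context {R : realType}.
Notation mu := (@lebesgue_measure R).
Variables (nu rho : R).
Local Notation D := (`]0%R, rho[%classic : set R).
Implicit Types (f : R -> R) (s t C X : R).

Hypotheses (nu0 : 0 <= nu).
Variables (f : R -> R) (C X : R).
Hypotheses (f0 : ge0D rho f) (mf : measurable_fun D f).
Hypotheses (C0 : 0 <= C) (X0 : 0 <= X) (hb : head_bound rho f C X).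
Hypotheses (fin : forall t, 0 < t -> greene nu rho f t \is a fin_num).

Definition mass t : R := fine (head f t).

Lemma head_fin t : 0 < t < rho -> head f t \is a fin_num.
Proof.
move=> tD; have /andP[_ tr] := tD; rewrite ge0_fin_numE.
  by rewrite (le_lt_trans (hb tD)) ?ltry.
by apply: (head_ge0 f0); exact: ltW.
Qed.

Lemma mass_ge0 t : 0 < t < rho -> 0 <= mass t.
Proof. by move=> /andP[_ tr]; rewrite fine_ge0// (head_ge0 f0)// ltW. Qed.

Lemma mass_le t : 0 < t < rho -> mass t <= C * t `^ X.
Proof. by move=> tD; rewrite -lee_fin fineK ?head_fin// hb. Qed.

Lemma continuous_green t : 0 < t < rho -> {for t, continuous (green nu rho f)}.
Proof.
move=> tD; apply/cvgrPdist_lt => e e0.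
have [d d0 hd] := @green_equicontinuous R nu rho C X t e C0 X0 nu0 tD e0.
near=> s; rewrite distrC; have [|_ h] := hd s.
  by rewrite distrC; near: s; apply/nbhs_ballP; exists d.
by apply: h => // z /andP[z0 _]; exact: fin.
Unshelve. all: by end_near. Qed.

Lemma is_derive_mass t : 0 < t < rho -> {for t, continuous f} ->
  is_derive t 1 mass (f t).
Proof.
move=> tD ft; have /andP[t0 tr] := tD.
pose u := (t + rho) / 2.
have tu : t < u by rewrite /u; lra.
have ur : u < rho by rewrite /u; lra.
have u0 := lt_trans t0 tu.
have mfx x : x < rho -> measurable_fun (`]0, x[%classic : set R) (EFin \o f).
  move=> xr; apply/measurable_EFinP; apply: measurable_funS mf => //.
  by apply: subset_itvl; rewrite bnd_simp ltW.
have oc x : x < rho -> (\int[mu]_(s in `]0%R, x]) (f s)%:E)%E = head f x.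
  by move=> xr; rewrite -integral_itv_bndo_bndc//; exact: mfx.
have intu : mu.-integrable `]0, u] (EFin \o f).
  apply/integrableP; split.
    apply/measurable_EFinP; apply: measurable_funS mf => //.
    by apply: subset_itvl; rewrite bnd_simp.
  apply: (@le_lt_trans _ _ (\int[mu]_(s in `]0%R, u]) (f s)%:E)%E); last first.
    by rewrite oc// -ge0_fin_numE ?(head_ge0 f0) ?(ltW ur)// head_fin// u0.
  rewrite le_eqVlt; apply/orP; left; apply/eqP; apply: eq_integral.
  move=> s; rewrite inE/= in_itv/= => /andP[s0 su].
  by rewrite ger0_norm// f0// s0 (le_lt_trans su).
have [d1 d2] := @continuous_FTC1 R f (BRight 0) t u tu intu t0 ft.
have E : \near t, (\int[mu]_(s in [set` Interval (BRight 0) (BRight t)]) (f s))%R = mass t.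
  by near=> x; rewrite /Rintegral oc//; near: x; exact: lt_nbhsl.
split.
  by apply: near_eq_derivable d1.
by rewrite -(near_eq_derive _ E)// -derive1E.
Unshelve. all: by end_near. Qed.

Lemma is_derive_green t : 0 < t < rho -> {for t, continuous mass} ->
  is_derive t 1 (green nu rho f) (- (t `^ (- nu) * mass t)).
Proof.
move=> tD Mt; have /andP[t0 tr] := tD.
pose u := (t + rho) / 2.
have tu : t < u by rewrite /u; lra.
have ur : u < rho by rewrite /u; lra.
(* [greene f] is known to be finite only at positive points, so near t the potential is written as
   the constant [green f t1] minus an integral starting at t1 > 0. *)
pose t1 := t / 2.
have t1t : t1 < t by rewrite /t1; lra.
have t10 : 0 < t1 by rewrite /t1; lra.
pose k s := s `^ (- nu) * mass s.
have kE s : 0 < s < rho -> ((s `^ (- nu))%:E * head f s = (k s)%:E)%E.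
  by move=> sD; rewrite EFinM fineK ?head_fin.
have kI x : t1 <= x -> x < rho ->
    greene nu rho f t1 = (\int[mu]_(s in `]t1, x]) (k s)%:E + greene nu rho f x)%E.
  move=> tx xr; rewrite (greene_split nu f0 mf t10 tx xr); congr (_ + _)%E.
  apply: eq_integral => s; rewrite inE/= in_itv/= => /andP[s1 sx].
  by rewrite kE// (lt_trans t10)//= (le_lt_trans sx).
have k0 s : 0 < s < rho -> 0 <= k s by move=> sD; rewrite mulr_ge0 ?powR_ge0 ?mass_ge0.
have intu : mu.-integrable `]t1, u] (EFin \o k).
  apply/integrableP; split.
    apply: (@eq_measurable_fun _ _ _ _ _ (fun s => (s `^ (- nu))%:E * head f s)%E).
      move=> s; rewrite inE/= in_itv/= => /andP[s1 su].
      by rewrite kE// (lt_trans t10)//= (le_lt_trans su).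
    apply: measurable_funS (measurable_green_integrand nu f0 mf) => //.
    move=> s /=; rewrite !in_itv/= => /andP[s1 su].
    by rewrite (lt_trans t10)//= (le_lt_trans su).
  apply: (@le_lt_trans _ _ (\int[mu]_(s in `]t1, u]) (k s)%:E)%E).
    rewrite le_eqVlt; apply/orP; left; apply/eqP; apply: eq_integral.
    move=> s; rewrite inE/= in_itv/= => /andP[s0 su].
    by rewrite ger0_norm// k0// (lt_trans t10)//= (le_lt_trans su).
  have := fin t10; rewrite (kI u) ?(ltW (lt_trans t1t tu))// fin_numD => /andP[+ _].
  rewrite ge0_fin_numE//; apply: integral_ge0 => s /=; rewrite in_itv/= => /andP[s0 su].
  by rewrite lee_fin k0// (lt_trans t10)//= (le_lt_trans su).
have ck : {for t, continuous k} by apply: cvgM => //; exact: continuous_powR.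
have [d1 d2] := @continuous_FTC1 R k (BRight t1) t u tu intu t1t ck.
pose F x := (\int[mu]_(s in [set` Interval (BRight t1) (BRight x)]) (k s))%R.
have dF : is_derive t 1 F (k t) by split => //; rewrite -derive1E.
have E : \near t, green nu rho f t1 - F t = green nu rho f t.
  near=> x.
  have x1 : t1 < x by near: x; exact: lt_nbhsr.
  have xr : x < rho by near: x; exact: lt_nbhsl.
  have x0 := lt_trans t10 x1.
  rewrite {1}/green (kI x) ?(ltW x1)// fineD ?fin//.
    by rewrite /F /Rintegral addrAC subrr add0r.
  by have := fin t10; rewrite (kI x) ?(ltW x1)// fin_numD => /andP[].
have dG : is_derive t 1 (fun x => green nu rho f t1 - F x) (- (k t)).
  by apply: is_derive_eq; rewrite add0r mul1r.
have [g1 g2] := dG.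
split; first by apply: near_eq_derivable g1.
by rewrite -(near_eq_derive _ E)// g2.
Unshelve. all: by end_near. Qed.

End regularity.

(** * Borel sets and Lebesgue measure of R^n *)

Section rowvec_borel.
Context {R : realType}.

Lemma measurable_rowvec_box n (A : 'I_n -> set (measurableTypeR R)) :
  (forall i, measurable (A i)) ->
  measurable [set x : 'rV[R]_n | forall i, A i (rowvec_coord i x)].
Proof.
move=> mA; rewrite (_ : [set _ | _] = \bigcap_(i in [set: 'I_n])
    (rowvec_coord i @^-1` A i)).
  apply: fin_bigcap_measurable => // i _.
  by rewrite -[X in measurable X]setTI; exact: measurable_rowvec_coord.
by apply/seteqP; split => x /= h i *; exact: h.
Qed.

(** The sigma-algebra is generated by the coordinates, so A is written as the countable union of the
    boxes with rational centre and radius 1/(k + 1) that it contains. *)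
Lemma open_measurable_rowvec n (A : set 'rV[R]_n) : open A -> measurable A.
Proof.
move=> oA.
pose box (z : 'rV[rat]_n * nat) : set 'rV[R]_n :=
  [set x | forall i, ball (ratr (z.1 ord0 i) : R) (z.2.+1%:R^-1) (rowvec_coord i x)].
have mbox z : measurable (box z).
  by apply: (@measurable_rowvec_box n (fun i => ball (ratr (z.1 ord0 i) : R) (z.2.+1%:R^-1))) => i; exact: measurable_ball.
rewrite (_ : A = \bigcup_z (if `[< box z `<=` A >] then box z else set0)).
  apply: countable_bigcupT_measurable; first exact: countableP.
  by move=> z; case: ifP.
apply/seteqP; split => [x Ax|x [z _]]; last by case: ifPn => // /asboolP; apply.
have /nbhs_ballP[e /= e0 eA] : nbhs x A by exact: open_nbhs_nbhs.
have e2 : 0 < e / 2 by rewrite divr_gt0.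
pose k := Num.truncn (e / 2)^-1.
have k0 : 0 < k.+1%:R^-1 :> R by rewrite invr_gt0.
have ke : k.+1%:R^-1 < e / 2.
  by rewrite -[ltRHS]invrK ltf_pV2 ?posrE ?invr_gt0// truncnS_gt.
have /choice[qi hq] : forall i : 'I_n, exists q : rat, `|ratr q - x ord0 i| < k.+1%:R^-1.
  move=> i; have [q] : exists q : rat, ratr q \in `](x ord0 i - k.+1%:R^-1), (x ord0 i + k.+1%:R^-1)[.
    by apply: rat_in_itvoo; rewrite ltrBlDr -addrA ltrDl addr_gt0.
  by rewrite in_itv/= -ltr_distl => ?; exists q.
exists (\row_i qi i, k) => //.
have bx : box (\row_i qi i, k) x.
  by move=> i /=; rewrite mxE /ball/= /rowvec_coord.
rewrite (_ : `[< _ >] = true)//; apply/asboolP => y By.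
apply: eA; rewrite /ball/=; split => // i j; rewrite !ord1 /ball/=.
have := By j; rewrite /= mxE /ball/= /rowvec_coord => h1.
have := hq j => h2.
rewrite (_ : x _ _ - _ = - (ratr (qi j) - x ord0 j) + (ratr (qi j) - y ord0 j)); last by ring.
apply: (le_lt_trans (ler_normD _ _)); rewrite normrN.
have -> : e = e / 2 + e / 2 by lra.
by rewrite ltrD// (lt_trans _ ke).
Qed.

Lemma measurable_rowvec_set1 n (a : 'rV[R]_n) : measurable [set a].
Proof.
rewrite (_ : [set a] = [set x : 'rV[R]_n | forall i, [set a ord0 i] (rowvec_coord i x)]).
  by apply: (@measurable_rowvec_box n (fun i => [set a ord0 i])) => i; exact: measurable_set1.
apply/seteqP; split => x /=; first by move=> ->.
by move=> h; apply/rowP => i; exact: h.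
Qed.

Lemma compact_measurable_rowvec n (K : set 'rV[R]_n) : compact K -> measurable K.
Proof.
move=> cK; rewrite -(setCK K); apply: measurableC; apply: open_measurable_rowvec.
by apply: closed_openC; apply: compact_closed => //; exact: norm_hausdorff.
Qed.

Lemma continuous_measurable_rowvec n (O : set 'rV[R]_n) (f : 'rV[R]_n -> R) :
  open O -> (forall x, O x -> {for x, continuous f}) -> measurable_fun O f.
Proof.
move=> oO cf mO.
have : measurable_fun O (f : 'rV[R]_n -> measurableTypeR R).
  apply: (measurability _ (RGenOpens.measurableE R)).
  move=> _ [_ [a [b ->] <-]]; apply: open_measurable_rowvec.
  rewrite openE => x [Ox fx]; rewrite /interior.
  apply: filterI; first exact: open_nbhs_nbhs.
  apply: cf => //; apply: open_nbhs_nbhs; split => //; exact: interval_open.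
by apply.
Qed.

End rowvec_borel.

Section rowvec_integrals.
Context {R : realType}.
Notation mu := (@lebesgue_measure R).

Lemma integral_rowvec_prod n (g : R -> R) (M : R) : measurable_fun setT g ->
  (forall t, 0 <= g t) -> (\int[mu]_t (g t)%:E = M%:E)%E ->
  (\int[lebesgue_rV n]_x (\prod_(i < n) g (x ord0 i))%:E = (M ^+ n)%:E)%E.
Proof.
move=> mg g0 gM.
have mprod k : measurable_fun setT (fun x : 'rV[R]_k => \prod_(i < k) g (x ord0 i)).
  apply: measurable_prod => i _.
  exact: (measurableT_comp mg (@measurable_rowvec_coord R k i)).
elim: n => [|n ih].
  rewrite /= integral_dirac//=; last by apply/measurable_EFinP; exact: (mprod 0%N).
  by rewrite diracT mul1e big_ord0 expr0.
rewrite /= ge0_integral_pushforward//=.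
- rewrite fubini_tonelli1//=.
  + transitivity (\int[mu]_x (g x * M ^+ n)%:E)%E.
      apply: eq_integral => x _; rewrite /fubini_F/=.
      under eq_integral => y _.
        rewrite big_ord_recl rowvec_cons0/=.
        under eq_bigr do rewrite rowvec_consS/=.
        rewrite EFinM; over.
      rewrite ge0_integralZl//= ?lee_fin// ?ih ?EFinM//.
      - apply/measurable_EFinP; exact: (mprod n).
      - by move=> y _; rewrite lee_fin prodr_ge0.
    under eq_integral do rewrite mulrC EFinM.
    have M0 : 0 <= M by rewrite -lee_fin -gM integral_ge0// => t _; rewrite lee_fin.
    rewrite ge0_integralZl//= ?lee_fin ?exprn_ge0//.
    * by rewrite gM -EFinM exprSr.
    * exact/measurable_EFinP.
    * by move=> x _; rewrite lee_fin.
  + have mE : measurable_fun setT (fun x : 'rV[R]_n.+1 => (\prod_(i < n.+1) g (x ord0 i))%:E).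
      by apply/measurable_EFinP; exact: (mprod n.+1).
    exact: (measurableT_comp mE (@measurable_rowvec_cons R n)).
  + by move=> x; rewrite lee_fin prodr_ge0.
- exact: measurable_rowvec_cons.
- by apply/measurable_EFinP; exact: (mprod n.+1).
- by move=> x _; rewrite lee_fin prodr_ge0.
Qed.

Lemma lebesgue_rV_hyperplane n (i : 'I_n) :
  lebesgue_rV n [set x : 'rV[R]_n | x ord0 i = 0] = 0%E.
Proof.
pose A (j : 'I_n) : set (measurableTypeR R) := if j == i then [set 0] else setT.
rewrite (_ : [set _ | _] = [set x : 'rV[R]_n | forall j, A j (rowvec_coord j x)]).
  rewrite (@lebesgue_rV_box R n A); last first.
    by move=> j; rewrite /A; case: ifP => // _; exact: measurable_set1.
  by rewrite (bigD1 i)//= /A eqxx lebesgue_measure_set1 mul0e.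
apply/seteqP; split => x /=.
  by move=> xi j; rewrite /A; case: eqP => // ->.
by move=> /(_ i); rewrite /A eqxx.
Qed.

Lemma measurable_hyperplane n (i : 'I_n) : measurable [set x : 'rV[R]_n | x ord0 i = 0].
Proof.
rewrite (_ : [set _ | _] = rowvec_coord i @^-1` [set (0:R)])//.
rewrite -[X in measurable X]setTI; apply: measurable_rowvec_coord => //.
Qed.

(** A null set containing the origin when n > 0, off which every coordinate is nonzero; it serves as
    the exceptional set of almost everywhere statements. *)
Definition hyperplanes n : set 'rV[R]_n := \bigcup_(i in [set: 'I_n]) [set x | x ord0 i = 0].
Arguments hyperplanes : clear implicits.

Lemma measurable_hyperplanes n : measurable (hyperplanes n).
Proof. by apply: fin_bigcup_measurable => // i _; exact: measurable_hyperplane. Qed.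

Lemma lebesgue_rV_hyperplanes n : lebesgue_rV n (hyperplanes n) = 0%E.
Proof.
apply/eqP; rewrite eq_le measure_ge0 andbT.
have := @content_sub_fsum _ _ _ (lebesgue_rV n) _ [set: 'I_n] (hyperplanes n)
  (fun i => [set x | x ord0 i = 0]) finite_finset.
move=> /(_ (fun i _ => measurable_hyperplane i) (@measurable_hyperplanes n) (@subset_refl _ _)).
by rewrite fsbig1// => i _; exact: lebesgue_rV_hyperplane.
Qed.

End rowvec_integrals.

Arguments hyperplanes {R} n.

(** * The squared norm and integrability of its powers on balls *)

Section sqnorm.
Context {R : realType}.
Notation mu := (@lebesgue_measure R).
Implicit Types (c e C r t : R).

Definition sqn n (x : 'rV[R]_n) : R := \sum_i x ord0 i ^+ 2.

Lemma sqn_ge0 n (x : 'rV[R]_n) : 0 <= sqn x.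
Proof. by apply: sumr_ge0 => i _; exact: sqr_ge0. Qed.

Lemma sqr_le_sqn n (x : 'rV[R]_n) i : x ord0 i ^+ 2 <= sqn x.
Proof.
rewrite /sqn (bigD1 i)//= lerDl; apply: sumr_ge0 => j _; exact: sqr_ge0.
Qed.

Lemma sqn_eq0 n (x : 'rV[R]_n) : (sqn x == 0) = (x == 0).
Proof.
apply/idP/eqP => [/eqP x0|->]; last first.
  by rewrite /sqn big1// => i _; rewrite mxE expr0n.
apply/rowP => i; rewrite mxE; apply/eqP; rewrite -sqrf_eq0 eq_le sqr_ge0 andbT.
by rewrite -x0 sqr_le_sqn.
Qed.

Lemma sqn_gt0 n (x : 'rV[R]_n) : x != 0 -> 0 < sqn x.
Proof. by move=> x0; rewrite lt_def sqn_ge0 andbT sqn_eq0. Qed.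

Lemma enormE n (x : 'rV[R]_n) : enorm x = Num.sqrt (sqn x). Proof. by []. Qed.

Lemma eball_sqn n r (x : 'rV[R]_n) : 0 < r -> eball r x <-> sqn x < r ^+ 2.
Proof.
move=> r0; rewrite /eball/= enormE.
have rE : r = Num.sqrt (r ^+ 2) by rewrite sqrtr_sqr ger0_norm// ltW.
by rewrite [in X in X <-> _]rE ltr_sqrt// exprn_gt0.
Qed.

Lemma cvg_bigsum (T : Type) (F : set_system T) {FF : Filter F} (I : Type) (s : seq I)
    (f : I -> T -> R) (l : I -> R) :
  (forall i, f i y @[y --> F] --> l i) ->
  \sum_(i <- s) f i y @[y --> F] --> \sum_(i <- s) l i.
Proof.
move=> fl; elim: s => [|i s ih].
  by rewrite big_nil; under eq_fun do rewrite big_nil; exact: cvg_cst.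
rewrite big_cons; under eq_fun do rewrite big_cons.
exact: cvgD.
Qed.

Lemma continuous_sqn n : continuous (@sqn n).
Proof.
move=> x.
have h i : (fun y : 'rV[R]_n => y ord0 i ^+ 2) @ x --> x ord0 i ^+ 2.
  have c : (fun y : 'rV[R]_n => y ord0 i) @ x --> x ord0 i by exact: coord_continuous.
  exact: (cvgM c c).
exact: (@cvg_bigsum _ (nbhs x) _ _ (index_enum _)
  (fun i (y : 'rV[R]_n) => y ord0 i ^+ 2) (fun i => x ord0 i ^+ 2) h).
Qed.

Lemma open_eball n r : 0 < r -> open (@eball R n r).
Proof.
move=> r0; rewrite (_ : eball r = (@sqn n) @^-1` [set t | t < r ^+ 2]).
  by apply: open_comp; [move=> x _; exact: continuous_sqn|exact: open_lt].
by apply/seteqP; split => x; rewrite eball_sqn.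
Qed.

Lemma measurable_eball n r : 0 < r -> measurable (@eball R n r).
Proof. by move=> r0; apply: open_measurable_rowvec; exact: open_eball. Qed.

(** The origin is split off as a measurable singleton, so the value of f there is arbitrary. *)
Lemma measurable_fun_eball n r (f : 'rV[R]_n -> R) : 0 < r ->
  (forall x, eball r x -> x != 0 -> {for x, continuous f}) ->
  measurable_fun (eball r : set 'rV[R]_n) f.
Proof.
move=> r0 cf.
have oD : open (eball r `\` [set (0 : 'rV[R]_n)]).
  rewrite setDE; apply: openI; first exact: open_eball.
  apply: closed_openC; exact: (accessible_closed_set1 (hausdorff_accessible (@norm_hausdorff _ _))).
have mD : measurable_fun (eball r `\` [set (0 : 'rV[R]_n)]) f.
  apply: continuous_measurable_rowvec => // x [Bx /= /eqP x0]; exact: cf.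
have mB := @measurable_eball n r r0.
have m0 : measurable [set (0 : 'rV[R]_n)] by exact: measurable_rowvec_set1.
rewrite -(setDUK (_ : [set (0 : 'rV[R]_n)] `<=` eball r)).
  apply/measurable_funU => //; first exact: measurableD.
  by split => //; exact: measurable_fun_set1.
by move=> x /= ->; rewrite eball_sqn// (_ : sqn 0 = 0) ?exprn_gt0//; apply/eqP; rewrite sqn_eq0.
Qed.

Let G e r t : R := t `^ (- e) * \1_(`]0, r[%classic : set R) t.

Let mG e r : measurable_fun setT (G e r).
Proof.
by apply: measurable_funM; [exact: measurable_powR|exact: measurable_indic].
Qed.

Let G0 e r t : 0 <= G e r t.
Proof. by rewrite mulr_ge0 ?powR_ge0// indicE. Qed.

Let intG e r : 0 < r -> e < 1 -> (\int[mu]_t (G e r t)%:E < +oo)%E.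
Proof.
move=> r0 e1.
apply: (@le_lt_trans _ _ ((1 - e)^-1 * r `^ (1 - e))%:E); last exact: ltry.
apply: (le_trans _ (@integral_powR_head R (1 - e) r _ r0)); last by rewrite subr_gt0.
rewrite [leRHS]integral_mkcond le_eqVlt; apply/orP; left; apply/eqP; apply: eq_integral => t _.
rewrite patchE /G indicE; case: ifPn => _; rewrite ?mulr1 ?mulr0//.
by congr (_ `^ _)%:E; ring.
Qed.

Let intGN e r : (\int[mu]_t (G e r (- t))%:E = \int[mu]_t (G e r t)%:E)%E.
Proof.
transitivity (\int[pushforward mu (-%R : measurableTypeR R -> measurableTypeR R)]_t (G e r t)%:E)%E.
  rewrite ge0_integral_pushforward//.
  - apply/measurable_EFinP; exact: mG.
  - by move=> t _; rewrite lee_fin.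
by apply: eq_measure_integral => A mA _; exact: lebesgue_measureN.
Qed.

(* Off the coordinate hyperplanes [sqn x ^ (- c)] is at most the product of the
   [|x_i| ^ (- 2 c / n)], each of which is integrable in one variable. *)
Lemma integral_powR_sqn n c r : 0 < r -> 0 <= c -> 2 * c < n%:R ->
  (\int[lebesgue_rV n]_(x in eball r `\` hyperplanes n) (sqn x `^ (- c))%:E < +oo)%E.
Proof.
move=> r0 c0 cn.
have n0 : 0 < n%:R :> R by rewrite (le_lt_trans _ cn)// mulr_ge0.
have n0' : n%:R != 0 :> R by rewrite gt_eqF.
pose e := 2 * c / n%:R.
have e1 : e < 1 by rewrite ltr_pdivrMr// mul1r.
(* This is |t|^(- e) for 0 < |t| < r and 0 elsewhere; e < 1 makes it integrable on the line. *)
pose g t := G e r t + G e r (- t).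
have mGN : measurable_fun setT (fun t => G e r (- t)).
  have mo : measurable_fun setT (fun t : R => - t) by exact: oppr_measurable.
  exact: (measurableT_comp (mG e r) mo).
have mg : measurable_fun setT g by exact: measurable_funD.
have g0 t : 0 <= g t by rewrite addr_ge0.
have [M gM] : exists M : R, (\int[mu]_t (g t)%:E = M%:E)%E.
  exists (fine (\int[mu]_t (g t)%:E)); rewrite fineK// ge0_fin_numE; last first.
    by apply: integral_ge0 => t _; rewrite lee_fin.
  rewrite /g; under eq_integral do rewrite EFinD.
  rewrite ge0_integralD//=.
  - by rewrite intGN lte_add_pinfty// intG.
  - by move=> t _; rewrite lee_fin.
  - by apply/measurable_EFinP; exact: mG.
  - by move=> t _; rewrite lee_fin.
  - exact/measurable_EFinP.
apply: (@le_lt_trans _ _ (\int[lebesgue_rV n]_x (\prod_(i < n) g (x ord0 i))%:E)%E); last first.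
  by rewrite (integral_rowvec_prod n mg g0 gM) ltry.
have mprod : measurable_fun setT (fun x : 'rV[R]_n => (\prod_(i < n) g (x ord0 i))%:E).
  apply/measurable_EFinP; apply: measurable_prod => i _.
  exact: (measurableT_comp mg (@measurable_rowvec_coord R n i)).
have mD : measurable (eball r `\` hyperplanes n : set 'rV[R]_n).
  by apply: measurableD; [exact: measurable_eball|exact: measurable_hyperplanes].
apply: (@le_trans _ _ (\int[lebesgue_rV n]_(x in eball r `\` hyperplanes n)
    (\prod_(i < n) g (x ord0 i))%:E)%E); last first.
  apply: ge0_subset_integral => //; first by move=> x _; rewrite lee_fin prodr_ge0.
apply: ge0_le_integral => //.
- by move=> x _; rewrite lee_fin powR_ge0.
- apply/measurable_EFinP; apply: measurable_funTS.
  apply: (measurableT_comp (measurable_powR (- c))).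
  by apply: continuous_measurable_rowvec; [exact: openT|move=> x _; exact: continuous_sqn].
- exact: measurable_funTS.
- move=> x [Bx Hx]; rewrite lee_fin.
  have xi i : x ord0 i != 0 by apply/eqP => xi0; apply: Hx; exists i.
  have {}Bx : sqn x < r ^+ 2 by apply/eball_sqn.
  have gi i : sqn x `^ (- (c / n%:R)) <= g (x ord0 i).
    have ar : `|x ord0 i| < r.
      rewrite -(@ltr_pXn2r _ 2)// ?nnegrE ?(ltW r0)// real_normK ?num_real//.
      exact: le_lt_trans (sqr_le_sqn x i) Bx.
    have a0 : 0 < `|x ord0 i| by rewrite normr_gt0.
    apply: (@le_trans _ _ (`|x ord0 i| `^ (- e))).
      have -> : `|x ord0 i| `^ (- e) = (x ord0 i ^+ 2) `^ (- (c / n%:R)).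
        rewrite -(real_normK (num_real _)) -powR_mulrn// -powRrM; congr (_ `^ _).
        by rewrite /e mulrN mulrA.
      have x2 : 0 < x ord0 i ^+ 2 by rewrite exprn_even_gt0//= xi.
      have s0 : 0 < sqn x by apply: lt_le_trans (sqr_le_sqn x i).
      rewrite !powRN lef_pV2 ?posrE ?powR_gt0//.
      by rewrite ge0_ler_powR ?nnegrE ?sqr_ge0 ?sqn_ge0 ?sqr_le_sqn// divr_ge0// ltW.
    have [x0|x0] := leP 0 (x ord0 i).
      rewrite ger0_norm// in ar a0 *; rewrite /g {1}/G indicE mem_set ?mulr1 ?lerDl//.
      by rewrite /= in_itv/= a0.
    rewrite ltr0_norm// in ar a0 *; rewrite /g {2}/G indicE mem_set ?mulr1 ?lerDr//.
    by rewrite /= in_itv/= a0.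
  have -> : sqn x `^ (- c) = \prod_(i < n) sqn x `^ (- (c / n%:R)).
    rewrite prodr_const card_ord -powR_mulrn ?powR_ge0// -powRrM; congr (_ `^ _).
    by rewrite mulNr mulfVK.
  by apply: ler_prod => i _; rewrite powR_ge0 gi.
Qed.

Lemma L1_sqn_bound n r c C (f : 'rV[R]_n -> R) : 0 < r -> 0 <= c -> 2 * c < n%:R ->
  measurable_fun (eball r : set 'rV[R]_n) f ->
  (forall x, eball r x -> x != 0 -> `|f x| <= C * sqn x `^ (- c)) ->
  L1 (eball r) f.
Proof.
move=> r0 c0 cn mf fC.
have n0 : 0 < n%:R :> R by rewrite (le_lt_trans _ cn)// mulr_ge0.
have mB := @measurable_eball n r r0.
have mH := @measurable_hyperplanes R n.
have mfE : measurable_fun (eball r : set 'rV[R]_n) (EFin \o f) by exact/measurable_EFinP.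
apply/(negligible_integrable mH mB mfE (lebesgue_rV_hyperplanes n)).
have mD := measurableD mB mH.
apply: (@le_integrable _ _ _ _ _ mD _ (fun x => (`|C| * sqn x `^ (- c))%:E)).
- exact: measurable_funS mfE.
- move=> x [Bx Hx] /=; rewrite lee_fin.
  have x0 : x != 0.
    apply/eqP => x0; apply: Hx; case: n => [|n] in f x mf fC n0 cn mB mH mfE mD Bx x0 *.
      by move: n0; rewrite ltxx.
    by exists ord0 => //=; rewrite x0 mxE.
  rewrite (le_trans (fC _ Bx x0))// [leRHS]ger0_norm ?mulr_ge0 ?powR_ge0//.
  by rewrite ler_wpM2r ?powR_ge0// ler_norm.
- have mN : measurable_fun (eball r `\` hyperplanes n) (fun x : 'rV[R]_n => (sqn x `^ (- c))%:E).
    apply/measurable_EFinP; apply: measurable_funTS.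
    apply: (measurableT_comp (measurable_powR (- c))).
    by apply: continuous_measurable_rowvec; [exact: openT|move=> x _; exact: continuous_sqn].
  under eq_fun do rewrite EFinM; apply: integrableZl => //.
  apply/integrableP; split => //.
  apply: le_lt_trans (integral_powR_sqn r0 c0 cn).
  rewrite le_eqVlt; apply/orP; left; apply/eqP; apply: eq_integral => x _.
  by rewrite /= ger0_norm// powR_ge0.
Qed.

End sqnorm.

(** * Integration by parts off the origin *)

Section lines.
Context {R : realType}.
Notation mu := (@lebesgue_measure R).

Lemma is_derive_line n (F : 'rV[R]_n -> R) (x v : 'rV[R]_n) (t d : R) :
  is_derive (x + t *: v) v F d <-> is_derive t 1 (fun s => F (x + s *: v)) d.
Proof.
pose k1 h := h^-1 *: (F (h *: v + (x + t *: v)) - F (x + t *: v)).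
pose k2 h := h^-1 *: (F (x + (h *: (1 : R) + t) *: v) - F (x + t *: v)).
have E : k1 = k2.
  apply/funext => h; rewrite /k1 /k2; congr (_ *: (F _ - _)).
  by rewrite -[h *: (1 : R)]/(h * 1) mulr1 scalerDl addrCA.
by split => -[h1 h2]; split; [move: h1|move: h2|move: h1|move: h2];
  rewrite /derivable /derive -/k1 -/k2 ?E.
Qed.

Lemma continuous_line n (G : 'rV[R]_n -> R) (x v : 'rV[R]_n) (t : R) :
  {for x + t *: v, continuous G} -> {for t, continuous (fun s : R => G (x + s *: v))}.
Proof.
move=> cG; apply: (@continuous_comp _ _ _ (fun s : R => x + s *: v) G) => //.
apply: cvgD; first exact: cvg_cst.
by apply: cvgZr_tmp; exact: cvg_id.
Qed.

Lemma integral_derivative_eq0 (F G : R -> R) (M : R) :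
  (forall t : R, is_derive t 1 F (G t)) -> continuous G ->
  (forall t : R, M <= `|t| -> F t = 0 /\ G t = 0) -> (\int[mu]_t (G t)%:E = 0)%E.
Proof.
move=> dF cG FG0.
pose m := `|M| + 1.
have m0 : 0 < m by rewrite ltr_wpDl.
have Mm : M <= m by rewrite (le_trans (ler_norm M))// lerDl.
transitivity (\int[mu]_(t in `[(- m)%R, m]) (G t)%:E)%E.
  rewrite [RHS]integral_mkcond; apply: eq_integral => t _; rewrite patchE; case: ifPn => //.
  rewrite notin_setE/= in_itv/= -ler_norml => /negP; rewrite -ltNge => mt.
  by have [_ ->] := FG0 t (le_trans Mm (ltW mt)).
have mm : - m < m by rewrite gtrN.
rewrite (FTC2_is_derive mm (fun x _ => dF x) (fun x _ => cG x)).
have [-> _] := FG0 m (le_trans Mm (ler_norm m)).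
have [|-> _] := FG0 (- m); last by rewrite subrr.
by rewrite normrN (le_trans Mm)// ler_norm.
Qed.

Lemma rowvec_consE n (y : 'rV[R]_n) (t : R) :
  rowvec_cons (t, y) = rowvec_cons (0, y) + t *: delta_mx ord0 ord0.
Proof.
apply/rowP => i.
transitivity (rowvec_cons (0, y) ord0 i + t * (delta_mx ord0 ord0 : 'rV[R]_n.+1) ord0 i).
  rewrite [X in _ * X]mxE; case: (unliftP ord0 i) => [j|] ->.
    by rewrite !rowvec_consS/= mulr0 addr0.
  by rewrite !rowvec_cons0/= mulr1 add0r.
by rewrite [RHS]mxE [X in _ = _ + X]mxE.
Qed.

Lemma rowvec_consD n (x0 : R) (y : 'rV[R]_n) (j : 'I_n) (t : R) :
  rowvec_cons (x0, y + t *: delta_mx ord0 j) =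
  rowvec_cons (x0, y) + t *: delta_mx ord0 (lift ord0 j).
Proof.
apply/rowP => i.
transitivity (rowvec_cons (x0, y) ord0 i +
    t * (delta_mx ord0 (lift ord0 j) : 'rV[R]_n.+1) ord0 i).
  rewrite [X in _ * X]mxE; case: (unliftP ord0 i) => [k|] ->.
    rewrite !rowvec_consS [LHS]mxE [X in _ + X = _]mxE [X in _ + _ * X = _]mxE.
    by rewrite (inj_eq (@lift_inj _ ord0)).
  by rewrite !rowvec_cons0/= mulr0 addr0.
by rewrite [RHS]mxE [X in _ = _ + X]mxE.
Qed.

Definition C1_on_line n (F G : 'rV[R]_n -> R) (v x : 'rV[R]_n) :=
  (forall t : R, is_derive t 1 (fun s => F (x + s *: v)) (G (x + t *: v))) /\
  continuous (fun s : R => G (x + s *: v)).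

Definition box_supported n (M : R) (F : 'rV[R]_n -> R) :=
  forall (x : 'rV[R]_n) (j : 'I_n), M <= `|x ord0 j| -> F x = 0.

Section slices.
Variables (n : nat) (F G : 'rV[R]_n.+1 -> R) (M : R).
Hypotheses (intG : (lebesgue_rV n.+1).-integrable setT (EFin \o G)).
Hypotheses (FM : box_supported M F) (GM : box_supported M G).

Let Gc := (EFin \o G) \o @rowvec_cons R n.

Let mG : measurable_fun setT (EFin \o G).
Proof. exact: measurable_int intG. Qed.

Let mGc : measurable_fun setT Gc.
Proof. exact: (measurableT_comp mG (@measurable_rowvec_cons R n)). Qed.

Let intGc : (mu \x lebesgue_rV n)%E.-integrable setT Gc.
Proof.
apply/integrableP; split => //.
have /integrableP[_] := intG.
rewrite /= ge0_integral_pushforward//=.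
- exact: measurable_rowvec_cons.
- exact: (measurableT_comp (@abse_measurable _ _) mG).
Qed.

Let int_cons : (\int[lebesgue_rV n.+1]_x (G x)%:E =
  \int[(mu \x lebesgue_rV n)%E]_z Gc z)%E.
Proof.
rewrite /= integral_pushforward//=; exact: measurable_rowvec_cons.
Qed.

(** The derivative is in the first direction: the inner integral runs along that direction and
    vanishes on each line not over N. *)
Lemma integral_slice0 (N : set 'rV[R]_n) : measurable N -> lebesgue_rV n N = 0%E ->
  (forall y, ~ N y -> C1_on_line F G (delta_mx ord0 ord0) (rowvec_cons (0, y))) ->
  (\int[lebesgue_rV n.+1]_x (G x)%:E = 0)%E.
Proof.
move=> mN N0 h; rewrite int_cons -(integral21_prod_meas1 intGc).
rewrite (@ae_eq_integral _ _ _ (lebesgue_rV n) setT (cst 0%E))//.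
- by rewrite integral0.
- exact: (measurable_fubini_G intGc).
- exists N; split => // y /= hy; apply: contrapT => Ny; apply: hy => _.
  have [dF cG] := h _ Ny.
  apply: (@integral_derivative_eq0 (fun t => F (rowvec_cons (t, y)))
      (fun t => G (rowvec_cons (t, y))) M).
  + move=> t; rewrite (funext (fun s => congr1 F (rowvec_consE y s))) (rowvec_consE y t).
    exact: dF.
  + move=> t; rewrite (funext (fun s => congr1 G (rowvec_consE y s))).
    exact: cG.
  + by move=> t Mt; split; [apply: (@FM _ ord0)|apply: (@GM _ ord0)]; rewrite rowvec_cons0.
Qed.

(** For a derivative in another direction: freezing the first coordinate lowers the dimension. *)
Lemma integral_sliceS (N : set (measurableTypeR R)) : measurable N -> mu N = 0%E ->
  (forall t, ~ N t -> (lebesgue_rV n).-integrable setT (fun y => (G (rowvec_cons (t, y)))%:E) ->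
     \int[lebesgue_rV n]_y (G (rowvec_cons (t, y)))%:E = 0)%E ->
  (\int[lebesgue_rV n.+1]_x (G x)%:E = 0)%E.
Proof.
move=> mN N0 h; rewrite int_cons -(integral12_prod_meas1 intGc).
rewrite (@ae_eq_integral _ _ _ mu setT (cst 0%E))//.
- by rewrite integral0.
- exact: (measurable_fubini_F intGc).
- have aeN : {ae mu, forall t, ~ N t} by exists N; split => // t /= /contrapT.
  have := ae_integrable1 intGc; move: aeN; apply: filterS2 => t Nt it _.
  exact: h.
Qed.

End slices.

Lemma integral_partial_C1 n (i : 'I_n) (F G : 'rV[R]_n -> R) (M : R) :
  (lebesgue_rV n).-integrable setT (EFin \o G) ->
  box_supported M F -> box_supported M G ->
  (forall x, C1_on_line F G (delta_mx ord0 i) x) ->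
  (\int[lebesgue_rV n]_x (G x)%:E = 0)%E.
Proof.
elim: n i F G => [[]//|n ih] i F G intG FM GM h.
case: (unliftP ord0 i) => [j|] ij; last first.
  apply: (integral_slice0 intG FM GM measurable0 (measure0 _)) => y _.
  by rewrite -ij; exact: h.
apply: (integral_sliceS intG measurable0 (measure0 _)) => t _ it.
apply: (ih j (fun y => F (rowvec_cons (t, y)))) => //.
- by move=> x k xk; apply: (FM _ (lift ord0 k)); rewrite rowvec_consS.
- by move=> x k xk; apply: (GM _ (lift ord0 k)); rewrite rowvec_consS.
- move=> x; have [dF cG] := h (rowvec_cons (t, x)); rewrite ij in dF cG; split => s.
    rewrite (funext (fun s => congr1 F (rowvec_consD t x j s))) rowvec_consD.
    exact: dF.
  rewrite (funext (fun s => congr1 G (rowvec_consD t x j s))).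
  exact: cG.
Qed.

(* For [n >= 2] almost every line parallel to an axis misses the origin, so a
   singularity there does not affect integration by parts. *)
Lemma integral_partial_C1_off0 n (i : 'I_n) (F G : 'rV[R]_n -> R) (M : R) : (2 <= n)%N ->
  (lebesgue_rV n).-integrable setT (EFin \o G) ->
  box_supported M F -> box_supported M G ->
  (forall x : 'rV[R]_n, (exists2 j, j != i & x ord0 j != 0) -> C1_on_line F G (delta_mx ord0 i) x) ->
  (\int[lebesgue_rV n]_x (G x)%:E = 0)%E.
Proof.
case: n i F G => [[]//|n] i F G n2 intG FM GM h.
case: (unliftP ord0 i) => [j|] ij; last first.
  apply: (integral_slice0 intG FM GM (@measurable_hyperplanes R n)
    (lebesgue_rV_hyperplanes n)) => y Ny.
  case: n => [|n] in i F G n2 intG FM GM h ij y Ny *; first by [].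
  rewrite -ij; apply: h; exists (lift ord0 ord0); first by rewrite ij.
  rewrite rowvec_consS/=; apply/eqP => y0; apply: Ny; exists ord0 => //.
(* For t different from 0 the whole slice misses the origin, so the result without singularity
   applies to it. *)
apply: (integral_sliceS intG (@measurable_set1 R 0) (lebesgue_measure_set1 0)) => t t0 it.
apply: (@integral_partial_C1 n j (fun y => F (rowvec_cons (t, y))) _ M) => //.
- by move=> x k xk; apply: (FM _ (lift ord0 k)); rewrite rowvec_consS.
- by move=> x k xk; apply: (GM _ (lift ord0 k)); rewrite rowvec_consS.
- move=> x; have [|dF cG] := h (rowvec_cons (t, x)).
    exists ord0; first by rewrite ij.
    by rewrite rowvec_cons0/=; apply/eqP.
  rewrite ij in dF cG; split => s.
    rewrite (funext (fun s => congr1 F (rowvec_consD t x j s))) rowvec_consD.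
    exact: dF.
  rewrite (funext (fun s => congr1 G (rowvec_consD t x j s))).
  exact: cG.
Qed.

End lines.

(** * Test functions: support, bounds, measurability *)

Section test_functions.
Context {R : realType} {n : nat}.
Implicit Types (U : set 'rV[R]_n) (phi f : 'rV[R]_n -> R).

Lemma partials_eq0 (O : set 'rV[R]_n) phi : open O -> (forall x, O x -> phi x = 0) ->
  forall s x, O x -> partials s phi x = 0.
Proof.
move=> oO phi0; elim => [|i s ih] x Ox /=; first exact: phi0.
rewrite /partial (@near_eq_derive _ _ _ _ (cst 0)); first exact: derive_cst.
have : nbhs x O by exact: open_nbhs_nbhs.
by apply: filterS => y /ih.
Qed.

Lemma test_partials_eq0 U phi s x : test_function U phi -> ~ U x -> partials s phi x = 0.
Proof.
move=> [_ cK KU] Ux.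
apply: (@partials_eq0 (~` closure [set x | phi x != 0])).
- by apply: closed_openC; exact: closed_closure.
- move=> y Ky; apply/eqP; apply: contrapT => /negP y0; apply: Ky.
  exact: subset_closure.
- by move=> /KU.
Qed.

Lemma test_near0 U phi s x : test_function U phi -> ~ U x ->
  \near x, partials s phi x = 0.
Proof.
move=> [_ cK KU] Ux.
pose O := ~` closure [set x | phi x != 0].
have oO : open O by apply: closed_openC; exact: closed_closure.
have : nbhs x O by apply: open_nbhs_nbhs; split => // /KU.
apply: filterS => y Oy; apply: (@partials_eq0 O) => // z Kz.
by apply/eqP; apply: contrapT => /negP z0; apply: Kz; exact: subset_closure.
Qed.

Lemma test_partial U phi i : test_function U phi -> test_function U (partial i phi).
Proof.
move=> tphi; have [sphi cK KU] := tphi.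
have sub : closure [set x | partial i phi x != 0] `<=` closure [set x | phi x != 0].
  rewrite [X in _ `<=` X](closure_id _).1; last exact: closed_closure.
  apply: closure_subset => x /= px; apply: contrapT => Kx.
  move/eqP: px; apply.
  apply: (@partials_eq0 (~` closure [set x | phi x != 0]) phi _ _ [:: i]) => //.
  - by apply: closed_openC; exact: closed_closure.
  - move=> y Ky; apply/eqP; apply: contrapT => /negP y0; apply: Ky.
    exact: subset_closure.
split.
- move=> s; have [h1 h2] := sphi (rcons s i).
  by move: h1 h2; rewrite /partials foldr_rcons.
- by apply: subclosed_compact sub => //; exact: closed_closure.
- exact: subset_trans sub KU.
Qed.

Lemma test_bounded U phi s : test_function U phi ->
  exists2 M, 0 <= M & forall x, `|partials s phi x| <= M.
Proof.
move=> tphi; have [sphi cK KU] := tphi.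
pose K := closure [set x | phi x != 0].
have cc : compact (partials s phi @` K).
  apply: continuous_compact => //; apply: continuous_subspaceT => x.
  by case: (sphi s).
have [M [_ hM]] := compact_bounded cc.
exists (`|M| + 1); first by rewrite addr_ge0.
move=> x; have [Kx|Kx] := pselect (K x).
  by apply: hM; [rewrite (le_lt_trans (ler_norm M))// ltrDl|exists x].
rewrite (@partials_eq0 (~` K) phi) ?normr0 ?addr_ge0//.
- by apply: closed_openC; exact: closed_closure.
- move=> y Ky; apply/eqP; apply: contrapT => /negP y0; apply: Ky.
  exact: subset_closure.
Qed.

Lemma measurable_test U phi s : test_function U phi ->
  measurable_fun setT (partials s phi).
Proof.
move=> [sphi _ _]; apply: continuous_measurable_rowvec; first exact: openT.
by move=> x _; case: (sphi s) => + _; exact.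
Qed.

End test_functions.

(** * Weak derivatives of functions regular off the origin *)

Section weak_derivatives.
Context {R : realType} {n : nat}.
Variable r : R.
Hypothesis r0 : 0 < r.
Local Notation B := (eball r : set 'rV[R]_n).
Implicit Types (f df phi : 'rV[R]_n -> R) (i : 'I_n).

Lemma L1_L1loc f : L1 B f -> L1loc B f.
Proof.
move=> fB K cK KB; apply: integrableS fB => //; first exact: measurable_eball.
exact: compact_measurable_rowvec.
Qed.

Lemma L1M_test f phi s : L1 B f -> test_function B phi ->
  L1 B (fun x => f x * partials s phi x).
Proof.
move=> fB tphi; have [M M0 hM] := test_bounded s tphi.
have mB := @measurable_eball R n r r0.
have := @integrableMl _ _ _ (lebesgue_rV n) B mB (EFin \o f) (partials s phi) fB.
apply.
- exact: measurable_funTS (measurable_test s tphi).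
- exists M; split; first exact: num_real.
  by move=> y My x _; exact: le_trans (hM x) (ltW My).
Qed.

(** The derivative G of F = f phi has integral 0 over the whole space, by integration along lines.
    Nothing is known of f outside B, but phi and its derivative vanish there. *)
Lemma Rintegral_by_parts f df phi i : (2 <= n)%N ->
  (forall x, B x -> x != 0 -> is_derive x (delta_mx ord0 i : 'rV[R]_n) f (df x)) ->
  (forall x, B x -> x != 0 -> {for x, continuous f}) ->
  (forall x, B x -> x != 0 -> {for x, continuous df}) ->
  L1 B f -> L1 B df -> test_function B phi ->
  \int[lebesgue_rV n]_(x in B) (f x * partial i phi x) =
  - \int[lebesgue_rV n]_(x in B) (df x * phi x).
Proof.
move=> n2 f_df cf cdf fB dfB tphi.
have mB := @measurable_eball R n r r0.
have [sphi _ _] := tphi.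
pose F x := f x * phi x.
pose G x := df x * phi x + f x * partial i phi x.
have h1 : L1 B (fun x => df x * phi x) by exact: (@L1M_test df phi [::]).
have h2 : L1 B (fun x => f x * partial i phi x) by exact: (@L1M_test f phi [:: i]).
have GL : L1 B G.
  have := integrableD mB h1 h2; apply: eq_integrable => // x _.
have phi0 x : ~ B x -> phi x = 0 by exact: (@test_partials_eq0 R n B phi [::]).
have dphi0 x : ~ B x -> partial i phi x = 0 by exact: (@test_partials_eq0 R n B phi [:: i]).
have G0 x : ~ B x -> G x = 0 by move=> Bx; rewrite /G phi0// dphi0// !mulr0 addr0.
have GE : (EFin \o G) \_ B = EFin \o G.
  apply/funext => x; rewrite patchE; case: ifPn => // /negP; rewrite inE => /G0 /= ->.
  by [].
have GT : (lebesgue_rV n).-integrable setT (EFin \o G).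
  by rewrite -GE; apply/(integrable_mkcond _ mB).
have box (x : 'rV[R]_n) (j : 'I_n) : r <= `|x ord0 j| -> ~ B x.
  move=> rx; rewrite eball_sqn// => xr.
  have := le_lt_trans (sqr_le_sqn x j) xr.
  by rewrite -real_normK ?num_real// ltr_pXn2r// ?nnegrE ?(ltW r0)// ltNge rx.
have line z : z != 0 -> is_derive z (delta_mx ord0 i : 'rV[R]_n) F (G z) /\
    {for z, continuous G}.
  move=> z0; have [Bz|Bz] := pselect (B z).
    split.
      have d1 := f_df _ Bz z0.
      have d2 : is_derive z (delta_mx ord0 i : 'rV[R]_n) phi (partial i phi z).
        by apply: derivableP; case: (sphi [::]) => _; apply.
      have := is_deriveM d1 d2.
      by rewrite /F /G => d; apply: is_derive_eq d _; rewrite addrC [df z * _]mulrC.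
    have c0 : {for z, continuous phi} by case: (sphi [::]) => + _; exact.
    have c1 : {for z, continuous (partial i phi)} by case: (sphi [:: i]) => + _; exact.
    exact: (cvgD (cvgM (cdf z Bz z0) c0) (cvgM (cf z Bz z0) c1)).
  (* Outside B, boundary included, phi vanishes in a neighbourhood of z, so F and G are locally 0
     whatever f is. *)
  have n0 := @test_near0 R n B phi [::] z tphi Bz.
  have n1 := @test_near0 R n B phi [:: i] z tphi Bz.
  rewrite G0//; split.
    apply: (@near_eq_is_derive _ _ _ (cst 0)) (is_derive_cst _ _ _).
    by apply: filterS n0 => y /= y0; rewrite /F /= [phi y]y0 mulr0.
  rewrite /prop_for /continuous_at G0//.
  have H : \near z, G z = 0.
    by apply: filterS2 n0 n1 => y /= y0 y1; rewrite /G [phi y]y0 [partial i phi y]y1 !mulr0 addr0.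
  exact: (@cvg_near_cst _ _ (0 : R) G (nbhs z) _ H).
have IG : (\int[lebesgue_rV n]_x (G x)%:E = 0)%E.
  apply: (@integral_partial_C1_off0 R n i F G r n2 GT).
  - by move=> x j rx; rewrite /F phi0 ?mulr0//; exact: box rx.
  - by move=> x j rx; apply: G0; exact: box rx.
  - move=> x [j ji xj].
    have z0 (t : R) : x + t *: delta_mx ord0 i != 0.
      apply/eqP => /rowP/(_ j); rewrite !mxE (negbTE ji) andbF mulr0 addr0.
      by move/eqP; exact/negP.
    split => t.
      by apply/is_derive_line; case: (line _ (z0 t)).
    by apply: continuous_line; case: (line _ (z0 t)).
have : \int[lebesgue_rV n]_(x in B) G x = 0.
  by rewrite /Rintegral integral_mkcond [X in fine (\int[_]_x X x)%E]GE IG.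
rewrite RintegralD// => /eqP; rewrite addr_eq0 => /eqP ->.
by rewrite opprK.
Qed.

Lemma weak_partial_C1 f df i : (2 <= n)%N ->
  (forall x, B x -> x != 0 -> is_derive x (delta_mx ord0 i : 'rV[R]_n) f (df x)) ->
  (forall x, B x -> x != 0 -> {for x, continuous f}) ->
  (forall x, B x -> x != 0 -> {for x, continuous df}) ->
  L1 B f -> L1 B df -> weak_partials B [:: i] f df.
Proof.
move=> n2 f_df cf cdf fB dfB; split; [exact: L1_L1loc|exact: L1_L1loc|].
move=> phi tphi; rewrite /= expr1 mulN1r.
exact: Rintegral_by_parts.
Qed.

Lemma weak_partials_C2 u (Du : 'I_n -> 'rV[R]_n -> R) (D2u : 'I_n -> 'I_n -> 'rV[R]_n -> R) :
  (2 <= n)%N ->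
  (forall i x, B x -> x != 0 -> is_derive x (delta_mx ord0 i : 'rV[R]_n) u (Du i x)) ->
  (forall i j x, B x -> x != 0 ->
    is_derive x (delta_mx ord0 j : 'rV[R]_n) (Du i) (D2u i j x)) ->
  (forall x, B x -> x != 0 -> {for x, continuous u}) ->
  (forall i x, B x -> x != 0 -> {for x, continuous (Du i)}) ->
  (forall i j x, B x -> x != 0 -> {for x, continuous (D2u i j)}) ->
  L1 B u -> (forall i, L1 B (Du i)) -> (forall i j, L1 B (D2u i j)) ->
  [/\ W1 2 B u, forall i, weak_partials B [:: i] u (Du i) &
   forall f, L1 B f -> (forall x, B x -> x != 0 -> - \sum_i D2u i i x = f x) ->
     weak_poisson B u f].
Proof.
move=> n2 d1 d2 c0 c1 c2 L0 L1u L2.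
have w1 i : weak_partials B [:: i] u (Du i) by exact: (weak_partial_C1 n2 (d1 i) c0 (c1 i) L0 (L1u i)).
split => //.
- split => // s; case: s => [_|i [_|j [_|//]]].
  + exists u => //; split; [exact: L1_L1loc|exact: L1_L1loc|].
    by move=> phi tphi; rewrite /= expr0 mul1r.
  + by exists (Du i).
  + exists (D2u i j) => //; split; [exact: L1_L1loc|exact: L1_L1loc|].
    move=> phi tphi; rewrite /= -signr_odd/= expr0 mul1r.
    (* [partials [:: i; j] phi] is the i-th derivative of [partial j phi], so the first integration
       by parts tests u with [partial j phi], and the second moves j. *)
    rewrite (@Rintegral_by_parts u (Du i) (partial j phi) i n2 (d1 i) c0 (c1 i) L0 (L1u i)).
      rewrite (@Rintegral_by_parts (Du i) (D2u i j) phi j n2 (d2 i j) (c1 i) (c2 i j)) ?opprK//.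
    exact: test_partial.
- move=> f fB fE; split; first exact: L1_L1loc.
  exists Du; split => // phi tphi.
  have mB := @measurable_eball R n r r0.
  have Rsum (h : 'I_n -> 'rV[R]_n -> R) (s : seq 'I_n) : (forall i, L1 B (h i)) ->
      L1 B (fun x => \sum_(i <- s) h i x) /\
      \int[lebesgue_rV n]_(x in B) (\sum_(i <- s) h i x) =
      \sum_(i <- s) \int[lebesgue_rV n]_(x in B) h i x.
    move=> hB; elim: s => [|i s [ih1 ih2]].
      rewrite big_nil; under [in X in _ /\ X]eq_Rintegral do rewrite big_nil.
      split; last by rewrite /Rintegral integral0.
      by apply: (eq_integrable mB) (integrable0 _ _) => x _ /=; rewrite big_nil.
    split.
      have := integrableD mB (hB i) ih1; apply: (eq_integrable mB) => x _ /=.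
      by rewrite big_cons EFinD.
    rewrite big_cons -ih2 -RintegralD//; last exact: hB.
    by apply: eq_Rintegral => x _; rewrite big_cons.
  have [_ ->] := Rsum (fun i x => Du i x * partial i phi x) (index_enum _)
    (fun i => @L1M_test (Du i) phi [:: i] (L1u i) tphi).
  transitivity (\sum_i \int[lebesgue_rV n]_(x in B) (- (D2u i i x * phi x))).
    apply: eq_bigr => i _; rewrite (@Rintegral_by_parts (Du i) (D2u i i) phi i n2 (d2 i i) (c1 i) (c2 i i))//.
    have h := @L1M_test (D2u i i) phi [::] (L2 i i) tphi.
    rewrite -mulN1r -RintegralZl//.
    by apply: eq_Rintegral => x _; rewrite mulN1r.
  have [|s1 <-] := Rsum (fun i x => - (D2u i i x * phi x)) (index_enum _).
    move=> i; have h := @L1M_test (D2u i i) phi [::] (L2 i i) tphi.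
    have := integrableN h; apply: (eq_integrable mB) => x _ /=; by [].
  have h := @L1M_test f phi [::] fB tphi.
  congr fine; apply: ae_eq_integral => //.
  + exact: measurable_int s1.
  + exact: measurable_int h.
  + exists (hyperplanes n); split.
    * exact: measurable_hyperplanes.
    * exact: lebesgue_rV_hyperplanes.
    move=> x /= hx; apply: contrapT => Hx; apply: hx => Bx; congr EFin.
    have x0 : x != 0.
      apply/eqP => x0; apply: Hx; exists (Ordinal (ltnW n2)) => //=.
      by rewrite x0 mxE.
    rewrite -fE// mulNr mulr_suml sumrN.
    by congr (- _).
Qed.

End weak_derivatives.

(** * Smooth functions *)

Section smooth_real.
Context {R : realType}.
Notation mu := (@lebesgue_measure R).
Implicit Types (D : set R) (f g : R -> R) (c t : R) (k j : nat).

(** Derivatives are carried as witnesses constrained on D only, so closure under sums and products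
    is an induction on k. *)
Fixpoint iter_derivable D k f : Prop :=
  if k is k'.+1 then
    exists2 f', (forall x, D x -> is_derive x 1 f (f' x)) & iter_derivable D k' f'
  else True.

Lemma iter_derivableW D k f : iter_derivable D k.+1 f -> iter_derivable D k f.
Proof.
elim: k f => [//|k ih] f [f' df f's]; exists f' => //; exact: ih.
Qed.

Lemma iter_derivable_subset D E k f : E `<=` D -> iter_derivable D k f -> iter_derivable E k f.
Proof.
move=> ED; elim: k f => [//|k ih] f [f' df f's]; exists f'; last exact: ih.
by move=> x /ED; exact: df.
Qed.

Lemma iter_derivable_cst D k c : iter_derivable D k (cst c).
Proof.
elim: k c => [//|k ih] c; exists (cst 0); last exact: ih.
by move=> x _; exact: is_derive_cst.
Qed.

Lemma iter_derivableD D k f g : iter_derivable D k f -> iter_derivable D k g -> iter_derivable D k (f \+ g).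
Proof.
elim: k f g => [//|k ih] f g [f' df f's] [g' dg g's].
exists (f' \+ g'); last exact: ih.
by move=> x Dx; apply: is_deriveD; [exact: df|exact: dg].
Qed.

Lemma iter_derivableM D k f g : iter_derivable D k f -> iter_derivable D k g -> iter_derivable D k (f \* g).
Proof.
elim: k f g => [//|k ih] f g fk gk.
have [f' df f's] := fk; have [g' dg g's] := gk.
exists ((f \* g') \+ (g \* f')).
  by move=> x Dx; apply: is_deriveM; [exact: df|exact: dg].
by apply: iter_derivableD; apply: ih => //; exact: iter_derivableW.
Qed.

Lemma iter_derivableZ D k c f : iter_derivable D k f -> iter_derivable D k (fun t => c * f t).
Proof. by move=> fk; apply: (@iter_derivableM D k (cst c) f) => //; exact: iter_derivable_cst. Qed.

Lemma iter_derivable_eq D k f g : open D -> (forall x, D x -> f x = g x) -> iter_derivable D k f -> iter_derivable D k g.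
Proof.
case: k => [//|k] oD fg [f' df f's]; exists f' => // x Dx.
apply: (near_eq_is_derive _ (df _ Dx)).
have : nbhs x D by exact: open_nbhs_nbhs.
by apply: filterS => y /fg.
Qed.

Lemma iter_derivable_affine D k f c t0 : iter_derivable setT k f -> iter_derivable D k (fun t => f (c * t + t0)).
Proof.
elim: k f => [//|k ih] f [f' df f's].
exists (fun t => c * f' (c * t + t0)); last by apply: iter_derivableZ; exact: ih.
move=> x _.
have d1 : is_derive x 1 (fun t => c * t + t0) c.
  by apply: is_derive_eq; rewrite ?addr0 ?add0r; apply: mulr1.
have := @is_derive1_comp R f (fun t => c * t + t0) x _ _ (df (c * x + t0) I) d1.
by rewrite mulrC.
Qed.

Lemma iter_derivable_powR k c : iter_derivable `]0, +oo[ k (fun t => t `^ c).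
Proof.
elim: k c => [//|k ih] c; exists (fun t => c * t `^ (c - 1)); last exact/iter_derivableZ/ih.
by move=> x; rewrite /= in_itv/= andbT => x0; exact: is_derive1_powR.
Qed.

(** Meant for products with t^(- nu), differentiable only for t > 0: a factor vanishing near 0 lets
    every derivative be extended by 0. *)
Lemma iter_derivable_extend0 k f (e : R) : 0 < e -> (forall t, t < e -> f t = 0) ->
  iter_derivable `]0, +oo[ k f -> iter_derivable setT k f.
Proof.
move=> e0; elim: k f => [//|k ih] f fe [f' df f's].
pose h t := if 0 < t then f' t else 0.
have near0 t : t < e -> is_derive t 1 f 0.
  move=> te; apply: (@near_eq_is_derive _ _ _ (cst 0)) (is_derive_cst _ _ _).
  by near=> s; rewrite fe//; near: s; exact: lt_nbhsl.
exists h.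
  move=> x _; rewrite /h; case: ltP => [x0|x0].
    by apply: df; rewrite /= in_itv/= x0.
  by apply: near0; exact: le_lt_trans e0.
apply: ih.
  move=> t te; rewrite /h; case: ltP => // t0.
  have tt : (`]0, +oo[%classic : set R) t by rewrite /= in_itv/= t0.
  have [_ <-] := df _ tt; by have [_ ->] := near0 _ te.
apply: iter_derivable_eq f's; first exact: interval_open.
by move=> x; rewrite /= in_itv/= andbT /h => ->.
Unshelve. all: by end_near. Qed.

(* [bump j t = t^(-j) exp (-1/t)] for [t > 0]; the family is closed under differentiation. *)
Definition bump j t : R := if 0 < t then t^-1 ^+ j * expR (- t^-1) else 0.

Lemma bump_ge0 j t : 0 <= bump j t.
Proof.
by rewrite /bump; case: ifPn => // t0; rewrite mulr_ge0 ?expR_ge0// exprn_ge0// invr_ge0 ltW.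
Qed.

(** With x = 1/t this is x^j <= j! exp x, read off the exponential series. *)
Lemma bump_le j t : bump j t <= j`!%:R.
Proof.
rewrite /bump; case: ifPn => t0 //.
have x0 : 0 < t^-1 by rewrite invr_gt0.
rewrite expRN ler_pdivrMr ?expR_gt0//; move: (t^-1) x0 => x x0.
case: j => [|j]; first by rewrite expr0 mul1r -expR0 ler_expR ltW.
have j0 : 0 < (j.+1)`!%:R :> R by rewrite ltr0n fact_gt0.
rewrite mulrC -ler_pdivrMr//; apply: le_trans (expR_ge1Dxn j (ltW x0)).
by rewrite lerDr.
Qed.

Lemma bump0_le1 t : bump 0 t <= 1.
Proof. exact: bump_le. Qed.

Lemma bump_le0 j t : t <= 0 -> bump j t = 0.
Proof. by move=> t0; rewrite /bump ltNge t0. Qed.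

Lemma is_derive_bump j t : is_derive t 1 (bump j) (bump j.+2 t - j%:R * bump j.+1 t).
Proof.
have [t0|t0|->] := ltgtP t 0.
- rewrite (bump_le0 j.+2 (ltW t0)) (bump_le0 j.+1 (ltW t0)) mulr0 subr0.
  apply: (@near_eq_is_derive _ _ _ (cst 0)) (is_derive_cst _ _ _).
  near=> s; have s0 : s < 0 by near: s; exact: lt_nbhsl.
  by rewrite bump_le0// ltW.
- have t0' : t != 0 by rewrite gt_eqF.
  have d1 : is_derive t 1 (fun s : R => s^-1) (- t^-2).
    by apply: is_derive_eq (@is_deriveV R id t 1 1 t0' (is_derive_id _ _)) _; apply: mulr1.
  have d2 := @is_derive1_comp R expR (fun s => - s^-1) t _ _ (is_derive_expR (- t^-1)) (is_deriveN d1).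
  have d3 := is_deriveX j d1; rewrite exprfctE in d3.
  have d4 : is_derive t 1 (fun s => (s^-1) ^+ j * expR (- s^-1))
     (bump j.+2 t - j%:R * bump j.+1 t).
    apply: is_derive_eq (is_deriveM d3 d2) _.
    rewrite /bump t0 /GRing.scale/= opprK -exprVn.
    case: j {d3} => [|j] /=; first by rewrite !expr0 expr2; ring.
    by rewrite !exprS; ring.
  apply: near_eq_is_derive d4; near=> s.
  have s0 : 0 < s by near: s; exact: lt_nbhsr.
  by rewrite /bump s0.
(* At 0 the difference quotient for h > 0 is h [bump (j + 2) h], at most (j + 2)! h. *)
- rewrite !(@bump_le0 _ 0)// mulr0 subr0.
  pose C : R := (j.+2)`!%:R + 1.
  have C0 : 0 < C by rewrite ltr_wpDl.
  have h : h^-1 *: (bump j (h *: 1 + 0) - bump j 0) @[h --> 0^'] --> (0 : R).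
    apply/cvgr0Pnorm_lt => e e0; near=> h.
    have h0 : h != 0 by near: h; exact: nbhs_dnbhs_neq.
    have he : `|h| < e / C.
      near: h; apply: dnbhs0_lt; exact: divr_gt0.
    rewrite (@bump_le0 j 0)// subr0 addr0 [h *: 1]mulr1 /GRing.scale/=.
    have [hn|hp] := leP h 0; first by rewrite bump_le0// mulr0 normr0.
    rewrite ger0_norm ?mulr_ge0 ?bump_ge0 ?invr_ge0 ?(ltW hp)//.
    have -> : h^-1 * bump j h = bump j.+2 h * h.
      by rewrite /bump hp !exprS; field.
    move: he; rewrite gtr0_norm// ltr_pdivlMr// mulrC; apply: le_lt_trans.
    by rewrite ler_wpM2r ?(ltW hp)// (le_trans (bump_le _ _))// lerDl.
  split; first by apply/cvg_ex; exists 0.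
  exact: cvg_lim h.
Unshelve. all: by end_near. Qed.

Lemma iter_derivable_bump k j : iter_derivable setT k (bump j).
Proof.
elim: k j => [//|k ih] j; exists (fun t => bump j.+2 t + (- j%:R) * bump j.+1 t).
  by move=> t _; rewrite mulNr; exact: is_derive_bump.
by apply: iter_derivableD; [exact: ih|apply: iter_derivableZ; exact: ih].
Qed.

Lemma continuous_bump j : continuous (bump j).
Proof.
move=> t; apply: differentiable_continuous; apply/derivable1_diffP.
by case: (is_derive_bump j t).
Qed.

Lemma measurable_bump j : measurable_fun setT (bump j).
Proof. by apply: continuous_measurable_fun; exact: continuous_bump. Qed.

Section convolution.
Variables (E : set R) (w : R -> R) (N : R).
Hypotheses (mE : measurable E) (w0 : forall s, E s -> 0 <= w s) (N0 : 0 < N).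
Hypothesis intw : mu.-integrable E (EFin \o w).

(* As [N -> oo], [bump 0 (N * (t - s))] increases to the indicator of [s < t], so
   [bump_conv 0] is a smooth approximation of the primitive of [w]. *)
Definition bump_conv j t : R := \int[mu]_(s in E) (bump j (N * (t - s)) * w s).

Let mb j t : measurable_fun E (fun s => bump j (N * (t - s))).
Proof.
apply: measurable_funTS; apply: (measurableT_comp (measurable_bump j)).
by apply: measurable_funM => //; exact: measurable_funB.
Qed.

Let intb j t : mu.-integrable E (EFin \o (fun s => bump j (N * (t - s)) * w s)).
Proof.
have := @integrableMr _ _ _ mu E mE (fun s => bump j (N * (t - s))) (EFin \o w) (mb j t).
apply => //; exists (j`!%:R); split; first exact: num_real.
move=> y jy s Es /=; rewrite ger0_norm ?bump_ge0//.
exact: le_trans (bump_le _ _) (ltW jy).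
Qed.

Lemma is_derive_bump_conv j t :
  is_derive t 1 (bump_conv j) (N * (bump_conv j.+2 t - j%:R * bump_conv j.+1 t)).
Proof.
pose f x s := bump j (N * (x - s)) * w s.
pose d x s := N * (bump j.+2 (N * (x - s)) - j%:R * bump j.+1 (N * (x - s))) * w s.
have df (x s : R) : is_derive x 1 (fun y => f y s) (d x s).
  have d1 : is_derive x 1 (fun y => N * (y - s)) N.
    by apply: is_derive_eq; rewrite subr0; apply: mulr1.
  have d2 := @is_derive1_comp R (bump j) (fun y => N * (y - s)) x _ _ (is_derive_bump j _) d1.
  have d3 : is_derive x 1 (fun y => w s * (bump j (N * (y - s)))) (w s * ((bump j.+2 (N * (x - s)) -
   j%:R * bump j.+1 (N * (x - s))) * N)).
    by apply: is_derive_eq.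
  rewrite (_ : (fun y => f y s) = (fun y => w s * (bump j (N * (y - s))))); last first.
    by apply/funext => y; rewrite /f mulrC.
  by apply: is_derive_eq d3 _; rewrite /d; ring.
(* Differentiation under the integral sign, with the factorial bounds on [bump] giving the
   integrable majorant C |w|. *)
pose C : R := N * ((j.+2)`!%:R + j%:R * (j.+1)`!%:R).
have C0 : 0 <= C by rewrite mulr_ge0 ?(ltW N0)// addr_ge0// mulr_ge0.
have It : (`](t - 1), (t + 1)[%classic : set R) t by rewrite /= in_itv/= gtrBl ltrDl ltr01.
have p1E x s : partial1of2 f x s = d x s.
  by rewrite partial1of2E; exact: (@derive_val _ _ _ _ _ _ _ (df x s)).
have intG : mu.-integrable E (EFin \o (fun s => C * `|w s|)).
  rewrite (_ : _ \o _ = (fun s => C%:E * (`|w s|)%:E)%E); last by apply/funext.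
  apply: integrableZl => //; exact: integrable_norm.
have G0 s : 0 <= C * `|w s| by rewrite mulr_ge0.
have ub x s : (`](t - 1), (t + 1)[%classic : set R) x -> E s ->
    `|partial1of2 f x s| <= C * `|w s|.
  move=> _ Es; rewrite p1E /d normrM ler_wpM2r// normrM (ger0_norm (ltW N0)).
  rewrite ler_wpM2l ?(ltW N0)// (le_trans (ler_normB _ _))// lerD//.
    by rewrite ger0_norm ?bump_ge0// bump_le.
  by rewrite normrM normr_nat ler_wpM2l// ger0_norm ?bump_ge0// bump_le.
have der : forall x s, (`](t - 1), (t + 1)[%classic : set R) x -> E s ->
    derivable (f ^~ s) x 1 by move=> x s _ _; case: (df x s).
have H1 := @derivable_under_integral R _ _ mu f E mE t (t - 1) (t + 1) It
  (fun x _ => intb j x) der (fun s => C * `|w s|) G0 intG ub.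
have H2 := @differentiation_under_integral R _ _ mu f E mE t (t - 1) (t + 1) It
  (fun x _ => intb j x) der (fun s => C * `|w s|) G0 intG ub.
split; first exact: H1.
rewrite -derive1E H2.
pose b k s := bump k (N * (t - s)) * w s.
have i1 : mu.-integrable E (EFin \o (fun s => j%:R * b j.+1 s)).
  rewrite (_ : _ \o _ = (fun s => (j%:R)%:E * (b j.+1 s)%:E)%E); last by apply/funext.
  by apply: integrableZl => //; exact: intb.
have i2 : mu.-integrable E (EFin \o (fun s => b j.+2 s - j%:R * b j.+1 s)).
  rewrite (_ : _ \o _ = (fun s => (b j.+2 s)%:E - (j%:R * b j.+1 s)%:E)%E); last by apply/funext.
  by apply: integrableB => //; exact: intb.
have e1 : \int[mu]_(s in E) (j%:R * b j.+1 s) = j%:R * bump_conv j.+1 t.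
  by rewrite RintegralZl//; exact: intb.
have e2 : \int[mu]_(s in E) (b j.+2 s - j%:R * b j.+1 s) =
    bump_conv j.+2 t - j%:R * bump_conv j.+1 t.
  by rewrite RintegralB ?e1//; exact: intb.
rewrite -e2 -RintegralZl//.
by apply: eq_Rintegral => s _; rewrite p1E /d /b; ring.
Qed.

Lemma iter_derivable_bump_conv k j : iter_derivable setT k (bump_conv j).
Proof.
elim: k j => [//|k ih] j.
exists (fun t => N * (bump_conv j.+2 t + (- j%:R) * bump_conv j.+1 t)).
  by move=> t _; rewrite mulNr; exact: is_derive_bump_conv.
by apply: iter_derivableZ; apply: iter_derivableD; [exact: ih|apply: iter_derivableZ; exact: ih].
Qed.

End convolution.

End smooth_real.

(** * Smooth radial functions of several variables *)

Section smooth_rowvec.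
Context {R : realType} {n : nat}.
Implicit Types (F G : 'rV[R]_n -> R) (i : 'I_n) (k : nat) (psi : R -> R).
Local Notation dir i := (delta_mx ord0 i : 'rV[R]_n).

(** Continuity is demanded at each order because partial derivatives alone do not give it. *)
Fixpoint Ck k F : Prop := continuous F /\
  if k is k'.+1 then
    forall i, exists2 Fi, (forall x, is_derive x (dir i) F (Fi x)) & Ck k' Fi
  else True.

Lemma Ck_continuous k F : Ck k F -> continuous F.
Proof. by case: k => [|k] []. Qed.

Lemma CkW k F : Ck k.+1 F -> Ck k F.
Proof.
elim: k F => [|k ih] F [cF dF]; split => // i.
by have [Fi h1 h2] := dF i; exists Fi => //; exact: ih.
Qed.

Lemma Ck_cst k (c : R) : Ck k (fun _ => c).
Proof.
elim: k c => [|k ih] c; (split; first exact: cst_continuous) => //.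
by move=> i; exists (fun _ => 0) => [x|]; [exact: is_derive_cst|exact: ih].
Qed.

Lemma CkD k F G : Ck k F -> Ck k G -> Ck k (F \+ G).
Proof.
elim: k F G => [|k ih] F G [cF dF] [cG dG];
  (split; first by move=> x; exact: (cvgD (cF x) (cG x))) => //.
move=> i; have [Fi h1 h2] := dF i; have [Gi g1 g2] := dG i.
exists (Fi \+ Gi) => [x|]; last exact: ih.
exact: (is_deriveD (h1 x) (g1 x)).
Qed.

Lemma CkM k F G : Ck k F -> Ck k G -> Ck k (F \* G).
Proof.
elim: k F G => [|k ih] F G Fk Gk; have [cF dF] := Fk; have [cG dG] := Gk;
  (split; first by move=> x; exact: (cvgM (cF x) (cG x))) => //.
move=> i; have [Fi h1 h2] := dF i; have [Gi g1 g2] := dG i.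
exists ((F \* Gi) \+ (G \* Fi)) => [x|].
  exact: (is_deriveM (h1 x) (g1 x)).
by apply: CkD; apply: ih => //; exact: CkW.
Qed.

Lemma is_derive_coord (i j : 'I_n) (x : 'rV[R]_n) :
  is_derive x (dir i) (fun y : 'rV[R]_n => y ord0 j) (j == i)%:R.
Proof.
rewrite -[x]addr0 -(scale0r (dir i)); apply/is_derive_line.
rewrite (_ : (fun _ => _) = (fun s : R => x ord0 j + s * (j == i)%:R)); last first.
  by apply/funext => s; rewrite !mxE eqxx.
by apply: is_derive_eq; rewrite /GRing.scale/= add0r mul1r mulr0 add0r mulr1.
Qed.

Lemma Ck_coord k (j : 'I_n) : Ck k (fun x => x ord0 j).
Proof.
have c : continuous (fun x : 'rV[R]_n => x ord0 j) by exact: coord_continuous.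
case: k => [|k]; (split; first exact: c) => // i.
by exists (fun _ => (j == i)%:R) => [x|]; [exact: is_derive_coord|exact: Ck_cst].
Qed.

Lemma is_derive_sqn i (x : 'rV[R]_n) : is_derive x (dir i) (@sqn R n) (2 * x ord0 i).
Proof.
rewrite -{1}[x]addr0 -{1}(scale0r (dir i)); apply/is_derive_line.
rewrite (_ : (fun _ => _) = (fun s : R => sqn x + (2 * x ord0 i) * s + s ^+ 2)); last first.
  apply/funext => s; rewrite /sqn (bigD1 i)//= [in RHS](bigD1 i)//=.
  rewrite [X in _ + X = _](_ : _ = \sum_(j < n | j != i) x ord0 j ^+ 2); last first.
    apply: eq_bigr => j ji; rewrite !mxE eqxx/= (negbTE ji) mulr0 addr0//.
  by rewrite !mxE !eqxx/=; ring.
by apply: is_derive_eq; rewrite /GRing.scale/=; ring.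
Qed.

Lemma is_derive_sqn_comp psi (d : R) i (x : 'rV[R]_n) :
  is_derive (sqn x) 1 psi d -> is_derive x (dir i) (psi \o @sqn R n) (d * (2 * x ord0 i)).
Proof.
move=> dpsi.
have xE : x = x + (0 : R) *: dir i by rewrite scale0r addr0.
rewrite [X in is_derive X]xE; apply/is_derive_line.
have ds : is_derive (0 : R) 1 (fun s : R => sqn (x + s *: dir i)) (2 * x ord0 i).
  by apply/is_derive_line; rewrite -xE; exact: is_derive_sqn.
apply: (@is_derive1_comp R psi (fun s : R => sqn (x + s *: dir i)) 0 _ _ _ ds).
by rewrite -xE.
Qed.

(** D is a neighbourhood of 0 as well, so the chain rule with derivative 2 x_i psi'(sqn x) also
    covers the origin. *)
Lemma Ck_radial k psi (D : set R) : open D -> (forall t, 0 <= t -> D t) ->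
  (forall j, iter_derivable D j psi) -> Ck k (psi \o @sqn R n).
Proof.
move=> oD D0; elim: k psi => [|k ih] psi sm; have [f' df _] := sm 1%N;
  (split; first (move=> x; apply: continuous_comp; [exact: continuous_sqn|
    by apply: differentiable_continuous; apply/derivable1_diffP;
     case: (df (sqn x) (D0 _ (sqn_ge0 x)))])) => //.
move=> i; exists ((f' \o @sqn R n) \* (fun x => 2 * x ord0 i)) => [x|].
  by apply: is_derive_sqn_comp; apply: df; exact/D0/sqn_ge0.
apply: CkM; last by apply: (@CkM k (fun _ => 2)); [exact: Ck_cst|exact: Ck_coord].
(* [f'] was chosen at order 1; on D it agrees with the witness at order j + 1, which has j further
   derivatives. *)
apply: ih => j; have [g dg gs] := sm j.+1.
apply: iter_derivable_eq gs => // t Dt.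
have [_ <-] := dg t Dt; by have [_ ->] := df t Dt.
Qed.

Lemma Ck_partials k F (s : seq 'I_n) : Ck (size s + k) F -> Ck k (partials s F).
Proof.
elim: s k => [//|i s ih] k; rewrite [size _]/= addSnnS => /ih [_ /(_ i)[Fi h1 h2]].
rewrite [partials _ _]/= (_ : partial i _ = Fi)//; apply/funext => x; exact: (@derive_val _ _ _ _ _ _ _ (h1 x)).
Qed.

Lemma Ck_smooth F : (forall k, Ck k F) -> smooth F.
Proof.
move=> sF s; split; first by apply: (@Ck_continuous 0); exact: Ck_partials.
by move=> i x; have [_ /(_ i)[Fi h1 _]] := @Ck_partials 1 F s (sF _); case: (h1 x).
Qed.

End smooth_rowvec.

(** * Radial test functions and traces *)

Section radial_approximation.
Context {R : realType}.
Notation mu := (@lebesgue_measure R).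
Variables (nu rho : R).
Hypotheses (rho0 : 0 < rho).
Local Notation D := (`]0%R, rho[%classic : set R).
Variables (f : R -> R) (C X : R).
Hypotheses (f0 : ge0D rho f) (mf : measurable_fun D f).
Hypotheses (hb : head_bound rho f C X).
Hypotheses (fin : forall t, 0 < t -> greene nu rho f t \is a fin_num).
Local Notation m := (mass f).
Implicit Types (N : nat) (s t : R).

Let nn N : R := N.+1%:R.
(** The shift [N.+2] makes [b N] positive already for N = 0. *)
Let b N : R := rho - rho / N.+2%:R.
Let E N : set R := `](nn N)^-1, b N[%classic.

Let nn0 N : 0 < nn N. Proof. by []. Qed.

Let nnV0 N : 0 < (nn N)^-1. Proof. by rewrite invr_gt0. Qed.

Let b_lt N : b N < rho.
Proof. by rewrite /b gtrBl divr_gt0. Qed.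

Let b_gt0 N : 0 < b N.
Proof. by rewrite /b subr_gt0 ltr_pdivrMr// ltr_pMr// ltr1n. Qed.

Let ED N s : E N s -> 0 < s < rho.
Proof.
rewrite /E/= in_itv/= => /andP[s1 s2].
by rewrite (lt_trans (nnV0 N) s1) (lt_trans s2 (b_lt N)).
Qed.

Let E_near s : 0 < s < rho -> \forall N \near \oo, E N s.
Proof.
move=> /andP[s0 sr].
have rs : 0 < (rho - s) / rho by rewrite divr_gt0 ?subr_gt0.
near=> N; rewrite /E/= in_itv/=; apply/andP; split.
  by near: N; exact: (near_infty_natSinv_lt (PosNum s0)).
rewrite /b ltrBrDr -ltrBrDl mulrC -ltr_pdivlMr//.
apply: (@lt_trans _ _ (nn N)^-1).
  by rewrite ltf_pV2 ?posrE// ltr_nat.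
by near: N; exact: (near_infty_natSinv_lt (PosNum rs)).
Unshelve. all: by end_near. Qed.

Let integrable_head t : 0 < t < rho -> mu.-integrable (`]0%R, t[%classic : set R) (EFin \o f).
Proof.
move=> tD; have /andP[t0 tr] := tD; apply/integrableP; split.
  apply/measurable_EFinP; apply: measurable_funS mf => //.
  by apply: subset_itvl; rewrite bnd_simp ltW.
have := head_fin f0 hb tD; rewrite ge0_fin_numE ?(head_ge0 f0) ?ltW//; apply: le_lt_trans.
rewrite le_eqVlt; apply/orP; left; apply/eqP; apply: eq_integral => s.
rewrite inE/= in_itv/= => /andP[s0 st].
by rewrite ger0_norm// f0// s0 (lt_trans st).
Qed.

Let mE N : measurable (E N). Proof. exact: measurable_itv. Qed.

Let intE N : mu.-integrable (E N) (EFin \o f).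
Proof.
have bD : 0 < b N < rho by rewrite b_gt0 b_lt.
apply: integrableS (integrable_head bD) => //.
  exact: mE.
by move=> s; rewrite /E/= !in_itv/= => /andP[s1 ->]; rewrite (lt_trans _ s1).
Qed.

Let bump0_cvg1 (c_ : nat -> R) (d : R) : 0 < d -> (\forall N \near \oo, d <= c_ N) ->
  bump 0 (nn N * c_ N) @[N --> \oo] --> (1 : R).
Proof.
move=> d0 dc.
have l : 1 - (nn N)^-1 * d^-1 @[N --> \oo] --> (1 : R).
  rewrite -[X in _ --> X]subr0; apply: cvgB; first exact: cvg_cst.
  rewrite -[X in _ --> X](mul0r d^-1); apply: cvgMr_tmp; exact: cvg_harmonic.
have c1 : (fun _ : nat => (1 : R)) @ \oo --> (1 : R) by exact: cvg_cst.
apply: (squeeze_cvgr _ l c1); near=> N.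
rewrite bump0_le1 andbT.
have dN : d <= c_ N by near: N.
have y0 : 0 < nn N * c_ N by rewrite mulr_gt0// (lt_le_trans d0).
rewrite /bump y0 expr0 mul1r; apply: le_trans (expR_ge1Dx _).
rewrite lerD2l lerN2 -invfM lef_pV2 ?posrE//; last by rewrite mulr_gt0.
by rewrite ler_wpM2l.
Unshelve. all: by end_near. Qed.

(** A smooth approximation of [mass f] from below on ]0, rho[; cutting [E N] at 1/(N + 1) makes it
    vanish near 0. *)
Let A N t : R := bump_conv (E N) f (nn N) 0 t.

Let g N t s : R := \1_(E N) s * bump 0 (nn N * (t - s)) * f s.

Let AE N t : 0 < t -> A N t = \int[mu]_(s in `]0%R, t[) g N t s.
Proof.
move=> t0; rewrite /A /bump_conv Rintegral_mkcond [RHS]Rintegral_mkcond.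
apply: eq_Rintegral => s _; rewrite !patchE /g indicE.
have [sE|sE] := boolP (s \in E N); last by rewrite !mul0r; case: ifP.
rewrite mul1r; case: ifPn => // st.
rewrite bump_le0 ?mul0r// mulr_ge0_le0 ?(ltW (nn0 N))// subr_le0 leNgt.
apply: contra st => st; rewrite inE/= in_itv/= st andbT.
by move: sE; rewrite inE => /ED/andP[].
Qed.

Let gle N t s : 0 < s < rho -> 0 <= g N t s <= f s.
Proof.
move=> sD; have fs := f0 sD.
rewrite /g indicE !mulr_ge0 ?bump_ge0//= -[leRHS]mul1r ler_wpM2r//.
by case: (_ \in _); rewrite ?mul1r ?mul0r ?bump0_le1.
Qed.

Let mg N t : 0 < t < rho -> measurable_fun (`]0%R, t[%classic : set R) (g N t).
Proof.
move=> /andP[t0 tr]; apply: measurable_funM; last first.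
  by apply: measurable_funS mf => //; apply: subset_itvl; rewrite bnd_simp ltW.
apply: measurable_funTS; apply: measurable_funM; first exact: measurable_indic.
apply: (measurableT_comp (measurable_bump 0)).
by apply: measurable_funM => //; exact: measurable_funB.
Qed.

Let intg N t : 0 < t < rho -> mu.-integrable (`]0%R, t[%classic : set R) (EFin \o g N t).
Proof.
move=> tD; have /andP[t0 tr] := tD.
apply: le_integrable (integrable_head tD) => //.
  by apply/measurable_EFinP; exact: mg.
move=> s /=; rewrite in_itv/= => /andP[s0 st]; rewrite lee_fin.
have sD : 0 < s < rho by rewrite s0 (lt_trans st).
have /andP[g0 gf] := gle N t sD.
by rewrite ger0_norm// ger0_norm// f0.
Qed.

Let A_bounds N t : 0 < t < rho -> 0 <= A N t <= m t.
Proof.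
move=> tD; have /andP[t0 tr] := tD; rewrite AE//.
have sD s : (`]0%R, t[%classic : set R) s -> 0 < s < rho.
  by rewrite /= in_itv/= => /andP[s0 st]; rewrite s0 (lt_trans st).
rewrite Rintegral_ge0/=; last by move=> s /sD /(gle N t)/andP[].
apply: le_Rintegral => //; [exact: intg|exact: integrable_head|].
by move=> s /sD /(gle N t)/andP[].
Qed.

Let A_cvg t : 0 < t < rho -> A N t @[N --> \oo] --> m t.
Proof.
move=> tD; have /andP[t0 tr] := tD.
have sD s : (`]0%R, t[%classic : set R) s -> 0 < s < rho.
  by rewrite /= in_itv/= => /andP[s0 st]; rewrite s0 (lt_trans st).
rewrite (_ : (fun N => A N t) = fine \o (fun N => \int[mu]_(s in `]0%R, t[) (g N t s)%:E)%E);
  last by apply/funext => N; rewrite AE.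
apply: fine_cvg; rewrite /mass fineK ?(head_fin f0 hb)//.
apply: (@dominated_cvg _ _ _ mu _ _ (fun N s => (g N t s)%:E) (fun s => (f s)%:E) (fun s => (f s)%:E)) => //.
- by move=> N; apply/measurable_EFinP; exact: mg.
- move=> s st; apply: cvg_EFin; first exact: nearW.
  rewrite -[X in _ --> X]mul1r; apply: cvgMr_tmp; rewrite -[X in _ --> X]mul1r.
  apply: cvgM.
    apply: cvg_near_cst; near=> N; rewrite indicE mem_set//.
    by near: N; apply: E_near; exact: sD.
  apply: (bump0_cvg1 (d := t - s)); last exact: nearW.
  by move: st; rewrite /= in_itv/= subr_gt0 => /andP[].
- exact: integrable_head.
- move=> N s /sD sD'; have /andP[g0 gf] := gle N t sD'.
  by rewrite gee0_abs ?lee_fin.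
Unshelve. all: by end_near. Qed.

Let A_eq0 N t : t <= (nn N)^-1 -> A N t = 0.
Proof.
move=> tN; rewrite /A /bump_conv /Rintegral integral0_eq// => s.
rewrite /E/= in_itv/= => /andP[s1 _].
rewrite bump_le0 ?mul0r// mulr_ge0_le0 ?(ltW (nn0 N))// subr_le0.
exact: le_trans tN (ltW s1).
Qed.

Let chi N t : R := bump 0 (nn N * (b N - t)).

(** Smooth approximation from below of - (Kf)' = t^(- nu) [mass f], vanishing near 0 and beyond
    [b N] < rho. *)
Definition radial_theta N t : R := A N t * (chi N t * t `^ (- nu)).

Let theta_eq0 N t : t < (nn N)^-1 -> radial_theta N t = 0.
Proof. by move=> tN; rewrite /radial_theta A_eq0 ?mul0r// ltW. Qed.

Let theta_eq0b N t : b N <= t -> radial_theta N t = 0.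
Proof.
move=> tb; rewrite /radial_theta /chi bump_le0 ?mul0r ?mulr0//.
by rewrite mulr_ge0_le0 ?(ltW (nn0 N))// subr_le0.
Qed.

Lemma iter_derivable_radial_theta N k : iter_derivable setT k (radial_theta N).
Proof.
apply: (iter_derivable_extend0 (nnV0 N) (@theta_eq0 N)).
apply: iter_derivableM.
  by apply: (@iter_derivable_subset _ setT) => //; exact: iter_derivable_bump_conv.
apply: iter_derivableM; last exact: iter_derivable_powR.
rewrite (_ : chi N = fun t => bump 0 (- nn N * t + nn N * b N)).
  by apply: iter_derivable_affine; exact: iter_derivable_bump.
by apply/funext => t; rewrite /chi; congr bump; ring.
Qed.

Lemma radial_theta_bounds N t : 0 < t < rho ->
  0 <= radial_theta N t <= t `^ (- nu) * m t.
Proof.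
move=> tD; have /andP[A0 Am] := A_bounds N tD.
rewrite !mulr_ge0 ?bump_ge0 ?powR_ge0//= /radial_theta mulrA [leRHS]mulrC ler_wpM2r ?powR_ge0//.
by rewrite -[leRHS]mulr1 ler_pM ?bump_ge0 ?bump0_le1.
Qed.

Lemma radial_theta_cvg t : 0 < t < rho ->
  radial_theta N t @[N --> \oo] --> t `^ (- nu) * m t.
Proof.
move=> tD; rewrite mulrC; apply: cvgM; first exact: A_cvg.
rewrite -[X in _ --> X]mul1r; apply: cvgMr_tmp.
have /andP[t0 tr] := tD.
pose t' := (t + rho) / 2.
have t'D : 0 < t' < rho by rewrite /t'; apply/andP; split; lra.
apply: (bump0_cvg1 (d := t' - t)); first by rewrite /t'; lra.
apply: filterS (E_near t'D) => N; rewrite /E/= in_itv/= => /andP[_ h].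
by rewrite lerD2r ltW.
Qed.

Let theta_derivable N t : derivable (radial_theta N) t 1.
Proof. by have [g' dg _] := iter_derivable_radial_theta N 1; case: (dg t I). Qed.

Let theta_continuous N : continuous (radial_theta N).
Proof.
move=> t; apply: differentiable_continuous; apply/derivable1_diffP.
exact: theta_derivable.
Qed.

Let theta_int N x y : mu.-integrable (`[x, y]%classic : set R) (EFin \o radial_theta N).
Proof.
apply: continuous_compact_integrable; first exact: segment_compact.
by apply: continuous_subspaceT; exact: theta_continuous.
Qed.

(** The primitive of - theta that vanishes at rho. It is based at -1, not at 0, so that it is
    differentiable on a neighbourhood of [0, +oo[. *)
Definition radial_psi N t : R :=
  \int[mu]_(s in `[(-1)%R, rho]) radial_theta N s - \int[mu]_(s in `[(-1)%R, t]) radial_theta N s.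

Lemma is_derive_radial_psi N t : -1 < t -> is_derive t 1 (radial_psi N) (- radial_theta N t).
Proof.
move=> t1.
have [d1 d2] := @continuous_FTC1_closed R (radial_theta N) (-1) t (t + 1)
  (ltr_pwDr ltr01 (lexx _)) (theta_int N _ _) t1 (@theta_continuous N t).
have d : is_derive t 1 (fun x => \int[mu]_(s in `[(-1)%R, x]) radial_theta N s) (radial_theta N t).
  by split => //; rewrite -derive1E.
by apply: is_derive_eq; rewrite add0r mul1r.
Qed.

Lemma iter_derivable_radial_psi N k : iter_derivable `](-1), +oo[ k (radial_psi N).
Proof.
case: k => [//|k]; exists (fun t => (-1) * radial_theta N t).
  move=> t; rewrite /= in_itv/= andbT mulN1r; exact: is_derive_radial_psi.
by apply: iter_derivableZ; apply: (@iter_derivable_subset _ setT) => //; exact: iter_derivable_radial_theta.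
Qed.

Lemma radial_psi_support N : exists2 c, 0 < c < rho & forall t, c <= t -> radial_psi N t = 0.
Proof.
exists (b N); first by rewrite b_gt0 b_lt.
move=> t bt; apply/eqP; rewrite subr_eq0; apply/eqP.
rewrite Rintegral_mkcond [RHS]Rintegral_mkcond; apply: eq_Rintegral => s _.
rewrite !patchE; have [sb|sb] := leP (b N) s.
  by rewrite theta_eq0b//; case: ifP; case: ifP.
have -> : (s \in `[(-1)%R, rho]%classic) = (s \in `[(-1)%R, t]%classic) => //.
apply/idP/idP; rewrite !inE/= !in_itv/= => /andP[-> _] /=; apply/ltW.
  exact: lt_le_trans sb bt.
exact: lt_trans sb (b_lt N).
Qed.

Let h t : R := t `^ (- nu) * m t.

Let hE s : 0 < s < rho -> ((s `^ (- nu))%:E * head f s = (h s)%:E)%E.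
Proof. by move=> sD; rewrite EFinM fineK ?(head_fin f0 hb). Qed.

Let h0 s : 0 < s < rho -> 0 <= h s.
Proof. by move=> sD; rewrite mulr_ge0 ?powR_ge0 ?(mass_ge0 f0)//. Qed.

Let mh t : 0 < t -> measurable_fun (`]t, rho[%classic : set R) (EFin \o h).
Proof.
move=> t0; apply: (@eq_measurable_fun _ _ _ _ _ (fun s => (s `^ (- nu))%:E * head f s)%E).
  move=> s; rewrite inE/= in_itv/= => /andP[ts sr].
  by rewrite hE// sr (lt_trans t0).
apply: measurable_funS (measurable_green_integrand nu f0 mf) => //.
by move=> s /=; rewrite !in_itv/= => /andP[ts ->]; rewrite (lt_trans t0).
Qed.

Let greenE t : 0 < t -> greene nu rho f t = (\int[mu]_(s in `]t, rho[) (h s)%:E)%E.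
Proof.
move=> t0; apply: eq_integral => s; rewrite inE/= in_itv/= => /andP[ts sr].
by rewrite hE// sr (lt_trans t0).
Qed.

Let inth t : 0 < t -> mu.-integrable (`]t, rho[%classic : set R) (EFin \o h).
Proof.
move=> t0; apply/integrableP; split; first exact: mh.
have := fin t0; rewrite ge0_fin_numE ?greene_ge0// greenE//; apply: le_lt_trans.
rewrite le_eqVlt; apply/orP; left; apply/eqP; apply: eq_integral => s.
rewrite inE/= in_itv/= => /andP[ts sr].
by rewrite ger0_norm// h0// sr (lt_trans t0).
Qed.

Let psiE N t : 0 < t < rho -> radial_psi N t = \int[mu]_(s in `]t, rho[) radial_theta N s.
Proof.
move=> /andP[t0 tr]; rewrite /radial_psi Rintegral_itvB ?bnd_simp//.
- rewrite Rintegral_itv_bndo_bndc//; apply: integrableS (theta_int N t rho) => //.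
  exact: subset_itv_oo_cc.
- by apply: (le_trans _ (ltW t0)); rewrite lerN10.
- exact: ltW.
Qed.

Lemma radial_psi_bounds N t : 0 < t < rho -> 0 <= radial_psi N t <= green nu rho f t.
Proof.
move=> tD; have /andP[t0 tr] := tD; rewrite psiE//.
have sD s : (`]t, rho[%classic : set R) s -> 0 < s < rho.
  by rewrite /= in_itv/= => /andP[ts sr]; rewrite sr (lt_trans t0).
rewrite Rintegral_ge0/=; last by move=> s /sD /(radial_theta_bounds N)/andP[].
rewrite /green greenE//; apply: le_Rintegral => //; last 1 first.
- by move=> s /sD /(radial_theta_bounds N)/andP[].
- apply: integrableS (theta_int N t rho) => //.
  exact: subset_itv_oo_cc.
- exact: inth.
Qed.

Lemma radial_psi_cvg t : 0 < t < rho -> radial_psi N t @[N --> \oo] --> green nu rho f t.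
Proof.
move=> tD; have /andP[t0 tr] := tD.
have sD s : (`]t, rho[%classic : set R) s -> 0 < s < rho.
  by rewrite /= in_itv/= => /andP[ts sr]; rewrite sr (lt_trans t0).
rewrite (_ : (fun N => radial_psi N t) =
    fine \o (fun N => \int[mu]_(s in `]t, rho[) (radial_theta N s)%:E)%E);
  last by apply/funext => N; rewrite psiE.
apply: fine_cvg; rewrite /green fineK ?fin// greenE//.
apply: (@dominated_cvg _ _ _ mu _ _ (fun N s => (radial_theta N s)%:E) (EFin \o h) (EFin \o h)) => //.
- move=> N; apply/measurable_EFinP; apply: measurable_funTS.
  by apply: continuous_measurable_fun; exact: theta_continuous.
- move=> s /sD sD'; apply: cvg_EFin; first exact: nearW.
  exact: radial_theta_cvg.
- exact: inth.
- move=> N s /sD sD'; have /andP[g0 gf] := radial_theta_bounds N sD'.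
  by rewrite gee0_abs ?lee_fin.
Qed.

End radial_approximation.

(** * Radial potentials belong to W^{1,1}_0 of the ball *)

Section W11_0_radial.
Context {R : realType} {n : nat}.
Variable r : R.
Hypothesis r0 : 0 < r.
Local Notation B := (eball r : set 'rV[R]_n).
Local Notation rho := (r ^+ 2).
Local Notation D := (`]0%R, rho[%classic : set R).

Let rho0 : 0 < rho. Proof. by rewrite exprn_gt0. Qed.

Lemma radial_test_function (psi : R -> R) (c : R) : 0 < c < rho ->
  (forall t, c <= t -> psi t = 0) -> (forall k, iter_derivable `](-1), +oo[ k psi) ->
  test_function B (psi \o @sqn R n).
Proof.
move=> /andP[c0 cr] psi0 spsi.
have sub : closure [set x | (psi \o @sqn R n) x != 0] `<=` [set x | sqn x <= c].
  have cl : closed [set x : 'rV[R]_n | sqn x <= c].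
    rewrite (_ : [set _ | _] = (@sqn R n) @^-1` [set t | t <= c])//.
    by apply: closed_comp; [move=> x _; exact: continuous_sqn|exact: closed_le].
  rewrite [X in _ `<=` X](closure_id _).1//; apply: closure_subset => x /=.
  by move=> h; rewrite leNgt; apply: contra h => h; rewrite psi0// ltW.
split.
- apply: Ck_smooth => k; apply: (@Ck_radial _ _ _ _ `](-1), +oo[) => //.
  + by move=> t t0; rewrite /= in_itv/= andbT; apply: lt_le_trans t0; rewrite ltrN10.
- apply: bounded_closed_compact; last exact: closed_closure.
  exists r; split; first exact: num_real.
  move=> y ry x /sub /= xc; rewrite [X in X <= _]mx_normrE.
  apply: bigmax_le; first exact: ltW (lt_trans r0 ry).
  move=> [i j] _ /=; rewrite ord1.
  rewrite -(@ler_pXn2r _ 2)// ?nnegrE ?(ltW (lt_trans r0 ry))// real_normK ?num_real//.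
  rewrite (le_trans (sqr_le_sqn x j))// (le_trans xc)// (le_trans (ltW cr))//.
  by rewrite ler_pXn2r ?nnegrE ?(ltW r0) ?(ltW ry)// (ltW (lt_trans r0 ry)).
- move=> x /sub /= xc; apply/eball_sqn => //; exact: le_lt_trans cr.
Qed.

Lemma L1_cvg_dominated (g : 'rV[R]_n -> R) (h : nat -> 'rV[R]_n -> R) : (0 < n)%N ->
  L1 B g -> (forall N, measurable_fun B (h N)) ->
  (forall x, B x -> x != 0 -> h ^~ x @ \oo --> g x) ->
  (forall N x, B x -> x != 0 -> `|g x - h N x| <= `|g x|) ->
  (\int[lebesgue_rV n]_(x in B) `|g x - h N x|%:E @[N --> \oo] --> 0)%E.
Proof.
move=> n0 gB mh hg gh.
have mB := @measurable_eball R n r r0.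
have mg : measurable_fun B g by apply/measurable_EFinP; exact: measurable_int gB.
have ae0 (P : 'rV[R]_n -> Prop) : (forall x, x != 0 -> P x) -> {ae (lebesgue_rV n), forall x, P x}.
  move=> h0; exists (hyperplanes n); split.
  - exact: measurable_hyperplanes.
  - exact: lebesgue_rV_hyperplanes.
  - move=> x /= Px; apply: contrapT => Hx; apply: Px; apply: h0.
    apply/eqP => x0; apply: Hx; exists (Ordinal n0) => //=.
    by rewrite x0 mxE.
have [] := @dominated_convergence _ _ _ (lebesgue_rV n) B mB
  (fun N x => `|g x - h N x|%:E) (fun=> 0%E) (fun x => `|g x|%:E).
- move=> N; apply/measurable_EFinP; apply: measurableT_comp => //; exact: measurable_funB.
- exact: measurable_cst.
- apply: ae0 => x x0 Bx; apply: cvg_EFin; first exact: nearW.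
  have c : h N x @[N --> \oo] --> g x by exact: hg.
  have : `|g x - h N x| @[N --> \oo] --> `|g x - g x|.
    by apply: cvg_norm; apply: cvgB => //; exact: cvg_cst.
  by rewrite subrr normr0.
- exact: integrable_norm.
- by apply: ae0 => x x0 N Bx; rewrite gee0_abs ?lee_fin// gh.
- by move=> _ _; rewrite integral0.
Qed.

Variables (nu : R) (f : R -> R) (C X l : R).
Hypotheses (f0 : ge0D rho f) (mf : measurable_fun D f).
Hypotheses (hb : head_bound rho f C X).
Hypotheses (fin : forall t, 0 < t -> greene nu rho f t \is a fin_num).

(** psi lies between 0 and Kf, and theta between 0 and - (Kf)', so the errors are dominated by u and
    Du themselves. Dominated convergence then suffices, without any rate near the sphere. *)
Lemma W11_0_radial (u : 'rV[R]_n -> R) (Du : 'I_n -> 'rV[R]_n -> R) : (0 < n)%N ->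
  (forall x, B x -> x != 0 -> u x = l * green nu rho f (sqn x)) ->
  (forall i x, B x -> x != 0 ->
     Du i x = - (l * (sqn x `^ (- nu) * mass f (sqn x))) * (2 * x ord0 i)) ->
  L1 B u -> (forall i, L1 B (Du i)) -> (forall i, weak_partials B [:: i] u (Du i)) ->
  W11_0 B u.
Proof.
move=> n0 uE DuE uB DuB wDu; split => //; exists Du; split => // e e0.
have sD x : B x -> x != 0 -> 0 < sqn x < rho.
  by move=> /(eball_sqn _ r0) h x0; rewrite sqn_gt0.
pose phi N := (fun t => l * radial_psi nu rho f N t) \o @sqn R n.
have tphi N : test_function B (phi N).
  have [c cD psi0] := radial_psi_support nu rho0 f N.
  apply: (radial_test_function cD).
    by move=> t /psi0 ->; rewrite mulr0.
  by move=> k; apply: iter_derivableZ; exact: (iter_derivable_radial_psi nu rho0 f0 mf hb).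
have mphi s N : measurable_fun B (partials s (phi N)).
  exact: measurable_funTS (measurable_test s (tphi N)).
have dphi N i x : B x -> x != 0 -> partial i (phi N) x =
    - (l * radial_theta nu rho f N (sqn x)) * (2 * x ord0 i).
  move=> Bx x0; have /andP[t0 _] := sD x Bx x0.
  apply: derive_val; apply: is_derive_sqn_comp.
  have d := is_derive_radial_psi nu rho0 f0 mf hb N (lt_trans (ltrN10 R) t0).
  by apply: is_derive_eq; rewrite /GRing.scale/=; ring.
have c0 : (\int[lebesgue_rV n]_(x in B) `|u x - phi N x|%:E @[N --> \oo] --> 0)%E.
  apply: L1_cvg_dominated => //.
  - by move=> N; exact: (mphi [::]).
  - move=> x Bx x0; rewrite uE//; apply: cvgMl_tmp.
    exact: (radial_psi_cvg rho0 f0 mf hb fin (sD _ Bx x0)).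
  - move=> N x Bx x0; rewrite uE// /phi/= -mulrBr !normrM ler_wpM2l//.
    have /andP[p0 p1] := radial_psi_bounds rho0 f0 mf hb fin N (sD _ Bx x0).
    by rewrite !ger0_norm ?subr_ge0 ?(le_trans p0)// gerBl.
have c1 i : (\int[lebesgue_rV n]_(x in B) `|Du i x - partial i (phi N) x|%:E @[N --> \oo] --> 0)%E.
  apply: L1_cvg_dominated => //.
  - by move=> N; exact: (mphi [:: i]).
  - move=> x Bx x0; rewrite DuE//.
    under eq_fun do rewrite dphi//.
    apply: cvgMr_tmp; apply: cvgN; apply: cvgMl_tmp.
    exact: (radial_theta_cvg rho0 f0 mf hb (sD _ Bx x0)).
  - move=> N x Bx x0; rewrite DuE// dphi//.
    have /andP[] := radial_theta_bounds nu rho0 f0 mf hb N (sD _ Bx x0).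
    move: (_ * mass _ _) (radial_theta _ _ _ _ _) => h th p0 p1.
    rewrite -mulrBl !(normrM _ (2 * _)) ler_wpM2r//.
    rewrite opprK addrC -mulrBr normrN !normrM ler_wpM2l//.
    by rewrite distrC !ger0_norm ?subr_ge0 ?(le_trans p0)// gerBl.
have cs : (\int[lebesgue_rV n]_(x in B) `|u x - phi N x|%:E +
    \sum_(i < n) \int[lebesgue_rV n]_(x in B) `|Du i x - partial i (phi N) x|%:E
    @[N --> \oo] --> 0)%E.
  rewrite -[X in _ --> X]adde0; apply: cvgeD => //.
  rewrite [X in _ --> X](_ : _ = (\sum_(i < n) 0)%E); last by rewrite big1.
  apply: cvg_nnesum => // i _; apply: nearW => N; apply: integral_ge0 => x _.
  by rewrite lee_fin.
have nb : nbhs (0%E : \bar R) [set y | (y < e%:E)%E].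
  apply: open_nbhs_nbhs; split; last by rewrite /= lte_fin.
  exact: open_ereal_lt_ereal.
by have [N _ /(_ N (leqnn N)) hN] := cs _ nb; exists (phi N).
Qed.

End W11_0_radial.

(** * Back to the ball *)

Section radial_component.
Context {R : realType} {n : nat}.
Implicit Types (c e C t : R).

(** A nonpositive power is integrable because 2 c > - n; a positive one is bounded by its value at
    r^2. *)
Lemma L1_sqn_powR r c C (f : 'rV[R]_n -> R) : 0 < r -> (0 < n)%N -> - (n%:R / 2) < c ->
  (forall x, eball r x -> x != 0 -> {for x, continuous f}) ->
  (forall x, eball r x -> x != 0 -> `|f x| <= C * sqn x `^ c) ->
  L1 (eball r) f.
Proof.
move=> r0 n0 nc cf fC.
have mf := measurable_fun_eball r0 cf.
have [c0|c0] := leP c 0.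
  apply: (@L1_sqn_bound R n r (- c) C f) => //.
  - by rewrite oppr_ge0.
  - by lra.
  - by move=> x Bx x0; rewrite opprK fC.
apply: (@L1_sqn_bound R n r 0 (`|C| * (r ^+ 2) `^ c) f) => //.
  by rewrite mulr0 ltr0n.
move=> x Bx x0; rewrite oppr0 powRr0 mulr1 (le_trans (fC x Bx x0))//.
apply: (@le_trans _ _ (`|C| * sqn x `^ c)).
  by rewrite ler_wpM2r ?powR_ge0// ler_norm.
rewrite ler_wpM2l// ge0_ler_powR ?nnegrE ?sqn_ge0 ?sqr_ge0 ?(ltW c0)//.
by apply/ltW/eball_sqn.
Qed.

Lemma enorm_powR (x : 'rV[R]_n) e : enorm x `^ e = sqn x `^ (e / 2).
Proof. by rewrite enormE -powR12_sqrt ?sqn_ge0// -powRrM mulrC. Qed.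

(* The value at the origin is irrelevant but has to be positive. *)
Definition off0 (U : R -> R) t : R := if t <= 0 then 1 else U t.

Variables (r a p l al be C1 C2 : R) (U V : R -> R).
Local Notation nu := ((n%:R / 2) : R).
Local Notation rho := (r ^+ 2).
Local Notation c := (nu + a / 2).
Local Notation D := (`]0%R, rho[%classic : set R).
Local Notation B := (eball r : set 'rV[R]_n).
Hypotheses (r0 : 0 < r) (n3 : (3 <= n)%N) (p1 : 1 < p) (l0 : 0 < l) (c0 : 0 < c).
Hypotheses (be0 : 0 < be) (bec : be * p < c) (alnu : al < nu) (C10 : 0 <= C1) (C20 : 0 <= C2).
Hypotheses (VC : forall t, 0 < t < rho -> 0 < V t <= C2 * t `^ (- be)).
Hypotheses (mV : measurable_fun D V).
Hypotheses (cV : forall t, 0 < t < rho -> {for t, continuous V}).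
Hypotheses (UV : radial_half nu rho c p l (c / p) al C1 V U).

Local Notation u := (off0 U \o @sqn R n).
Local Notation v := (off0 V \o @sqn R n).

Let f := src c p V.
Let f0 : ge0D rho f. Proof. by move=> s _; exact: src_ge0. Qed.
Let mf : measurable_fun D f. Proof. exact: measurable_src. Qed.
Let hb : head_bound rho f C1 (c / p). Proof. by case: UV. Qed.
Let fin t : 0 < t -> greene nu rho f t \is a fin_num. Proof. by case: UV => _ + _ _ _; apply. Qed.
Let UE t : U t = l * green nu rho f t. Proof. by case: UV. Qed.
Let UC t : 0 < t < rho -> 0 < U t <= C1 * t `^ (- al). Proof. by case: UV => _ _ + _ _; apply. Qed.

Let p0 : 0 < p. Proof. exact: lt_trans ltr01 _. Qed.
Let cp0 : 0 < c / p. Proof. exact: divr_gt0. Qed.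
Let nu0 : 0 <= nu. Proof. exact: divr_ge0. Qed.
Let n2 : (2 <= n)%N. Proof. exact: leq_trans n3. Qed.
Let n0 : (0 < n)%N. Proof. exact: leq_trans n3. Qed.

Let sD (x : 'rV[R]_n) : B x -> x != 0 -> 0 < sqn x < rho.
Proof. by move=> /(eball_sqn _ r0) h x0; rewrite sqn_gt0. Qed.

Let off0E (W : R -> R) (x : 'rV[R]_n) : x != 0 -> off0 W (sqn x) = W (sqn x).
Proof. by move=> x0; rewrite /off0 leNgt sqn_gt0. Qed.

Let cf t : 0 < t < rho -> {for t, continuous f}.
Proof.
move=> tD; have /andP[t0 _] := tD; have /andP[V0 _] := VC tD.
apply: cvgM; first exact: continuous_powR.
apply: (@continuous_comp _ _ _ V (fun y => y `^ (p - 1))); first exact: cV.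
exact: continuous_powR.
Qed.

Let m := mass f.

Let dm t : 0 < t < rho -> is_derive t 1 m (f t).
Proof. by move=> tD; apply: (is_derive_mass f0 mf hb tD); exact: cf. Qed.

Let cm t : 0 < t < rho -> {for t, continuous m}.
Proof.
move=> tD; apply: differentiable_continuous; apply/derivable1_diffP.
by case: (dm tD).
Qed.

(** U' and U'' on ]0, rho[, computed from U' = - l t^(- nu) m and m' = f. *)
Let w1 t : R := - (l * (t `^ (- nu) * m t)).
Let w2 t : R := l * (nu * t `^ (- nu - 1) * m t) - l * (t `^ (- nu) * f t).

Let dU t : 0 < t < rho -> is_derive t 1 (off0 U) (w1 t).
Proof.
move=> tD; have /andP[t0 _] := tD.
have d : is_derive t 1 (fun s => l * green nu rho f s) (w1 t).
  have d1 := is_derive_green f0 mf hb fin tD (cm tD).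
  by apply: is_derive_eq; rewrite /GRing.scale/= /w1 /m; ring.
apply: near_eq_is_derive d; near=> s; rewrite /off0 -UE.
by rewrite leNgt (_ : 0 < s)//; near: s; exact: lt_nbhsr.
Unshelve. all: by end_near. Qed.

Let dw1 t : 0 < t < rho -> is_derive t 1 w1 (w2 t).
Proof.
move=> tD; have /andP[t0 _] := tD.
have d1 := is_derive1_powR (- nu) t0.
have d2 := dm tD.
by apply: is_derive_eq; rewrite /GRing.scale/= /w2; ring.
Qed.

Let cw1 t : 0 < t < rho -> {for t, continuous w1}.
Proof.
move=> tD; apply: differentiable_continuous; apply/derivable1_diffP.
by case: (dw1 tD).
Qed.

Let cw2 t : 0 < t < rho -> {for t, continuous w2}.
Proof.
move=> tD; have /andP[t0 _] := tD.
have c1 : {for t, continuous (fun s => s `^ (- nu - 1))} by exact: continuous_powR.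
have c2 : {for t, continuous (fun s => s `^ (- nu))} by exact: continuous_powR.
exact: (cvgB (cvgMl_tmp (cvgM (cvgMl_tmp c1) (cm tD))) (cvgMl_tmp (cvgM c2 (cf tD)))).
Qed.

Let comp_cont (W : R -> R) (x : 'rV[R]_n) : {for sqn x, continuous W} -> {for x, continuous (W \o @sqn R n)}.
Proof. by move=> cW; apply: continuous_comp => //; exact: continuous_sqn. Qed.

Let coord_cont i (x : 'rV[R]_n) : {for x, continuous (fun y : 'rV[R]_n => y ord0 i)}.
Proof. exact: coord_continuous. Qed.

Let cU t : 0 < t < rho -> {for t, continuous (off0 U)}.
Proof.
move=> tD; apply: differentiable_continuous; apply/derivable1_diffP.
by case: (dU tD).
Qed.

Let coff (W : R -> R) t : 0 < t -> {for t, continuous W} -> {for t, continuous (off0 W)}.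
Proof.
move=> t0 cW; rewrite /prop_for /continuous_at /off0 leNgt t0/=.
apply: cvg_trans cW; apply: near_eq_cvg; near=> s.
by rewrite leNgt (_ : 0 < s)//; near: s; exact: lt_nbhsr.
Unshelve. all: by end_near. Qed.

Let Du (i : 'I_n) (x : 'rV[R]_n) : R := w1 (sqn x) * (2 * x ord0 i).
Let D2u (i j : 'I_n) (x : 'rV[R]_n) : R := w2 (sqn x) * (2 * x ord0 j) * (2 * x ord0 i) + w1 (sqn x) * (2 * (i == j)%:R).

Let dDu (i j : 'I_n) (x : 'rV[R]_n) : B x -> x != 0 -> is_derive x (delta_mx ord0 j : 'rV[R]_n) (Du i) (D2u i j x).
Proof.
move=> Bx x0.
have d1 := is_derive_sqn_comp j (dw1 (sD Bx x0)).
have d2 : is_derive x (delta_mx ord0 j : 'rV[R]_n) (fun y => 2 * y ord0 i) (2 * (i == j)%:R).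
  have d3 := is_derive_coord j i x.
  by apply: is_derive_eq; rewrite /GRing.scale/=; ring.
apply: is_derive_eq (is_deriveM d1 d2) _; rewrite /D2u /GRing.scale/=; ring.
Qed.

Let cDu (i : 'I_n) (x : 'rV[R]_n) : B x -> x != 0 -> {for x, continuous (Du i)}.
Proof.
move=> Bx x0; have c1 := comp_cont (cw1 (sD Bx x0)).
have c2 : {for x, continuous (fun y : 'rV[R]_n => 2 * y ord0 i)}.
  by have h := @coord_cont i x; exact: (cvgMl_tmp h).
exact: (cvgM c1 c2).
Qed.

Let xx_le (i j : 'I_n) (x : 'rV[R]_n) : `|x ord0 i * x ord0 j| <= sqn x.
Proof.
have k i' : `|x ord0 i'| <= Num.sqrt (sqn x).
  by rewrite -sqrtr_sqr ler_wsqrtr// sqr_le_sqn.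
by rewrite normrM -[leRHS](sqr_sqrtr (sqn_ge0 x)) expr2 ler_pM.
Qed.

Let x_le (i : 'I_n) (x : 'rV[R]_n) : B x -> `|x ord0 i| <= r.
Proof.
move=> /(eball_sqn _ r0)/ltW h.
rewrite -(@ler_pXn2r _ 2)// ?nnegrE ?(ltW r0)// real_normK ?num_real//.
exact: le_trans (sqr_le_sqn x i) h.
Qed.

Let m_bounds t : 0 < t < rho -> 0 <= m t <= C1 * t `^ (c / p).
Proof. by move=> tD; rewrite (mass_ge0 f0 tD) (mass_le f0 hb tD). Qed.

Let VP e t : 0 <= e -> 0 < t < rho -> V t `^ e <= C2 `^ e * t `^ (- (be * e)).
Proof.
move=> e0 tD; have /andP[V0 V1] := VC tD.
apply: (@le_trans _ _ ((C2 * t `^ (- be)) `^ e)).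
  by rewrite ge0_ler_powR// ?nnegrE ?(ltW V0)// mulr_ge0 ?powR_ge0.
by rewrite powRM ?powR_ge0// -powRrM mulNr.
Qed.

Let tpow t e1 e2 : 0 < t -> t `^ e1 * t `^ e2 = t `^ (e1 + e2).
Proof. by move=> t0; rewrite powRD// (gt_eqF t0) implybT. Qed.

Let t_nu_m t : 0 < t < rho -> t `^ (- nu) * m t <= C1 * t `^ (- nu + c / p).
Proof.
move=> tD; have /andP[t0 _] := tD; have /andP[_ m1] := m_bounds tD.
by rewrite -tpow// mulrCA ler_wpM2l ?powR_ge0.
Qed.

Let L1u : L1 B u.
Proof.
apply: (@L1_sqn_powR r (- al) C1) => //; first by rewrite ltrN2.
- by move=> x Bx x0; apply: comp_cont; exact: cU (sD Bx x0).
- move=> x Bx x0; rewrite /= off0E//.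
  have /andP[u0 u1] := UC (sD Bx x0).
  by rewrite gtr0_norm.
Qed.

Let L1Du i : L1 B (Du i).
Proof.
apply: (@L1_sqn_powR r (- nu + c / p) (l * C1 * (2 * r))) => //; first by rewrite ltrDl.
- by move=> x; exact: cDu.
- move=> x Bx x0; have tD := sD Bx x0; have /andP[t0 _] := tD.
  rewrite /Du /w1 mulNr normrN normrM ger0_norm; last first.
    by rewrite !mulr_ge0 ?powR_ge0 ?(ltW l0)//; have /andP[] := m_bounds tD.
  rewrite -[leLHS]mulrA [leRHS](_ : _ = l * ((C1 * sqn x `^ (- nu + c / p)) * (2 * r))); last by ring.
  rewrite ler_wpM2l ?(ltW l0)// ler_pM ?mulr_ge0 ?powR_ge0 ?t_nu_m//.
    by have /andP[] := m_bounds tD.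
  by rewrite normrM normr_nat ler_wpM2l// x_le.
Qed.


Let cD2u (i j : 'I_n) (x : 'rV[R]_n) : B x -> x != 0 -> {for x, continuous (D2u i j)}.
Proof.
move=> Bx x0; have tD := sD Bx x0.
have c1 := comp_cont (cw1 tD); have c2 := comp_cont (cw2 tD).
have k i' : {for x, continuous (fun y : 'rV[R]_n => 2 * y ord0 i')}.
  by have h := @coord_cont i' x; exact: (cvgMl_tmp h).
have k0 : {for x, continuous (fun _ : 'rV[R]_n => 2 * (i == j)%:R : R)} by exact: cst_continuous.
exact: (cvgD (cvgM (cvgM c2 (k j)) (k i)) (cvgM c1 k0)).
Qed.

Let fE t : f t = t `^ (c - 1) * V t `^ (p - 1).
Proof. by []. Qed.

Let f_le t : 0 < t < rho -> 0 <= f t <= C2 `^ (p - 1) * t `^ (c - 1 - be * (p - 1)).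
Proof.
move=> tD; have /andP[t0 _] := tD.
rewrite fE mulr_ge0 ?powR_ge0//= -(tpow (c - 1) _ t0) mulrCA ler_wpM2l ?powR_ge0// VP//.
by rewrite subr_ge0 ltW.
Qed.

Let bep : be * (p - 1) < c.
Proof. by apply: le_lt_trans bec; rewrite ler_wpM2l ?(ltW be0)// gerBl. Qed.

(** [D2u] = [D2u1] - [D2u2] separates the terms in m from the one in f. As |x_i x_j| <= t, they are
    of order t^(- nu + c/p) and t^(c - nu - be (p - 1)), both exponents being above - nu. *)
Let D2u1 (i j : 'I_n) (x : 'rV[R]_n) : R :=
  l * (nu * sqn x `^ (- nu - 1) * m (sqn x)) * (2 * x ord0 j) * (2 * x ord0 i) + w1 (sqn x) * (2 * (i == j)%:R).

Let D2u2 (i j : 'I_n) (x : 'rV[R]_n) : R :=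
  l * (sqn x `^ (- nu) * f (sqn x)) * (2 * x ord0 j) * (2 * x ord0 i).

Let L1D2u1 (i j : 'I_n) : L1 B (D2u1 i j).
Proof.
apply: (@L1_sqn_powR r (- nu + c / p) (l * C1 * (4 * nu + 2))) => //; first by rewrite ltrDl.
- move=> x Bx x0; have tD := sD Bx x0; have /andP[t0 _] := tD.
  have c1 : {for sqn x, continuous (fun s => l * (nu * s `^ (- nu - 1) * m s))}.
    have h : {for sqn x, continuous (fun s => s `^ (- nu - 1))} by exact: continuous_powR.
    exact: (cvgMl_tmp (cvgM (cvgMl_tmp h) (cm tD))).
  have c2 := comp_cont c1; have c3 := comp_cont (cw1 tD).
  have k i' : {for x, continuous (fun y : 'rV[R]_n => 2 * y ord0 i')}.
    by have h := @coord_cont i' x; exact: (cvgMl_tmp h).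
  have k0 : {for x, continuous (fun _ : 'rV[R]_n => 2 * (i == j)%:R : R)} by exact: cst_continuous.
  exact: (cvgD (cvgM (cvgM c2 (k j)) (k i)) (cvgM c3 k0)).
- move=> x Bx x0; have tD := sD Bx x0; have /andP[t0 _] := tD.
  have /andP[m0 m1] := m_bounds tD; have h := t_nu_m tD; have h2 := xx_le j i x.
  set t := sqn x in t0 m0 h h2 *.
  have E : t `^ (- nu - 1) * t = t `^ (- nu).
    by rewrite -[X in _ * X](powRr1 (ltW t0)) tpow// subrK.
  apply: le_trans (ler_normD _ _) _.
  rewrite [leRHS](_ : _ = l * nu * 4 * (C1 * t `^ (- nu + c / p)) + l * (C1 * t `^ (- nu + c / p)) * 2); last by ring.
  apply: lerD.
    rewrite (_ : _ * _ * _ = l * nu * 4 * (t `^ (- nu - 1) * m t) * (x ord0 j * x ord0 i)); last by ring.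
    have k0 : 0 <= l * nu * 4 * (t `^ (- nu - 1) * m t) by rewrite !mulr_ge0 ?powR_ge0 ?(ltW l0).
    rewrite normrM ger0_norm//; apply: (le_trans (ler_wpM2l k0 h2)).
    rewrite -[leLHS]mulrA ler_wpM2l ?mulr_ge0 ?(ltW l0)//.
    by rewrite mulrAC E.
  have k0 : 0 <= l * (t `^ (- nu) * m t) by rewrite !mulr_ge0 ?powR_ge0 ?(ltW l0).
  rewrite /w1 normrM normrN (ger0_norm k0); apply: ler_pM => //.
    by rewrite ler_wpM2l ?(ltW l0).
  by rewrite normrM !normr_nat ler_piMr// lern1 leq_b1.
Qed.

Let L1D2u2 (i j : 'I_n) : L1 B (D2u2 i j).
Proof.
apply: (@L1_sqn_powR r (c - nu - be * (p - 1)) (l * 4 * C2 `^ (p - 1))) => //; first by have := bep; lra.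
- move=> x Bx x0; have tD := sD Bx x0; have /andP[t0 _] := tD.
  have c1 : {for sqn x, continuous (fun s => l * (s `^ (- nu) * f s))}.
    have h : {for sqn x, continuous (fun s => s `^ (- nu))} by exact: continuous_powR.
    exact: (cvgMl_tmp (cvgM h (cf tD))).
  have c2 := comp_cont c1.
  have k i' : {for x, continuous (fun y : 'rV[R]_n => 2 * y ord0 i')}.
    by have h := @coord_cont i' x; exact: (cvgMl_tmp h).
  exact: (cvgM (cvgM c2 (k j)) (k i)).
- move=> x Bx x0; have tD := sD Bx x0; have /andP[t0 _] := tD.
  have /andP[m0 m1] := f_le tD; have h2 := xx_le j i x.
  rewrite /D2u2; move: (f (sqn x)) m0 m1 => ft m0 m1; set t := sqn x in t0 m1 h2 *.
  have E : t `^ (- nu) * t `^ (c - 1 - be * (p - 1)) * t = t `^ (c - nu - be * (p - 1)).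
    by rewrite -[X in _ * X](powRr1 (ltW t0)) !tpow//; congr (_ `^ _); ring.
  rewrite (_ : _ * _ * _ = l * 4 * (t `^ (- nu) * ft) * (x ord0 j * x ord0 i)); last by ring.
  have k0 : 0 <= l * 4 * (t `^ (- nu) * ft) by rewrite !mulr_ge0 ?powR_ge0 ?(ltW l0).
  rewrite normrM ger0_norm//; apply: (le_trans (ler_wpM2l k0 h2)).
  rewrite -E -!mulrA !(ler_wpM2l (ltW l0)) ?ler_wpM2l//.
  rewrite [leRHS]mulrCA ler_wpM2l ?powR_ge0//.
  by rewrite mulrA ler_wpM2r// ltW.
Qed.

Let L1D2u (i j : 'I_n) : L1 B (D2u i j).
Proof.
have -> : D2u i j = (fun x => D2u1 i j x - D2u2 i j x).
  by apply/funext => x; rewrite /D2u /D2u1 /D2u2 /w2; ring.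
rewrite /L1 (_ : EFin \o _ = ((EFin \o D2u1 i j) \- (EFin \o D2u2 i j))%E)//.
by apply: integrableB => //; [exact: measurable_eball|exact: L1D2u1|exact: L1D2u2].
Qed.

Let rhs (x : 'rV[R]_n) : R := (4 * l) * enorm x `^ a * v x `^ (p - 1).

Let cv (x : 'rV[R]_n) : B x -> x != 0 -> {for x, continuous v}.
Proof.
move=> Bx x0; have tD := sD Bx x0; have /andP[t0 _] := tD.
by apply: comp_cont; apply: coff => //; exact: cV.
Qed.

Let c_sqn e (x : 'rV[R]_n) : x != 0 -> {for x, continuous (fun y : 'rV[R]_n => enorm y `^ e)}.
Proof.
move=> x0; rewrite (_ : (fun y => _) = (fun s => s `^ (e / 2)) \o @sqn R n).
  by apply: comp_cont; apply: continuous_powR; exact: sqn_gt0.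
by apply/funext => y; rewrite enorm_powR.
Qed.

Let cvp e (x : 'rV[R]_n) : B x -> x != 0 -> {for x, continuous (fun y : 'rV[R]_n => v y `^ e)}.
Proof.
move=> Bx x0; have tD := sD Bx x0.
apply: (@continuous_comp _ _ _ v (fun s => s `^ e)); first exact: cv.
apply: continuous_powR; rewrite /= off0E//.
by have /andP[] := VC tD.
Qed.

(** Used with e = p - 1 for the right-hand side of the equation and with e = p for the finiteness of
    the weighted norm of v. *)
Lemma weak_poisson_powR_L1 e : 0 <= e -> e <= p ->
  L1 B (fun x => enorm x `^ a * v x `^ e).
Proof.
move=> e0 ep; apply: (@L1_sqn_powR r (a / 2 - be * e) (C2 `^ e)) => //.
- have : be * e <= be * p by rewrite ler_wpM2l// ltW.
  by have := bec; lra.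
- by move=> x Bx x0; exact: (cvgM (c_sqn (e := a) x0) (cvp (e := e) Bx x0)).
- move=> x Bx x0; have tD := sD Bx x0; have /andP[t0 _] := tD.
  rewrite ger0_norm ?mulr_ge0 ?powR_ge0// enorm_powR /= off0E// -(tpow (a / 2) _ t0) mulrCA.
  by rewrite ler_wpM2l ?powR_ge0 ?VP.
Qed.

Let L1rhs : L1 B rhs.
Proof.
rewrite /L1 (_ : EFin \o rhs = (fun x => (4 * l)%:E * (EFin \o (fun x => (enorm x `^ a * v x `^ (p - 1))%R)) x)%E).
  apply: integrableZl; first exact: measurable_eball.
  by apply: weak_poisson_powR_L1; rewrite ?subr_ge0 ?(ltW p1)// gerBl.
by apply/funext => x; rewrite /rhs /= -EFinM mulrA.
Qed.

(** The sum is 4 t w2 + 2 n w1; as n = 2 nu the terms in m cancel and - 4 l t^(1 - nu) f remains,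
    where t^(1 - nu) t^(c - 1) = t^(a/2). *)
Let lapE (x : 'rV[R]_n) : B x -> x != 0 -> - \sum_i D2u i i x = rhs x.
Proof.
move=> Bx x0; have tD := sD Bx x0; have /andP[t0 _] := tD.
have -> : \sum_i D2u i i x = w2 (sqn x) * 4 * sqn x + w1 (sqn x) * 2 * n%:R.
  rewrite /D2u big_split/=; congr (_ + _).
    rewrite /sqn mulr_sumr; apply: eq_bigr => i _; ring.
  rewrite (eq_bigr (fun=> w1 (sqn x) * 2)); last by move=> i _; rewrite eqxx mulr1.
  by rewrite sumr_const card_ord [RHS]mulr_natr.
rewrite /rhs /= off0E// enorm_powR /w1 /w2 fE.
set t := sqn x in t0 *; set w := V t `^ (p - 1).
have E1 : t `^ (- nu - 1) * t = t `^ (- nu).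
  by rewrite -[X in _ * X](powRr1 (ltW t0)) tpow// subrK.
have E2 : t `^ (- nu) * t `^ (c - 1) * t = t `^ (a / 2).
  by rewrite -[X in _ * X](powRr1 (ltW t0)) !tpow//; congr (_ `^ _); ring.
by rewrite -E2 -E1; field.
Qed.

Let ucore : [/\ W1 2 B u, forall i, weak_partials B [:: i] u (Du i) &
   forall f, L1 B f -> (forall x, B x -> x != 0 -> - \sum_i D2u i i x = f x) -> weak_poisson B u f].
Proof.
apply: (@weak_partials_C2 R n r r0 u Du D2u) => //.
- move=> i x Bx x0; apply: is_derive_sqn_comp; exact: dU (sD Bx x0).
- by move=> x Bx x0; apply: comp_cont; exact: cU (sD Bx x0).
Qed.

Lemma radial_component : [/\ weak_poisson B u (fun x => (4 * l) * enorm x `^ a * v x `^ (p - 1)),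
  forall x, B x -> 0 < u x, radial_on B u, W1 2 B u /\ W11_0 B u &
  (\int[lebesgue_rV n]_(x in B) (enorm x `^ a * `|v x| `^ p)%:E < +oo)%E].
Proof.
have [uW wp wpo] := ucore; split.
- exact: wpo.
- move=> x Bx; rewrite /= /off0; case: (leP (sqn x) 0) => // x0.
  by have /andP[] : 0 < U (sqn x) <= C1 * sqn x `^ (- al) by apply: UC; rewrite x0; exact/(eball_sqn _ r0).
- by exists (fun s => off0 U (s ^+ 2)) => x _; rewrite /= enormE sqr_sqrtr ?sqn_ge0.
- split; first exact: uW.
  have uE x : B x -> x != 0 -> u x = l * green nu rho f (sqn x).
    by move=> Bx x0; rewrite /= off0E// UE.
  by have := W11_0_radial r0 f0 mf hb fin n0 uE (fun _ _ _ _ => erefl) L1u L1Du wp.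
- have /integrableP[_] := weak_poisson_powR_L1 (ltW p0) (lexx p).
  move=> h; apply: le_lt_trans h; rewrite le_eqVlt; apply/orP; left; apply/eqP.
  apply: eq_integral => x /[!inE] Bx /=.
  rewrite [in RHS]ger0_norm ?mulr_ge0 ?powR_ge0//.
  rewrite ger0_norm// /off0; case: (leP (sqn x) 0) => // x0.
  suff /andP[/ltW] : 0 < V (sqn x) <= C2 * sqn x `^ (- be) by [].
  by apply: VC; rewrite x0; exact/(eball_sqn _ r0).
Qed.

End radial_component.

(** al is the midpoint between max(0, m - X) and min(Y, m). It is applied with m = nu - 1, once for
    each order of c/p and d/q. *)
Lemma intermediate_exponent (R : realType) (X Y m : R) :
  0 < X -> 0 < Y -> 0 < m -> m < X + Y ->
  exists al, [/\ 0 < al, al < Y, al < m & m <= X + al].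
Proof.
move=> X0 Y0 m0 XY; have [mX|mX] := leP m X; have [Ym|Ym] := leP Y m.
- by exists (Y / 2); split; lra.
- by exists (m / 2); split; lra.
- by exists ((m - X + Y) / 2); split; lra.
- by exists ((m - X + m) / 2); split; lra.
Qed.

Lemma radial_half_continuous (R : realType) (nu rho c r l X e C : R) (V U : R -> R) :
  0 <= nu -> 0 <= C -> 0 <= X -> measurable_fun (`]0%R, rho[%classic : set R) V ->
  radial_half nu rho c r l X e C V U ->
  forall t, 0 < t < rho -> {for t, continuous U}.
Proof.
move=> nu0 C0 X0 mV [hb fin _ UE _] t tD.
have -> : U = fun s => l * green nu rho (src c r V) s by exact/funext.
apply: cvgMl_tmp; apply: (continuous_green nu0 _ _ C0 X0 hb fin tD).
- by move=> s _; exact: src_ge0.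
- exact: measurable_src.
Qed.

Theorem theorem1p5 (R : realType) (n : nat) (p q a b r : R) :
  (3 <= n)%N -> 1 < p -> 1 < q -> 0 < r ->
  - n%:R < a -> - n%:R < b ->
  n%:R - 2 < (a + n%:R) / p + (b + n%:R) / q ->
  let B : set 'rV[R]_n := eball r in
  exists lambda1 lambda2 : R, [/\ 0 < lambda1, 0 < lambda2 &
    exists u v : 'rV[R]_n -> R,
      [/\ weak_poisson B u
            (fun x => lambda1 * enorm x `^ a * v x `^ (p - 1)),
          weak_poisson B v
            (fun x => lambda2 * enorm x `^ b * u x `^ (q - 1)) &
          forall x, B x -> 0 < u x /\ 0 < v x] /\
      [/\ radial_on B u, radial_on B v,
          W1 2 B u /\ W11_0 B u & W1 2 B v /\ W11_0 B v] /\
      (\int[lebesgue_rV n]_(x in B)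
          (enorm x `^ b * `|u x| `^ q)%:E < +oo)%E /\
      (\int[lebesgue_rV n]_(x in B)
          (enorm x `^ a * `|v x| `^ p)%:E < +oo)%E].
Proof.
move=> n3 p1 q1 r0 an bn abpq B.
have p0 : 0 < p by lra.
have q0 : 0 < q by lra.
have n3R : 3 <= n%:R :> R by rewrite ler_nat.
pose nu : R := n%:R / 2; pose c := nu + a / 2; pose d := nu + b / 2.
(* n >= 3 leaves room for positive exponents below nu - 1; being below nu, they make |x|^(- 2 al)
   and |x|^(- 2 be) integrable. *)
have nu1 : 0 < nu - 1 by rewrite /nu; lra.
have nu0 : 0 <= nu by lra.
have c0 : 0 < c by rewrite /c /nu; lra.
have d0 : 0 < d by rewrite /d /nu; lra.
have cp0 : 0 < c / p by exact: divr_gt0.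
have dq0 : 0 < d / q by exact: divr_gt0.
have cd : nu - 1 < c / p + d / q.
  have -> : c / p + d / q = ((a + n%:R) / p + (b + n%:R) / q) / 2.
    by rewrite /c /d /nu; field; rewrite !gt_eqF.
  by rewrite /nu; lra.
have [al [al0 aldq alnu ala]] := intermediate_exponent cp0 dq0 nu1 cd.
have dc : nu - 1 < d / q + c / p by rewrite [ltRHS]addrC.
have [be [be0 becp benu beb]] := intermediate_exponent dq0 cp0 nu1 dc.
have alq : al * q < d by rewrite -ltr_pdivlMr.
have bep : be * p < c by rewrite -ltr_pdivlMr.
have alnu' : al < nu by lra.
have benu' : be < nu by lra.
have rho0 : 0 < r ^+ 2 by rewrite exprn_gt0.
have [l [C1 [C2 [U [V [l0 C10 C20 hU hV]]]]]] :=
  radial_pair_exists rho0 nu0 c0 d0 p1 q1 al0 alq ala be0 bep beb.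
have mU : measurable_fun (`]0%R, r ^+ 2[%classic : set R) U by case: hU.
have mV : measurable_fun (`]0%R, r ^+ 2[%classic : set R) V by case: hV.
have UC : forall t, 0 < t < r ^+ 2 -> 0 < U t <= C1 * t `^ (- al) by case: hU.
have VC : forall t, 0 < t < r ^+ 2 -> 0 < V t <= C2 * t `^ (- be) by case: hV.
have cU := radial_half_continuous nu0 C10 (ltW cp0) mV hU.
have cV := radial_half_continuous nu0 C20 (ltW dq0) mU hV.
have [u1 u2 u3 u4 u5] :=
  radial_component r0 n3 p1 ltr01 c0 be0 bep alnu' C20 VC mV cV hU.
have [v1 v2 v3 v4 v5] :=
  radial_component r0 n3 q1 l0 d0 al0 alq benu' C10 UC mU cU hV.
(* The 4 of the Laplacian in t times the scalar of each half, which is 1 for U and l for V. *)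
exists (4 * 1), (4 * l); split; [by rewrite mulr1 | by rewrite mulr_gt0|].
exists (off0 U \o @sqn R n), (off0 V \o @sqn R n); split; last by split.
by split => // x Bx; split; [exact: u2|exact: v2].
Qed.
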